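(* Let $K$ be an algebraically closed field of characteristic $0$ and let $C\subset\mathbb{P}^2$ be the plane curve over $K$ defined by $X^6+Y^6+Z^6-10(X^3Y^3+Y^3Z^3+Z^3X^3)=0$. Then $$G_3(C)=\mathrm{Aut}(C).$$
   Context: For $P\in\mathbb{P}^2$, $\pi_P:C\dashrightarrow\mathbb{P}^1$ is the projection from $P$, and $G[P]=\{\tau\in\mathrm{Bir}(C)\mid \pi_P\circ\tau=\pi_P\}$. $P$ is called quasi-Galois if $|G[P]|\ge 2$. For smooth $C$ and $n\ge 2$, $G_n(C)=\langle G[P]\mid P\in\mathbb{P}^2 \text{ quasi-Galois with } |G[P]|=n\rangle\subset\mathrm{Aut}(C)$ is the subgroup generated by all these groups $G[P]$. *)

(* Defs.v *)
From HB Require Import structures.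
From mathcomp Require Import all_boot all_order all_algebra.
From mathcomp Require Export mpoly.

Set Implicit Arguments.
Unset Strict Implicit.
Unset Printing Implicit Defensive.

Import GRing.Theory.
Local Open Scope ring_scope.

(* A point of P^2 is given by homogeneous coordinates, i.e. by a nonzero row
   vector up to scaling; all the notions below are invariant under scaling.
   A curve C is given by a homogeneous form F; the definitions of rational maps
   follow the usual ones for an irreducible variety C. *)
Section PlaneCurve.

Variables (K : closedFieldType) (F : {mpoly K[3]}).

Definition on_curve (v : 'rV[K]_3) : Prop := v != 0 /\ F.@[v 0] = 0.

(* For homogeneous g: membership in the homogeneous ideal I(C). *)
Definition vanishes (g : {mpoly K[3]}) : Prop :=
  forall v : 'rV[K]_3, on_curve v -> g.@[v 0] = 0.

(* [t_0 : ... : t_(n-1)] represents a rational map from C to P^(n-1). *)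
Definition is_ratmap n (t : n.-tuple {mpoly K[3]}) : Prop :=
  (exists d : nat, forall i : 'I_n, tnth t i \is d.-homog) /\
  (exists i : 'I_n, ~ vanishes (tnth t i)).

(* Equality of the rational maps represented by s and t.  Requiring both to be
   genuine representatives matters: the zero tuple satisfies the cross relations
   with every tuple. *)
Definition same_map n (s t : n.-tuple {mpoly K[3]}) : Prop :=
  [/\ is_ratmap s, is_ratmap t
    & forall i j : 'I_n,
        vanishes (tnth s i * tnth t j - tnth s j * tnth t i)].

Definition is_selfmap (t : 3.-tuple {mpoly K[3]}) : Prop :=
  is_ratmap t /\ vanishes (F \mPo t).

(* s after t *)
Definition rcomp n (s : n.-tuple {mpoly K[3]}) (t : 3.-tuple {mpoly K[3]}) :
    n.-tuple {mpoly K[3]} :=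
  [tuple tnth s i \mPo t | i < n].

Definition ratid : 3.-tuple {mpoly K[3]} := [tuple 'X_i | i < 3].

Definition inverse_maps (s t : 3.-tuple {mpoly K[3]}) : Prop :=
  [/\ is_selfmap s, is_selfmap t,
      same_map (rcomp s t) ratid & same_map (rcomp t s) ratid].

(* t represents an element of Bir(C); two representatives of the same element
   are related by same_map. *)
Definition in_Bir (t : 3.-tuple {mpoly K[3]}) : Prop :=
  exists s, inverse_maps s t.

Definition regular_at (t : 3.-tuple {mpoly K[3]}) (v : 'rV[K]_3) : Prop :=
  exists2 s, same_map t s & exists i : 'I_3, (tnth s i).@[v 0] != 0.

Definition is_morphism (t : 3.-tuple {mpoly K[3]}) : Prop :=
  is_selfmap t /\ forall v : 'rV[K]_3, on_curve v -> regular_at t v.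

Definition in_Aut (t : 3.-tuple {mpoly K[3]}) : Prop :=
  exists s, [/\ is_morphism s, is_morphism t & inverse_maps s t].

(* p is the projection from the point P: it is given by two independent linear
   forms vanishing at P, which is unique up to an automorphism of P^1. *)
Definition is_projection_from (P : 'rV[K]_3) (p : 2.-tuple {mpoly K[3]}) :
    Prop :=
  exists A : 'M[K]_(3, 2),
    [/\ \rank A = 2%N, P *m A = 0
      & p = [tuple \sum_(i < 3) A i j *: 'X_i | j < 2]].

Definition in_G (P : 'rV[K]_3) (t : 3.-tuple {mpoly K[3]}) : Prop :=
  in_Bir t /\
  exists2 p, is_projection_from P p & same_map (rcomp p t) p.

(* A set S of birational maps, closed under same_map, has exactly n elements. *)
Definition has_card (S : 3.-tuple {mpoly K[3]} -> Prop) (n : nat) : Prop :=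
  exists e : 'I_n -> 3.-tuple {mpoly K[3]},
    [/\ forall i, S (e i),
        forall i j, same_map (e i) (e j) -> i = j
      & forall t, S t -> exists i, same_map t (e i)].

Definition quasi_Galois (P : 'rV[K]_3) : Prop :=
  exists s t, [/\ in_G P s, in_G P t & ~ same_map s t].

Inductive generated (S : 3.-tuple {mpoly K[3]} -> Prop) :
    3.-tuple {mpoly K[3]} -> Prop :=
| generated_in t : S t -> generated S t
| generated_id : generated S ratid
| generated_comp s t :
    generated S s -> generated S t -> generated S (rcomp s t)
| generated_inv s t : generated S s -> inverse_maps s t -> generated S t
| generated_same s t : generated S s -> same_map s t -> generated S t.

Definition in_Gn (n : nat) : 3.-tuple {mpoly K[3]} -> Prop :=
  generated (fun t => exists P : 'rV[K]_3,
    [/\ P != 0, quasi_Galois P, has_card (in_G P) n & in_G P t]).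

End PlaneCurve.

Definition sextic (K : closedFieldType) : {mpoly K[3]} :=
  let X := 'X_(inord 0) in
  let Y := 'X_(inord 1) in
  let Z := 'X_(inord 2) in
  X ^+ 6 + Y ^+ 6 + Z ^+ 6
  - 10%:R *: (X ^+ 3 * Y ^+ 3 + Y ^+ 3 * Z ^+ 3 + Z ^+ 3 * X ^+ 3).

(* Main.v *)
(* A birational self-map t of C is linear.  Since C is nonsingular, t is regular at every
   point, so it pulls holomorphic differentials, the residues of g Omega / F with g a cubic
   form, back to holomorphic differentials.  This turns the products t_i t_j t_k, up to a
   common factor, into cubics C_ijk that span all cubics.  The 2 x 2 minors of this array
   have degree 6 and vanish on C; they turn out to vanish identically, so the C_ijk extend t
   to the whole plane as the composite of a linear map with the Veronese map: C_01k is r_k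
   times two fixed linear forms, and (r_0 : r_1 : r_2) represents t.
   For a linear map Phi preserving F up to a factor and P = Phi(0,0,1), the group G[P]
   consists of the three maps Phi diag(1,1,z) Phi^-1 with z^3 = 1, so all of these lie in
   G_3(C).  Conversely, let M preserve F up to a factor.  If the i-th coordinate of M u is 0
   then the Hessian of F is singular at u; as the Hessian determinant of F is a product of
   twelve lines, every row of M is proportional to one of these.  Homologies of order 3 move
   the last row to a multiple of (0,0,1); then M is monomial, and monomial automorphisms are
   products of such homologies. *)

Require Import Defs.
From HB Require Import structures.
From mathcomp Require Import all_boot all_order all_algebra all_field all_fingroup.
From mathcomp Require Import ring zify.
From Stdlib Require Import Classical.

Set Implicit Arguments.
Unset Strict Implicit.
Unset Printing Implicit Defensive.

Import GRing.Theory.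
Local Open Scope ring_scope.

(** * Polynomials in several variables *)

(** Common factors are cancelled on C throughout, so the coordinate ring of C must be a domain.
    Written as [Z^6 - s Z^3 + n] over K[x,y], F is irreducible: on suitable lines [s^2 - 4n] and [n]
    have a simple root, so the first is no square and the second no cube, and the substitution of
    [w Z] for [Z] excludes the remaining factorizations. The place of cohomology is taken by one
    fact, that an everywhere regular quotient of degree m on C is a form of degree m: a norm to
    K[x,y] clears the denominator, whose linear factors are then cancelled one at a time. That the
    cubics C_iii contain lines comes from the identity C_iii^2 C_jjj = C_iij^3, which forces zeros
    of multiplicity 3. The group behind the last part is the complex reflection group of order 648
    (number 25 of Shephard and Todd). F is its invariant of degree 6 and the twelve lines are its
    mirrors; they form the four triangles of the Hesse pencil spanned by x^3 + y^3 + z^3 and xyz. *)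

Lemma mpoly_ring_ind (n : nat) (R : comNzRingType) (P : {mpoly R[n]} -> Prop) :
  (forall c, P c%:MP) -> (forall i, P 'X_i) ->
  (forall p q, P p -> P q -> P (p + q)) ->
  (forall p q, P p -> P q -> P (p * q)) -> forall p, P p.
Proof.
move=> PC PX PD PM; elim/mpolyind => [|c m p _ _ Pp]; first by rewrite -mpolyC0; apply: PC.
apply: (PD) => //; rewrite -mul_mpolyC; apply: (PM) => //.
rewrite mpolyXE_id; elim/big_ind: _ => [||i _]; first by rewrite -mpolyC1; apply: PC.
  by move=> x y; apply: (PM).
by elim: (m i) => [|k IH]; rewrite ?expr0 ?exprS -?mpolyC1; [apply: PC|apply: (PM)].
Qed.

Section Zero.
Variable K : closedFieldType.

(** If [p] vanishes everywhere, [p + 1] has no root, and over a closed field only nonzero constants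
    have none. *)
Lemma poly_zero_fun (p : {poly K}) : (forall x, p.[x] = 0) -> p = 0.
Proof.
move=> p0; have /closed_rootP : ~ exists x, root (p + 1) x.
  by move=> [x]; rewrite rootE !hornerE p0 add0r oner_eq0.
move=> /size_poly1P [c _ pc].
have pE : p = (c - 1)%:P by rewrite polyCB -pc addrK.
by have := p0 0; rewrite pE hornerC => ->.
Qed.

Definition mfirst n (v : 'I_n.+1 -> K) : 'I_n -> K :=
  fun i => v (widen_ord (leqnSn n) i).

Definition mappend n (v : 'I_n -> K) (x : K) : 'I_n.+1 -> K :=
  fun j => if insub (val j) is Some k then v k else x.

Lemma mfirst_append n (v : 'I_n -> K) x : mfirst (mappend v x) =1 v.
Proof. by move=> j; rewrite /mfirst /mappend /= valK. Qed.

Lemma mappend_max n (v : 'I_n -> K) x : mappend v x ord_max = x.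
Proof. by rewrite /mappend insubF //= ltnn. Qed.

Lemma muni_widen n (R : comNzRingType) (i : 'I_n) :
  muni ('X_(widen_ord (leqnSn n) i) : {mpoly R[n.+1]}) = ('X_i)%:P.
Proof.
rewrite muniE msuppX big_seq1 mcoeffX eqxx scale1r mnm1E.
have -> : (widen_ord (leqnSn n) i == ord_max) = false.
  by apply/negbTE; rewrite -val_eqE /= neq_ltn ltn_ord.
rewrite expr0 -mul_polyC mulr1; congr ('X_[_]%:P).
by apply/mnmP => j; rewrite mnmE !mnm1E -!val_eqE.
Qed.

Lemma muni_max n (R : comNzRingType) :
  muni ('X_ord_max : {mpoly R[n.+1]}) = 'X.
Proof.
rewrite muniE msuppX big_seq1 mcoeffX eqxx scale1r mnm1E eqxx expr1.
rewrite -[RHS]scale1r -mpolyX0; congr ('X_[_] *: _).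
by apply/mnmP => j; rewrite mnmE mnm1E mnm0E -val_eqE /= gtn_eqF.
Qed.

Lemma ord_max_widen n (i : 'I_n.+1) :
  i = ord_max \/ exists j, i = widen_ord (leqnSn n) j.
Proof.
case: (ltnP i n) => [lt_in|le_ni]; [right|left].
  by exists (Ordinal lt_in); apply: val_inj.
by apply: val_inj; apply/eqP; rewrite eqn_leq le_ni -ltnS ltn_ord.
Qed.

Lemma muni_eval n (v : 'I_n.+1 -> K) (p : {mpoly K[n.+1]}) :
  (map_poly (meval (mfirst v)) (muni p)).[v ord_max] = p.@[v].
Proof.
elim/mpoly_ring_ind: p => [c|i|p q IHp IHq|p q IHp IHq].
- by rewrite muniC map_polyC /= hornerC !mevalC.
- rewrite mevalXU; case: (ord_max_widen i) => [->|[j ->]].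
    by rewrite muni_max map_polyX hornerX.
  by rewrite muni_widen map_polyC hornerC /= mevalXU.
- by rewrite muniD mevalD -IHp -IHq -hornerD; congr (_.[_]); apply: rmorphD.
- by rewrite muniM mevalM -IHp -IHq -hornerM; congr (_.[_]); apply: rmorphM.
Qed.

Lemma muni_eval_append n (v : 'I_n -> K) x (p : {mpoly K[n.+1]}) :
  (map_poly (meval v) (muni p)).[x] = p.@[mappend v x].
Proof.
rewrite -muni_eval mappend_max; congr (_.[_]).
by apply: eq_map_poly => q; apply: meval_eq => j; rewrite mfirst_append.
Qed.

(** Left inverse of [muni]: it carries identities found for polynomials in the last variable back to
    [n.+1] variables. *)
Definition unmuni n (R : comNzRingType) (p : {poly {mpoly R[n]}}) :
  {mpoly R[n.+1]} := (map_poly (@mwiden n R) p).['X_ord_max].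

Lemma unmuniD n (R : comNzRingType) : {morph @unmuni n R : p q / p + q}.
Proof. by move=> p q; rewrite /unmuni rmorphD hornerD. Qed.

Lemma unmuniM n (R : comNzRingType) : {morph @unmuni n R : p q / p * q}.
Proof. by move=> p q; rewrite /unmuni rmorphM hornerM. Qed.

Lemma muniK n (R : comNzRingType) : cancel (@muni n R) (@unmuni n R).
Proof.
elim/mpoly_ring_ind => [c|i|p q IHp IHq|p q IHp IHq].
- by rewrite /unmuni muniC map_polyC /= hornerC mwidenC.
- rewrite /unmuni; case: (ord_max_widen i) => [->|[j ->]].
    by rewrite muni_max map_polyX hornerX.
  rewrite muni_widen map_polyC hornerC /= mwidenX; congr 'X_[_].
  by rewrite mnmwiden1.
- by rewrite muniD unmuniD; congr (_ + _).
- by rewrite muniM unmuniM; congr (_ * _).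
Qed.

Lemma mpoly_zero_fun n (p : {mpoly K[n]}) : (forall v, p.@[v] = 0) -> p = 0.
Proof.
elim: n p => [|n IH] p p0.
  by rewrite (nvar0_mpolyC p) in p0 *; have := p0 (fun _ => 0); rewrite mevalC => ->.
apply: (can_inj (@muniK n K)); rewrite muni0; apply/polyP => i; rewrite coef0.
apply: IH => v.
have: map_poly (meval v) (muni p) = 0.
  apply: poly_zero_fun => x.
  by rewrite -[RHS](p0 (mappend v x)) -muni_eval_append.
by move/polyP/(_ i); rewrite coef_map coef0.
Qed.

Lemma mpoly_fun_inj n (p q : {mpoly K[n]}) : (forall v, p.@[v] = q.@[v]) -> p = q.
Proof.
move=> pq; apply/eqP; rewrite -subr_eq0; apply/eqP/mpoly_zero_fun => v.
by rewrite mevalB pq subrr.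
Qed.

(** Density of a nonempty open set: it suffices that [d * p] vanishes everywhere. *)
Lemma mpoly_zero_fun_off n (d p : {mpoly K[n]}) : d != 0 ->
  (forall v, d.@[v] != 0 -> p.@[v] = 0) -> p = 0.
Proof.
move=> d0 dp; apply/eqP; rewrite -[_ == _]orFb -(negbTE d0) -mulf_eq0.
apply/eqP/mpoly_zero_fun => v; rewrite mevalM.
by case: (eqVneq d.@[v] 0) => [->|/dp ->]; rewrite ?mul0r ?mulr0.
Qed.

Lemma mpoly_neq0 n (p : {mpoly K[n]}) : p != 0 -> exists v, p.@[v] != 0.
Proof.
move=> /eqP p0; apply: NNPP => np; apply/p0/mpoly_zero_fun => v.
by apply/eqP; apply: contra_notT np => pv; exists v.
Qed.

End Zero.

(** * Homogeneous forms, Euler's relation, chain rule *)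

Section Homogeneous.
Variables (n : nat) (R : comNzRingType).
Implicit Types (p q : {mpoly R[n]}) (v : 'I_n -> R).

Lemma dhomog_mdeg d p : p \is d.-homog -> {in msupp p, forall m, mdeg m = d}.
Proof. by move/dhomogP. Qed.

Lemma homog_eval d c v p : p \is d.-homog ->
  p.@[fun i => c * v i] = c ^+ d * p.@[v].
Proof.
move=> /dhomog_mdeg hp; rewrite !mevalE mulr_sumr; apply: eq_big_seq => m /hp <-.
rewrite mulrCA; congr (_ * _); rewrite mdegE -prodrXr -big_split /=.
by apply: eq_bigr => i _; rewrite exprMn.
Qed.

Lemma euler d p : p \is d.-homog -> \sum_i 'X_i * mderiv i p = d%:R *: p.
Proof.
move=> /dhomog_mdeg hp; rewrite [in LHS](mpolyE p) [in RHS](mpolyE p).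
under eq_bigr => i _ do rewrite linear_sum mulr_sumr /=.
rewrite exchange_big scaler_sumr /=; apply: eq_big_seq => m /hp <-.
rewrite mdegE natr_sum scaler_suml; apply: eq_bigr => i _.
rewrite mderivZ mderivX -!scalerAr !scalerA [p@_m * _]mulrC.
case: (posnP (m i)) => [->|mi0]; first by rewrite mul0r !scale0r.
rewrite -mpolyXD addmC submK //; apply/mnm_lepP => j; rewrite mnm1E.
by case: eqP => // <-.
Qed.

Lemma euler_eval d p v : p \is d.-homog ->
  \sum_i v i * (mderiv i p).@[v] = d%:R * p.@[v].
Proof.
move=> /euler/(congr1 (meval v)); rewrite mevalZ raddf_sum /= => <-.
by apply: eq_bigr => i _; rewrite mevalM mevalXU.
Qed.

Lemma mderiv_homog d i p : p \is d.-homog -> mderiv i p \is d.-1.-homog.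
Proof.
move=> /dhomog_mdeg hp; rewrite (mpolyE p) linear_sum /=.
rewrite big_seq; apply: rpred_sum => m /hp md; rewrite mderivZ mderivX.
apply/rpredZ; case: (posnP (m i)) => [->|mi0]; first by rewrite scale0r rpred0.
apply/rpredZ; rewrite dhomogX; apply/eqP.
have le1 : (U_(i) <= m)%MM.
  by apply/mnm_lepP => j; rewrite mnm1E; case: eqP => // <-.
by rewrite -md -{2}(submK le1) mdegD mdeg1 addn1.
Qed.

Lemma mderiv_comp k (p : {mpoly R[n]}) (t : n.-tuple {mpoly R[k]}) j :
  mderiv j (p \mPo t) = \sum_i (mderiv i p \mPo t) * mderiv j (tnth t i).
Proof.
elim/mpoly_ring_ind: p => [c|i|p q IHp IHq|p q IHp IHq].
- rewrite comp_mpolyC mderivC big1 // => i _.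
  by rewrite mderivC comp_mpoly0 mul0r.
- rewrite comp_mpolyXU -tnth_nth (bigD1 i) //= big1 => [|i' ne_i].
    by rewrite addr0 mderivX mnm1E eqxx scale1r -[X in (X - _)%MM]add0m addmK mpolyX0 comp_mpoly1 mul1r.
  by rewrite mderivX mnm1E eq_sym (negbTE ne_i) scale0r comp_mpoly0 mul0r.
- rewrite comp_mpolyD mderivD IHp IHq -big_split /=; apply: eq_bigr => i _.
  by rewrite mderivD comp_mpolyD mulrDl.
- rewrite rmorphM /= mderivM IHp IHq mulr_suml mulr_sumr -big_split /=.
  apply: eq_bigr => i _; rewrite mderivM comp_mpolyD !rmorphM /=; ring.
Qed.

Lemma homog_comp k d e p (t : n.-tuple {mpoly R[k]}) : p \is d.-homog ->
  (forall i, tnth t i \is e.-homog) -> p \mPo t \is (d * e).-homog.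
Proof.
move=> /dhomog_mdeg hp ht; rewrite comp_mpolyE; rewrite big_seq; apply: rpred_sum => m /hp <-.
apply: rpredZ; rewrite mdegE big_distrl /=.
elim/big_rec2: _ => [|i x y _ hy]; first by rewrite dhomog1.
by apply: dhomogM => //; rewrite mulnC; apply: dhomogMn.
Qed.

(** Allows the cofactor of a form in a homogeneous identity to be replaced by its homogeneous
    component. *)
Lemma pihomogM d e p q : q \is e.-homog ->
  pihomog mdeg (d + e) (p * q) = pihomog mdeg d p * q.
Proof.
move=> hq; elim/mpolyind: p => [|c m p _ _ IH]; first by rewrite mul0r !raddf0 mul0r.
rewrite mulrDl !pihomogD mulrDl IH; congr (_ + _).
rewrite -scalerAl !linearZ /= -scalerAl; congr (_ *: _); rewrite pihomogX.
have hm : 'X_[m] * q \is (mdeg m + e).-homog by rewrite dhomogM // dhomogX.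
case: eqP => [<-|/eqP ne_md]; first by rewrite pihomog_dE.
by rewrite mul0r (pihomog_ne0 _ hm) // eqn_add2r.
Qed.

End Homogeneous.

Lemma homog_divr n (R : idomainType) d e (f q : {mpoly R[n]}) : f != 0 ->
  f \is e.-homog -> q * f \is (d + e).-homog -> q \is d.-homog.
Proof.
move=> f0 hf /pihomog_dE; rewrite pihomogM // => /(mulIf f0) <-.
exact: pihomogP.
Qed.

(** * Forms vanishing on a hyperplane *)

Section Plane.
Variables (K : closedFieldType) (n : nat) (u : 'I_n -> K).
Hypothesis u_neq0 : exists i, u i != 0.
Implicit Types (p q g h : {mpoly K[n]}) (v : 'I_n -> K).

Definition lform : {mpoly K[n]} := \sum_i u i *: 'X_i.

Lemma lform_eval v : lform.@[v] = \sum_i u i * v i.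
Proof.
by rewrite /lform raddf_sum /=; apply: eq_bigr => i _; rewrite mevalZ mevalXU.
Qed.

Lemma lform_homog : lform \is 1.-homog.
Proof.
by apply: rpred_sum => i _; apply: rpredZ; rewrite dhomogX /= mdeg1.
Qed.

Definition on_plane v := \sum_i u i * v i = 0.

Definition vanish_plane g := forall v, on_plane v -> g.@[v] = 0.

(** [s] retracts the space onto the hyperplane by solving its equation for a coordinate with nonzero
    coefficient. It is the identity modulo [lform] on the variables, hence on all polynomials. *)
Lemma plane_section : exists s : n.-tuple {mpoly K[n]},
  (forall v, on_plane (fun i => (tnth s i).@[v])) /\
  (forall g, exists q, g - (g \mPo s) = q * lform).
Proof.
have [i0 ui0] := u_neq0.
pose s := [tuple (if i == i0 then 'X_i - (u i0)^-1 *: lform else 'X_i) | i < n].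
exists s; split=> [v|].
  have e : (fun i => (tnth s i).@[v]) =1
    (fun i => v i - (if i == i0 then (u i0)^-1 * lform.@[v] else 0)).
    move=> i; rewrite tnth_mktuple; case: eqP => _.
      by rewrite mevalB mevalXU mevalZ.
    by rewrite mevalXU subr0.
  rewrite /on_plane; under eq_bigr => i _ do rewrite e mulrBr.
  rewrite sumrB -lform_eval (bigD1 i0) //= eqxx big1 => [|i /negbTE ->].
    by rewrite addr0 mulrA divff // mul1r subrr.
  by rewrite mulr0.
elim/mpoly_ring_ind => [c|i|p q [a ha] [b hb]|p q [a ha] [b hb]].
- by exists 0; rewrite comp_mpolyC subrr mul0r.
- rewrite comp_mpolyXU -tnth_nth tnth_mktuple; case: eqP => _.
    by exists (u i0)^-1%:MP; rewrite opprB addrC subrK mul_mpolyC.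
  by exists 0; rewrite subrr mul0r.
- by exists (a + b); rewrite mulrDl -ha -hb comp_mpolyD; ring.
- exists (a * q + (p \mPo s) * b); rewrite rmorphM /=.
  have -> : (a * q + (p \mPo s) * b) * lform =
    a * lform * q + (p \mPo s) * (b * lform) by ring.
  by rewrite -ha -hb; ring.
Qed.

Lemma lform_neq0 : lform != 0.
Proof.
have [i ui] := u_neq0; apply: contraNneq ui => l0.
have := lform_eval (fun j => (j == i)%:R); rewrite l0 meval0 (bigD1 i) //= big1.
  by rewrite eqxx mulr1 addr0 => <-.
by move=> j /negbTE ->; rewrite mulr0.
Qed.

Lemma vanish_plane_dvd g : vanish_plane g -> exists q, g = q * lform.
Proof.
move=> g0; have [s [sv sd]] := plane_section; have [q gq] := sd g.
exists q; rewrite -gq.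
suff -> : g \mPo s = 0 by rewrite subr0.
by apply: mpoly_zero_fun => v; rewrite comp_mpoly_meval g0.
Qed.

Lemma vanish_plane_dvd_homog d g : g \is d.+1.-homog -> vanish_plane g ->
  exists2 q, q \is d.-homog & g = q * lform.
Proof.
move=> hg /vanish_plane_dvd [q gq]; exists q => //.
apply: (homog_divr lform_neq0 lform_homog); by rewrite -gq addn1.
Qed.

(** Pulled back along the retraction, vanishing on the hyperplane becomes being zero in a domain. *)
Lemma vanish_plane_mul g h :
  vanish_plane (g * h) -> vanish_plane g \/ vanish_plane h.
Proof.
move=> gh0; have [s [sv sd]] := plane_section.
have : (g \mPo s) * (h \mPo s) = 0.
  by apply: mpoly_zero_fun => v; rewrite -rmorphM comp_mpoly_meval gh0.
have back p : p \mPo s = 0 -> vanish_plane p.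
  move=> p0 v; have [q] := sd p; rewrite p0 subr0 => -> hv.
  by rewrite mevalM lform_eval hv mulr0.
by move/eqP; rewrite mulf_eq0 => /orP[] /eqP /back; [left|right].
Qed.

End Plane.

(** * Irreducibility of the sextic *)

Section Trisextic.
Variables (k : fieldType) (w s n : k).
Hypothesis w_root : w ^+ 2 + w + 1 = 0.
Hypothesis w_neq1 : w != 1.
Hypothesis no_quadratic_root : forall q, q ^+ 2 - s * q + n != 0.
Hypothesis n_not_cube : forall q, q ^+ 3 != n.

Definition trisextic : {poly k} := 'X^6 - s *: 'X^3 + n%:P.

Let wp : {poly k} := w *: 'X.
Local Notation twist D := (D \Po wp).

Lemma cube_root_expr3 : w ^+ 3 = 1.
Proof.
apply/eqP; rewrite -subr_eq0; apply/eqP.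
have -> : w ^+ 3 - 1 = (w - 1) * (w ^+ 2 + w + 1) by ring.
by rewrite w_root mulr0.
Qed.

Lemma cube_root_neq0 : w != 0.
Proof.
by apply: contra_eqN cube_root_expr3 => /eqP ->; rewrite expr0n /= eq_sym oner_eq0.
Qed.

Lemma size_trisextic : size trisextic = 7%N.
Proof.
have -> : trisextic = 'X^6 + (n%:P - s *: 'X^3) by rewrite /trisextic; ring.
rewrite size_polyDl size_polyXn //; apply: (leq_ltn_trans (size_polyD _ _)).
rewrite gtn_max size_polyN (leq_ltn_trans (size_polyC_leq1 _)) //=.
by rewrite (leq_ltn_trans (size_scale_leq _ _)) // size_polyXn.
Qed.

Lemma size_twist D : size (twist D) = size D.
Proof. by apply: size_comp_poly2; rewrite size_scale ?size_polyX ?cube_root_neq0. Qed.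

Lemma twist3 D : twist (twist (twist D)) = D.
Proof.
rewrite -!comp_polyA /wp.
have -> : (w *: 'X) \Po ((w *: 'X) \Po (w *: 'X)) = 'X :> {poly k}.
  rewrite !(comp_polyZ, comp_polyX) !scalerA.
  have -> : w * w * w = w ^+ 3 by ring.
  by rewrite cube_root_expr3 scale1r.
by rewrite comp_polyXr.
Qed.

Lemma twist_trisextic : twist trisextic = trisextic.
Proof.
rewrite /trisextic !rmorphD rmorphN /= !comp_polyZ comp_polyC !comp_Xn_poly /wp.
rewrite !exprZn -[6%N]/(3 * 2)%N [in w ^+ (3 * 2)]exprM cube_root_expr3 expr1n !scale1r.
by [].
Qed.

Lemma twist_dvd D E : D %| E -> twist D %| twist E.
Proof. exact: dvdp_comp_poly. Qed.

Lemma twist_coprime D E : coprimep D E -> coprimep (twist D) (twist E).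
Proof. exact: coprimep_comp_poly. Qed.

Lemma trisextic_no_root r : ~~ root trisextic r.
Proof.
apply/negP => /rootP; rewrite /trisextic !(hornerD, hornerN, hornerZ, hornerXn, hornerC) => h.
by case/eqP: (no_quadratic_root (r ^+ 3)); rewrite -h; ring.
Qed.

(** Such a [D] is a multiple of some X^3 - r, modulo which [trisextic] is the constant r^2 - s r +
    n. *)
Lemma trisextic_no_cubic (D : {poly k}) : size D = 4%N -> D`_1 = 0 -> D`_2 = 0 ->
  ~~ (D %| trisextic).
Proof.
move=> sD D1 D2; have D3 : D`_3 != 0.
  have -> : D`_3 = lead_coef D by rewrite lead_coefE sD.
  by rewrite lead_coef_eq0 -size_poly_eq0 sD.
pose r := - D`_0 / D`_3.
have DE : D = D`_3 *: ('X^3 - r%:P).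
  apply/polyP => -[|[|[|[|i]]]]; rewrite coefZ coefB coefXn coefC /= ?subr0 ?mulr0 ?mulr1 //.
    by rewrite sub0r /r mulNr opprK mulrC divfK.
  by rewrite nth_default // sD.
apply: contra (no_quadratic_root r) => Dp.
have: D %| (r ^+ 2 - s * r + n)%:P.
  have -> : (r ^+ 2 - s * r + n)%:P =
      trisextic - ('X^3 - r%:P) * ('X^3 + r%:P - s%:P).
    by rewrite /trisextic polyCD polyCB !polyCM -mul_polyC; ring.
  by rewrite dvdp_sub // {1}DE dvdpZl // dvdp_mulr.
case: eqVneq => // c0 /dvdp_leq.
by rewrite polyC_eq0 c0 size_polyC c0 sD => /(_ isT).
Qed.

Lemma coef_twist (D : {poly k}) i : (twist D)`_i = w ^+ i * D`_i.
Proof.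
  rewrite coef_comp_poly /wp; under eq_bigr => j _ do
    rewrite exprZn coefZ coefXn.
  have [iD|Di] := ltnP i (size D); last first.
    rewrite nth_default ?mulr0 // big1 // => j _.
    by rewrite gtn_eqF ?mulr0 // (leq_trans _ Di).
  rewrite (bigD1 (Ordinal iD)) //= eqxx mulr1 mulrC big1 ?addr0 // => j ne.
  by rewrite [i == _]eq_sym (negbTE (_ : val j != i)) ?mulr0.
Qed.

(** The substitution of [w X] for [X] permutes the factors. A factor fixed up to a constant is a
    polynomial in X^3 and yields a root of the quadratic; three coprime conjugate factors have
    degree at most 2 each and yield a root or make [n] a cube. *)
Lemma trisextic_irreducible : irreducible_poly trisextic.
Proof.
have p0 : trisextic != 0 by rewrite -size_poly_eq0 size_trisextic.
split; first by rewrite size_trisextic.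
move=> q sq1 qp; have q0 : q != 0 by apply: dvdpN0 qp p0.
rewrite -dvdp_size_eqp // size_trisextic.
have := dvdp_leq p0 qp; rewrite size_trisextic leq_eqVlt => /orP[//|sq7].
exfalso.
(* A proper divisor of minimal degree; it has no smaller nonconstant divisor. *)
have [D [sD1 Dp sD7 irrD]] : exists D : {poly k}, [/\ size D != 1%N, D %| trisextic,
    (size D < 7)%N & forall E, E %| D -> size E != 1%N -> size E = size D].
  have [m] := ubnP (size q); elim: m q => // m IH q in sq1 qp q0 sq7 *.
  rewrite ltnS => sqm.
  have [[E [sE Eq sEq]]|irr] :=
      classic (exists E : {poly k}, [/\ size E != 1%N, E %| q & (size E < size q)%N]).
    apply: (IH E) => //; first exact: dvdp_trans qp.
    - exact: dvdpN0 Eq q0.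
    - exact: ltn_trans sq7.
    - exact: leq_trans sqm.
  exists q; split=> // E Eq sE; apply/eqP; rewrite eqn_leq (dvdp_leq q0 Eq) /=.
  by rewrite leqNgt; apply/negP => sEq; apply: irr; exists E.
have D0 : D != 0 by apply: dvdpN0 Dp p0.
have D_0 : D`_0 != 0.
  by rewrite -horner_coef0; apply: contra (trisextic_no_root 0); apply: (root_dvdp Dp).
have sD_gt1 : (1 < size D)%N.
  by rewrite ltn_neqAle eq_sym sD1 lt0n size_poly_eq0.
(* By minimality [D] is coprime to its twist or associated with it. In the second case comparing
   constant terms gives the factor 1, so only the coefficients with index divisible by 3 survive and
   [D] has degree 3. *)
have [coD|ncoD] := boolP (coprimep D (twist D)); last first.
  have eqD : D %= twist D.
    have g1 : size (gcdp D (twist D)) = size D.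
      by apply: irrD => //; apply: dvdp_gcdl.
    rewrite -dvdp_size_eqp ?size_twist //.
    have : gcdp D (twist D) %= D by rewrite -dvdp_size_eqp ?dvdp_gcdl // g1.
    by rewrite /eqp => /andP[_ /dvdp_trans]; apply; apply: dvdp_gcdr.
  have [c c0 cD] := eqpf_eq _ _ eqD.
  have {}cD i : D`_i = c * (w ^+ i * D`_i).
    by rewrite {1}cD coefZ coef_twist.
  have c1 : c = 1 by apply: (mulIf D_0); rewrite {2}cD expr0 !mul1r.
  have wD i : w ^+ i != 1 -> D`_i = 0.
    move=> wi; apply/eqP; have /eqP := cD i.
    rewrite c1 mul1r eq_sym -subr_eq0 -[X in _ - X]mul1r -mulrBl mulf_eq0.
    by rewrite subr_eq0 (negbTE wi).
  have w2 : w ^+ 2 != 1.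
    apply: contraNneq w_neq1 => w2; rewrite -cube_root_expr3.
    by rewrite exprS w2 mulr1.
  have w4 : w ^+ 4 = w by rewrite exprSr cube_root_expr3 mul1r.
  have w5 : w ^+ 5 = w ^+ 2 by rewrite -[5%N]/(3 + 2)%N exprD cube_root_expr3 mul1r.
  have lD : lead_coef D != 0 by rewrite lead_coef_eq0.
  have D1 : D`_1 = 0 by apply: wD; rewrite expr1.
  have D2 : D`_2 = 0 by apply: wD.
  have D4 : D`_4 = 0 by apply: wD; rewrite w4.
  have D5 : D`_5 = 0 by apply: wD; rewrite w5.
  have sD : size D = 4%N.
    move: lD; rewrite lead_coefE; move: sD_gt1 sD7.
    by case: (size D) => [|[|[|[|[|[|[|]]]]]]] //= _ _; rewrite ?D1 ?D2 ?D4 ?D5 eqxx.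
  by move: Dp; rewrite (negbTE (trisextic_no_cubic sD D1 D2)).
pose D' := twist D; pose D'' := twist D'.
have coD' : coprimep D' D'' by apply: twist_coprime.
have coD'' : coprimep D D''.
  by rewrite coprimep_sym -[D in coprimep _ D]twist3; apply: twist_coprime.
have D'p : D' %| trisextic by rewrite -twist_trisextic; apply: twist_dvd.
have D''p : D'' %| trisextic by rewrite -twist_trisextic; apply: twist_dvd.
have Np : D * (D' * D'') %| trisextic.
  by rewrite Gauss_dvdp ?Dp /= ?Gauss_dvdp ?D'p // coprimepMr coD coD''.
have s' : size D' = size D by apply: size_twist.
have s'' : size D'' = size D by rewrite /D'' size_twist.
have D'0 : D' != 0 by rewrite -size_poly_eq0 s' size_poly_eq0.
have D''0 : D'' != 0 by rewrite -size_poly_eq0 s'' size_poly_eq0.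
have sN : size (D * (D' * D'')) = (3 * (size D).-1).+1.
  rewrite !size_mul ?mulf_neq0 // s' s''.
  by move: (size D) sD_gt1 => d; clear; lia.
have sD_le3 : (size D <= 3)%N.
  have := dvdp_leq p0 Np; rewrite sN size_trisextic ltnS.
  by move: (size D) sD_gt1 => d; clear; lia.
have {sD_le3 sD_gt1} [sD2|sD3] : size D = 2%N \/ size D = 3%N.
- by move: sD_le3 sD_gt1; case: (size D) => [|[|[|[|]]]] //; [left|right].
- have [r Dr] := poly2_root sD2.
  by have := root_dvdp Dp Dr; rewrite (negbTE (trisextic_no_root r)).
have : D * (D' * D'') %= trisextic.
  by rewrite -dvdp_size_eqp // sN sD3 size_trisextic.
have coef0E (f g : {poly k}) : (f * g)`_0 = f`_0 * g`_0 by rewrite -!horner_coef0 hornerM.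
case/eqpf_eq => c c0 Nc.
(* The constant and the leading coefficient of the product of the three conjugates; their quotient
   exhibits [n] as a cube. *)
have N0 : D`_0 ^+ 3 = c * n.
  have /(congr1 (fun p : {poly k} => p`_0)) := Nc.
  rewrite !coef0E /D'' /D' !coef_twist expr0 !mul1r coefZ.
  rewrite /trisextic !coefD coefN coefZ !coefXn /= coefC /= mulr0 subr0 add0r => <-.
  by ring.
have N6 : D`_2 ^+ 3 = c.
  have /(congr1 lead_coef) := Nc; rewrite !lead_coefM lead_coefZ.
  have lE (p : {poly k}) : size p = 3%N -> lead_coef p = p`_2.
    by move=> sp; rewrite lead_coefE sp.
  rewrite (lE D) // (lE D') ?s' // (lE D'') ?s'' // /D'' /D' !coef_twist.
  have -> : lead_coef trisextic = 1.
    rewrite lead_coefE size_trisextic /trisextic !coefD coefN coefZ !coefXn.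
    by rewrite coefC /= mulr0 subr0 addr0.
  rewrite mulr1 => <-.
  have -> : D`_2 * (w ^+ 2 * D`_2 * (w ^+ 2 * (w ^+ 2 * D`_2))) =
    (w ^+ 3) ^+ 2 * D`_2 ^+ 3 by ring.
  by rewrite cube_root_expr3 expr1n mul1r.
case/eqP: (n_not_cube (D`_0 / D`_2)).
by rewrite expr_div_n N6 N0 mulrC mulKf.
Qed.

End Trisextic.

Local Notation i0 := (inord 0 : 'I_3).
Local Notation i1 := (inord 1 : 'I_3).
Local Notation i2 := (inord 2 : 'I_3).

Lemma ord3P (P : 'I_3 -> Prop) : P i0 -> P i1 -> P i2 -> forall i, P i.
Proof.
move=> P0 P1 P2 i; rewrite -[i]inord_val.
by case: i => [[|[|[|]]] /=].
Qed.

Lemma sum3 (V : nmodType) (f : 'I_3 -> V) : \sum_i f i = f i0 + f i1 + f i2.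
Proof.
rewrite !big_ord_recr big_ord0 /= add0r.
by congr (f _ + f _ + f _); apply: val_inj; rewrite /= inordK.
Qed.

Lemma inord3_eq (i j : nat) : (i < 3)%N -> (j < 3)%N ->
  ((inord i : 'I_3) == inord j) = (i == j).
Proof. by move=> i3 j3; rewrite -val_eqE /= !inordK. Qed.

Section Char0.
Variables (K : closedFieldType) (charK : [pchar K] =i pred0).

Lemma natf_neq0_char0 (m : nat) : m != 0%N -> m%:R != 0 :> K.
Proof. by move=> m0; rewrite ((pcharf0P K).1 charK). Qed.

Lemma cube_root1_exists : exists w : K, w ^+ 2 + w + 1 = 0 /\ w != 1.
Proof.
have /closed_rootP[w] : size ('X^2 + 'X + 1%:P : {poly K}) != 1%N.
  rewrite -addrA size_polyDl size_polyXn //.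
  by rewrite size_polyDl size_polyX // size_polyC oner_eq0.
move/rootP; rewrite !(hornerD, hornerXn, hornerX, hornerC) => w0.
exists w; split=> //; apply: contra_eqN w0 => /eqP ->.
rewrite !expr1n; have -> : 1 + 1 + 1 = 3%:R :> K by ring.
by rewrite natf_neq0_char0.
Qed.

Lemma closed_cbrt (a : K) : exists r : K, r ^+ 3 = a.
Proof.
have /closed_rootP[w] : size ('X^3 - a%:P : {poly K}) != 1%N.
  by rewrite size_XnsubC.
by move/rootP; rewrite !(hornerD, hornerN, hornerXn, hornerC) => /eqP; rewrite subr_eq0 => /eqP; exists w.
Qed.

Lemma closed_quad (b c : K) : exists r : K, r ^+ 2 + b * r + c = 0.
Proof.
have /closed_rootP[w] : size ('X^2 + (b *: 'X + c%:P) : {poly K}) != 1%N.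
  rewrite size_polyDl size_polyXn //; apply: (leq_ltn_trans (size_polyD _ _)).
  rewrite gtn_max (leq_ltn_trans (size_scale_leq _ _)) ?size_polyX //=.
  by rewrite (leq_ltn_trans (size_polyC_leq1 _)).
move/rootP; rewrite !(hornerD, hornerZ, hornerXn, hornerX, hornerC) => h.
by exists w; rewrite -addrA.
Qed.

(** Compare multiplicities at [r]: on the left it is 1 modulo [m], on the right 0. *)
Lemma simple_root_not_power (m : nat) (f a b : {poly K}) (r : K) :
  (1 < m)%N -> root f r -> ~~ root f^`() r -> b != 0 -> f * b ^+ m != a ^+ m.
Proof.
move=> m1 fr f'r b0; apply: contraNneq f'r => fab.
have [q fE] := factor_theorem _ _ fr.
have qr : root q r -> root f^`() r.
  by rewrite fE derivM derivXsubC mulr1 !rootE !hornerE => /eqP ->; rewrite subrr mulr0 addr0.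
apply: contraTT isT => f'r; have {}qr : ~~ root q r by apply: contra f'r.
have q0 : q != 0 by apply: contraNneq qr => ->; rewrite root0.
have mupXn (p : {poly K}) j : p != 0 -> mup r (p ^+ j) = (j * mup r p)%N.
  move=> p0; elim: j => [|j IH]; first by rewrite expr0 mupNroot // rootE hornerC oner_eq0.
  by rewrite exprS mupM ?expf_neq0 // IH mulSn.
have a0 : a != 0.
  apply: contra_eqN fab => /eqP ->; rewrite expr0n (gtn_eqF (ltnW m1)) /=.
  by rewrite mulf_neq0 ?expf_neq0 // fE mulf_neq0 // polyXsubC_eq0.
have := congr1 (mup r) fab.
rewrite fE !mupM ?mulf_neq0 ?expf_neq0 ?polyXsubC_eq0 // !mupXn //.
rewrite (mupNroot qr) -['X - r%:P]expr1 mup_XsubCX eqxx add0n => e.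
have : (m %| 1 + m * mup r b)%N by rewrite e dvdn_mulr.
by rewrite dvdn_addl ?dvdn_mulr // dvdn1 => /eqP m1'; rewrite m1' in m1.
Qed.

Local Notation A := {mpoly K[2]}.
Local Notation x := ('X_(inord 0) : A).
Local Notation y := ('X_(inord 1) : A).

(* Restriction of a polynomial in x, y to the line x = c. *)
Definition slice (c : K) (p : A) : {poly K} :=
  mmap (@polyC K) (fun i : 'I_2 => if val i == 0%N then c%:P else 'X) p.

HB.instance Definition _ c := GRing.RMorphism.copy (slice c)
  (mmap (@polyC K) (fun i : 'I_2 => if val i == 0%N then c%:P else 'X)).

Lemma sliceX c : slice c x = c%:P.
Proof. by rewrite /slice mmapX mmap1U /= inordK. Qed.
Lemma sliceY c : slice c y = 'X.
Proof. by rewrite /slice mmapX mmap1U /= inordK. Qed.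
Lemma sliceC c a : slice c a%:MP = a%:P.
Proof. by rewrite /slice mmapC. Qed.

Lemma slice_neq0 (p : A) : p != 0 -> exists2 c, c != 0 & slice c p != 0.
Proof.
move=> p0; have /mpoly_neq0[v] : p * x != 0.
  by rewrite mulf_neq0 // -msize_poly_eq0 msizeX.
rewrite mevalM mulf_eq0 negb_or mevalXU => /andP[pv vx].
exists (v (inord 0)) => //; apply: contraNneq pv => s0.
have <- : (slice (v (inord 0)) p).[v (inord 1)] = p.@[v].
  elim/mpoly_ring_ind: p {p0 s0} => [c|i|p q IHp IHq|p q IHp IHq].
  - by rewrite sliceC hornerC mevalC.
  - rewrite mevalXU -[i]inord_val; case: i => [[|[|]]] //= _.
      by rewrite sliceX hornerC.
    by rewrite sliceY hornerX.
  - by rewrite mevalD -IHp -IHq rmorphD hornerD.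
  - by rewrite mevalM -IHp -IHq rmorphM hornerM.
by rewrite s0 horner0.
Qed.

(** The sextic is [Z^6 - sext_s Z^3 + sext_n] as a polynomial in the third variable. *)
Definition sext_s : A := 10%:R * (x ^+ 3 + y ^+ 3).
Definition sext_n : A := x ^+ 6 + y ^+ 6 - 10%:R * (x ^+ 3 * y ^+ 3).

Lemma sext_no_quadratic_root (a b : A) : b != 0 ->
  a ^+ 2 - sext_s * (a * b) + sext_n * b ^+ 2 != 0.
Proof.
move=> b0; apply/negP => /eqP ab; have [c c0 sb0] := slice_neq0 b0.
(* The discriminant [sext_s^2 - 4 sext_n] on the line x = c, which equals 48 (2c^3 + y^3)(c^3 +
   2y^3). It has a simple root where y^3 = -2c^3, so it is not a square, while completing the square
   would make it one. *)
pose D : {poly K} := 96%:R *: 'X^6 + ((240%:R * c ^+ 3) *: 'X^3 + (96%:R * c ^+ 6)%:P).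
have [r r3] := closed_cbrt (- (2%:R * c ^+ 3)).
have r0 : r != 0.
  apply: contra_eqN r3 => /eqP ->; rewrite expr0n /= eq_sym oppr_eq0.
  by rewrite mulf_neq0 ?expf_neq0 ?natf_neq0_char0.
have : D * slice c b ^+ 2 != slice c (2%:R * a - sext_s * b) ^+ 2.
  apply: (@simple_root_not_power _ _ _ _ r) => //.
    apply/rootP; rewrite /D !(hornerD, hornerZ, hornerC, hornerXn).
    have -> : r ^+ 6 = (r ^+ 3) ^+ 2 by ring.
    by rewrite r3; ring.
  rewrite rootE /D !(derivD, derivZ, derivC, derivXn) addr0 /=.
  rewrite !(hornerD, hornerZ, hornerMn, hornerXn).
  have -> : 96%:R * (r ^+ 5 *+ 6) + 240%:R * c ^+ 3 * (r ^+ 2 *+ 3) =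
    r ^+ 2 * (576%:R * r ^+ 3 + 720%:R * c ^+ 3) by ring.
  rewrite r3; have -> : 576%:R * - (2%:R * c ^+ 3) + 720%:R * c ^+ 3 =
    - (432%:R * c ^+ 3) by ring.
  by rewrite mulf_neq0 ?expf_neq0 // oppr_eq0 mulf_neq0 ?expf_neq0 ?natf_neq0_char0.
move/eqP; apply.
have -> : D = slice c (sext_s ^+ 2 - 4%:R * sext_n).
  rewrite /sext_s /sext_n !(rmorphB, rmorphD, rmorphM, rmorphXn, rmorph_nat) /=.
  by rewrite sliceX sliceY /D -!mul_polyC !(polyCM, polyC_exp) !polyC_natr; ring.
rewrite -rmorphXn -rmorphM -rmorphXn; congr (slice c _).
apply/eqP; rewrite -subr_eq0; apply/eqP.
transitivity (- (4%:R) * (a ^+ 2 - sext_s * (a * b) + sext_n * b ^+ 2)); last by rewrite ab mulr0.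
ring.
Qed.

Lemma sext_n_not_cube (a b : A) : b != 0 -> sext_n * b ^+ 3 != a ^+ 3.
Proof.
move=> b0; apply/negP => /eqP ab; have [c c0 sb0] := slice_neq0 b0.
(* [sext_n] on the line x = c. As a quadratic in y^3 it has a root u that is neither 0 nor the
   double root 5c^3, so a cube root of u is a simple root of [D]. *)
pose D : {poly K} := 'X^6 + (- (10%:R * c ^+ 3) *: 'X^3 + (c ^+ 6)%:P).
have [u u2] := closed_quad (- (10%:R * c ^+ 3)) (c ^+ 6).
have [r r3] := closed_cbrt u.
have r0 : r != 0.
  apply: contra_eqN u2 => /eqP r0; rewrite -r3 r0.
  have -> : (0 ^+ 3) ^+ 2 + - (10%:R * c ^+ 3) * 0 ^+ 3 + c ^+ 6 = c ^+ 6 :> K by ring.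
  by rewrite expf_neq0.
have u5 : u - 5%:R * c ^+ 3 != 0.
  rewrite subr_eq0; apply: contra_eqN u2 => /eqP ->.
  have -> : (5%:R * c ^+ 3) ^+ 2 + - (10%:R * c ^+ 3) * (5%:R * c ^+ 3) + c ^+ 6 =
    - (24%:R * c ^+ 6) by ring.
  by rewrite oppr_eq0 mulf_neq0 ?expf_neq0 ?natf_neq0_char0.
have : D * slice c b ^+ 3 != slice c a ^+ 3.
  apply: (@simple_root_not_power _ _ _ _ r) => //.
    apply/rootP; rewrite /D !(hornerD, hornerZ, hornerC, hornerXn).
    have -> : r ^+ 6 = (r ^+ 3) ^+ 2 by ring.
    by rewrite r3 -u2; ring.
  rewrite rootE /D !(derivD, derivZ, derivC, derivXn) addr0 /=.
  rewrite !(hornerD, hornerZ, hornerMn, hornerXn).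
  have -> : r ^+ 5 *+ 6 + - (10%:R * c ^+ 3) * (r ^+ 2 *+ 3) =
    6%:R * r ^+ 2 * (r ^+ 3 - 5%:R * c ^+ 3) by ring.
  by rewrite r3 mulf_neq0 // mulf_neq0 ?expf_neq0 ?natf_neq0_char0.
move/eqP; apply.
have -> : D = slice c sext_n.
  rewrite /sext_n !(rmorphB, rmorphD, rmorphM, rmorphXn, rmorph_nat) /=.
  by rewrite sliceX sliceY /D -!mul_polyC !(polyCN, polyCM, polyC_exp) !polyC_natr; ring.
by rewrite -rmorphXn -rmorphM -rmorphXn ab.
Qed.

End Char0.

Lemma frac_numden (R : idomainType) (q : {fraction R}) :
  exists a b : R, b != 0 /\ q = FracField.tofrac a / FracField.tofrac b.
Proof.
elim/generic_quotient.quotW: q => r; exists (frac r).1, (frac r).2.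
have d0 := denom_ratioP r; split=> //.
apply: (canRL (mulfK _)); first by rewrite tofrac_eq0.
unlock FracField.tofrac; rewrite -[LHS]FracField.pi_mul.
apply/generic_quotient.eqmodP; rewrite /= FracField.equivfE /FracField.mulf.
by rewrite !numden_Ratio ?oner_eq0 ?mulr1 // mulrC.
Qed.

Lemma quadratic_clear_denom (k : fieldType) (s n a b : k) : b != 0 ->
  (a / b) ^+ 2 - s * (a / b) + n = 0 -> a ^+ 2 - s * (a * b) + n * b ^+ 2 = 0.
Proof. by move=> b0 h; rewrite -[RHS](mulr0 (b ^+ 2)) -h; field. Qed.

Lemma cube_clear_denom (k : fieldType) (n a b : k) : b != 0 ->
  (a / b) ^+ 3 = n -> n * b ^+ 3 = a ^+ 3.
Proof. by move=> b0 <-; field. Qed.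

(** * Primality over a domain, by Gauss's argument *)

Section TrisexticDomain.
Variables (R : idomainType) (w s n : R).
Hypothesis w_root : w ^+ 2 + w + 1 = 0.
Hypothesis w_neq1 : w != 1.
Hypothesis no_quadratic_root :
  forall a b, b != 0 -> a ^+ 2 - s * (a * b) + n * b ^+ 2 != 0.
Hypothesis n_not_cube : forall a b, b != 0 -> n * b ^+ 3 != a ^+ 3.
Local Notation frac := (@FracField.tofrac R).
Local Notation P := ('X^6 - s *: 'X^3 + n%:P : {poly R}).
Implicit Types p q r : {poly R}.

Lemma size_trisextic_domain : size P = 7%N.
Proof.
have -> : P = 'X^6 + (n%:P - s *: 'X^3) by ring.
rewrite size_polyDl size_polyXn //; apply: (leq_ltn_trans (size_polyD _ _)).
rewrite gtn_max size_polyN (leq_ltn_trans (size_polyC_leq1 _)) //=.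
by rewrite (leq_ltn_trans (size_scale_leq _ _)) // size_polyXn.
Qed.

Lemma trisextic_domain_monic : P \is monic.
Proof.
rewrite monicE lead_coefE size_trisextic_domain.
by rewrite !coefD coefN coefZ !coefXn coefC /= mulr0 subr0 addr0.
Qed.

Lemma map_trisextic (S : nzRingType) (f : {rmorphism R -> S}) :
  map_poly f P = 'X^6 - f s *: 'X^3 + (f n)%:P.
Proof.
by rewrite rmorphD rmorphB /= map_polyC map_polyZ !map_polyXn.
Qed.

Lemma trisextic_rem p : exists q r, p = q * P + r /\ (size r < 7)%N.
Proof.
exists (Pdiv.Ring.rdivp p P), (Pdiv.Ring.rmodp p P).
split; first exact: (Pdiv.RingMonic.rdivp_eq trisextic_domain_monic).
by rewrite -size_trisextic_domain Pdiv.Ring.ltn_rmodpN0 // monic_neq0 // trisextic_domain_monic.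
Qed.

Lemma trisextic_frac_irreducible : irreducible_poly (map_poly frac P).
Proof.
rewrite map_trisextic; apply: (@trisextic_irreducible _ (frac w)).
- by rewrite -tofracXn -tofracD -tofrac1 -tofracD w_root tofrac0.
- by rewrite -tofrac1 tofrac_eq.
- move=> q; have [a [b [b0 ->]]] := frac_numden q.
  apply: contra (no_quadratic_root a b0) => /eqP h.
  rewrite -tofrac_eq0; apply/eqP.
  rewrite !(tofracD, tofracN, tofracM, tofracXn).
  by apply: quadratic_clear_denom h; rewrite tofrac_eq0.
- move=> q; have [a [b [b0 ->]]] := frac_numden q.
  apply: contra (n_not_cube a b0) => /eqP h.
  rewrite -tofrac_eq; apply/eqP; rewrite !(tofracM, tofracXn).
  by apply: cube_clear_denom h; rewrite tofrac_eq0.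
Qed.

(** As P is monic, division with remainder takes place over [R], and a remainder of degree below 6
    that P divides over the fraction field is zero. *)
Lemma trisextic_frac_dvd p :
  map_poly frac P %| map_poly frac p -> exists q, p = q * P.
Proof.
have [q [r [pE sr]]] := trisextic_rem p; move=> hp; exists q; rewrite pE.
have inj : injective frac by move=> a b /eqP; rewrite tofrac_eq => /eqP.
have phi_r : map_poly frac r = map_poly frac p - map_poly frac q * map_poly frac P.
  by rewrite pE rmorphD rmorphM /= addrC addKr.
have : map_poly frac P %| map_poly frac r.
  by rewrite phi_r dvdp_sub // dvdp_mull.
have [-> | r0 /dvdp_leq] := eqVneq r 0; first by rewrite addr0.
have szE u : size (map_poly frac u) = size u.
  by apply: size_map_inj_poly => //; apply: tofrac0.
rewrite !szE size_trisextic_domain -size_poly_eq0 szE size_poly_eq0 => /(_ r0).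
by rewrite leqNgt sr.
Qed.

Lemma trisextic_prime p q r : p * q = r * P ->
  (exists t, p = t * P) \/ (exists t, q = t * P).
Proof.
move=> pqE; have irr := trisextic_frac_irreducible.
have : map_poly frac P %| map_poly frac p * map_poly frac q.
  by rewrite -rmorphM pqE rmorphM /= dvdp_mull.
have [/trisextic_frac_dvd|] := boolP (map_poly frac P %| map_poly frac p); first by left.
rewrite -(irreducible_poly_coprime _ irr) => co; rewrite Gauss_dvdpr //.
by move=> /trisextic_frac_dvd; right.
Qed.
End TrisexticDomain.

Definition sext (R : pzRingType) (a b c : R) : R := a ^+ 6 + b ^+ 6 + c ^+ 6
  - 10%:R * (a ^+ 3 * b ^+ 3 + b ^+ 3 * c ^+ 3 + c ^+ 3 * a ^+ 3).

Lemma rmorph_sext (R S : pzRingType) (f : {rmorphism R -> S}) a b c :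
  f (sext a b c) = sext (f a) (f b) (f c).
Proof.
rewrite /sext rmorphB !rmorphD !rmorphXn (rmorphM f 10%:R) rmorph_nat !rmorphD.
by rewrite (rmorphM f (a ^+ 3)) (rmorphM f (b ^+ 3)) (rmorphM f (c ^+ 3)) !rmorphXn.
Qed.

Lemma sext_polyC (R : comNzRingType) (a b : R) : sext a%:P b%:P 'X =
  'X^6 - (10%:R * (a ^+ 3 + b ^+ 3)) *: 'X^3
  + (a ^+ 6 + b ^+ 6 - 10%:R * (a ^+ 3 * b ^+ 3))%:P.
Proof.
have pX m (t : R) : (t ^+ m)%:P = t%:P ^+ m by rewrite rmorphXn.
have pN (t : R) : (10%:R * t)%:P = 10%:R * t%:P by rewrite (polyCM 10%:R) polyC_natr.
rewrite -mul_polyC polyCB polyCD !pN (polyCD (a ^+ 3)) (polyCM (a ^+ 3)) !pX /sext.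
by ring.
Qed.

(** * Primality and Nullstellensatz for the sextic *)

Section Sextic.
Variables (K : closedFieldType) (charK : [pchar K] =i pred0).
Local Notation A := {mpoly K[2]}.
Local Notation F := (sextic K).
Local Notation x := ('X_(inord 0) : A).
Local Notation y := ('X_(inord 1) : A).
Local Notation frac := (@FracField.tofrac A).
Local Notation ss := (sext_s K).
Local Notation nn := (sext_n K).
Implicit Types g h : {mpoly K[3]}.

Lemma sextic_sext : F = sext 'X_i0 'X_i1 'X_i2.
Proof. by rewrite /sextic /sext -[in LHS]mul_mpolyC mpolyC_nat. Qed.

Lemma sexticE u : F.@[u] = sext (u i0) (u i1) (u i2).
Proof. by rewrite sextic_sext (rmorph_sext (meval u)) /= !mevalXU. Qed.

Lemma muni_sextic : muni F = 'X^6 - ss *: 'X^3 + nn%:P.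
Proof.
have e0 : i0 = widen_ord (leqnSn 2) (inord 0) by apply: val_inj; rewrite /= !inordK.
have e1 : i1 = widen_ord (leqnSn 2) (inord 1) by apply: val_inj; rewrite /= !inordK.
have e2 : i2 = ord_max by apply: val_inj; rewrite /= !inordK.
have x0 : muni ('X_i0 : {mpoly K[3]}) = x%:P by rewrite e0; exact: muni_widen.
have x1 : muni ('X_i1 : {mpoly K[3]}) = y%:P by rewrite e1; exact: muni_widen.
have x2 : muni ('X_i2 : {mpoly K[3]}) = 'X by rewrite e2; exact: muni_max.
have muniXn (p : {mpoly K[3]}) m : muni (p ^+ m) = muni p ^+ m.
  by elim: m => [|m IH]; rewrite ?expr0 ?muni1 // !exprS muniM IH.
rewrite -sext_polyC /sextic muniB 2!muniD muniZ 2!muniD 3!muniXn.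
rewrite (muniM ('X_i0 ^+ 3)) (muniM ('X_i1 ^+ 3)) (muniM ('X_i2 ^+ 3)) 3!muniXn x0 x1 x2.
by rewrite /sext -mul_polyC mpolyC_nat polyC_natr.
Qed.

Definition sextic_dvd g := exists q, g = q * F.

Lemma sextic_dvd_quo g q : muni g = q * muni F -> sextic_dvd g.
Proof.
by move=> gq; exists (unmuni q); rewrite -[F]muniK -unmuniM -gq muniK.
Qed.

Lemma sextic_prime g h : sextic_dvd (g * h) -> sextic_dvd g \/ sextic_dvd h.
Proof.
move=> [q ghq]; have [w [w0 w1]] := cube_root1_exists charK.
have := congr1 (@muni 2 K) ghq; rewrite !muniM muni_sextic.
case/(@trisextic_prime A w%:MP).
- by rewrite -(rmorphXn (@mpolyC 2 K)) -mpolyC1 -!mpolyCD w0 mpolyC0.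
- by rewrite -mpolyC1 -subr_eq0 -mpolyCB mpolyC_eq0 subr_eq0.
- exact: sext_no_quadratic_root.
- exact: sext_n_not_cube.
- by move=> [t]; rewrite -muni_sextic => /sextic_dvd_quo; left.
- by move=> [t]; rewrite -muni_sextic => /sextic_dvd_quo; right.
Qed.

Definition on_cone (u : 'I_3 -> K) := (exists i, u i != 0) /\ F.@[u] = 0.

Lemma vanishesP g : vanishes F g <-> forall u, on_cone u -> g.@[u] = 0.
Proof.
split=> h.
  move=> u [[i ui] Fu]; have e : (\row_j u j) 0 =1 u by move=> j; rewrite mxE.
  rewrite -(meval_eq _ e); apply: h; split; last by rewrite (meval_eq _ e).
  by apply: contraNneq ui => /rowP/(_ i); rewrite !mxE => ->.
move=> v [/eqP v0 Fv]; apply: h; split=> //; apply: NNPP => no; apply: v0.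
by apply/rowP => i; rewrite mxE; apply/eqP; apply: contra_notT no => vi; exists i.
Qed.

Lemma mevalXn n (v : 'I_n -> K) p m : (p ^+ m).@[v] = p.@[v] ^+ m.
Proof. exact: rmorphXn. Qed.

Lemma meval_nat n (v : 'I_n -> K) m : (m%:R : {mpoly K[n]}).@[v] = m%:R.
Proof. exact: rmorph_nat. Qed.

Lemma sext_s_eval v :
  ss.@[v] = 10%:R * (v (inord 0) ^+ 3 + v (inord 1) ^+ 3).
Proof. by rewrite /sext_s mevalM meval_nat mevalD 2!mevalXn !mevalXU. Qed.

Lemma sext_n_eval v : nn.@[v] = v (inord 0) ^+ 6 + v (inord 1) ^+ 6
  - 10%:R * (v (inord 0) ^+ 3 * v (inord 1) ^+ 3).
Proof.
rewrite /sext_n mevalB mevalD 2!mevalXn mevalM meval_nat [(_ * _).@[_]]mevalM 2!mevalXn.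
by rewrite !mevalXU.
Qed.

(** Over a general point (x, y) the sextic has six distinct roots in Z, and each gives a point of
    the curve. The remainder of [g] has degree at most 5 in Z and vanishes at all of them, so its
    coefficients vanish on a dense set. *)
Lemma sextic_nullstellensatz g : vanishes F g <-> sextic_dvd g.
Proof.
rewrite vanishesP; split=> [g0|[q -> u [_ Fu]]]; last by rewrite mevalM Fu mulr0.
have [q [r []]] := trisextic_rem ss nn (muni g); rewrite -muni_sextic => gE sr.
suff r0 : r = 0 by apply: (@sextic_dvd_quo _ q); rewrite gE r0 addr0.
(* [d] has the same zeros as the discriminant of F in Z. It is not zero because its value at (1, 0)
   is 1 * (100 - 4) = 96. *)
pose d := nn * (ss ^+ 2 - 4%:R * nn).
have d0 : d != 0.
  pose u (i : 'I_2) : K := (i == inord 0)%:R.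
  suff : d.@[u] != 0 by apply: contraNneq => ->; rewrite meval0.
  have ux : u (inord 0) = 1 by rewrite /u eqxx.
  have uy : u (inord 1) = 0 by rewrite /u -val_eqE /= !inordK.
  rewrite /d mevalM sext_n_eval mevalB mevalXn sext_s_eval mevalM meval_nat sext_n_eval ux uy.
  rewrite [X in X != 0](_ : _ = 96%:R); last by ring.
  exact: natf_neq0_char0.
apply/polyP => i; rewrite coef0; apply: (mpoly_zero_fun_off d0) => v dv.
suff: map_poly (meval v) r = 0 by move/polyP/(_ i); rewrite coef_map coef0.
pose Fv := map_poly (meval v) (muni F).
have FvE : Fv = 'X^6 - ss.@[v] *: 'X^3 + (nn.@[v])%:P.
  by rewrite /Fv muni_sextic map_trisextic.
have [rs rsE] := closed_field_poly_normal Fv.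
have lFv : lead_coef Fv = 1 by rewrite FvE; apply/eqP/trisextic_domain_monic.
have sFv : size Fv = 7%N by rewrite FvE size_trisextic_domain.
have srs : size rs = 6%N.
  by move: sFv; rewrite rsE lFv scale1r size_prod_XsubC => -[].
have urs : uniq rs.
  rewrite -separable_prod_XsubC; move: rsE; rewrite lFv scale1r => <-.
  rewrite unlock; apply: Pdiv.ClosedField.root_coprimep => z.
  have dvE : d.@[v] = nn.@[v] * (ss.@[v] ^+ 2 - 4%:R * nn.@[v]).
    by rewrite /d mevalM; congr (_ * _); rewrite mevalB mevalXn [(_ * nn).@[_]]mevalM meval_nat.
  move: dv; rewrite dvE.
  rewrite FvE !(derivD, derivN, derivZ, derivXn, derivC) /= addr0.
  move: ss.@[v] nn.@[v] => s n; rewrite mulf_eq0 negb_or => /andP[n0 d1].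
  move/rootP; rewrite !(hornerD, hornerN, hornerZ, hornerMn, hornerXn, hornerC).
  move=> z6; apply/negP => /eqP z5.
  have z0 : z != 0.
    apply: contraNneq n0 => z0; rewrite -z6 z0; apply/eqP; ring.
  have sE : s = 2%:R * z ^+ 3.
    have : 3%:R * z ^+ 2 * (s - 2%:R * z ^+ 3) = 0.
      by rewrite -[RHS]oppr0 -z5; ring.
    move/eqP; rewrite mulf_eq0 mulf_eq0 expf_eq0 (negbTE z0) (negbTE (natf_neq0_char0 charK _)) //=.
    by rewrite subr_eq0 => /eqP.
  case/eqP: d1; transitivity (- 4%:R * (z ^+ 6 - s * z ^+ 3 + n)); last by rewrite z6 mulr0.
  by rewrite sE; ring.
apply: contraTeq sr => r0.
rewrite -leqNgt -srs; apply: (leq_trans (n := size (map_poly (meval v) r))); last first.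
  exact: size_poly.
apply: max_poly_roots => //; apply/allP => z zrs; apply/rootP.
have Fz : Fv.[z] = 0.
  by apply/rootP; rewrite rsE lFv scale1r root_prod_XsubC.
have : g.@[mappend v z] = 0.
  apply: g0; split; last by rewrite -muni_eval_append.
  apply: NNPP => no; case/negP: dv; apply/eqP.
  have v0 j : v j = 0.
    apply/eqP; apply: contra_notT no => vj; exists (widen_ord (leqnSn 2) j).
    by rewrite -[mappend v z _]/(mfirst (mappend v z) j) mfirst_append.
  rewrite /d mevalM sext_n_eval !v0.
  ring.
rewrite -muni_eval_append gE rmorphD rmorphM hornerD hornerM -/Fv Fz mulr0 add0r.
by [].
Qed.
End Sextic.

Lemma mwiden_eval (K : closedFieldType) n (u : 'I_n.+1 -> K) (p : {mpoly K[n]}) :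
  (mwiden p).@[u] = p.@[mfirst u].
Proof.
elim/mpoly_ring_ind: p => [c|i|p q IHp IHq|p q IHp IHq].
- by rewrite mwidenC !mevalC.
- by rewrite mwidenX mnmwiden1 !mevalXU.
- by rewrite mwidenD !mevalD IHp IHq.
- by rewrite mwidenM !mevalM IHp IHq.
Qed.

Lemma mwiden_pihomog (R : comNzRingType) n d (p : {mpoly R[n]}) :
  mwiden (pihomog mdeg d p) = pihomog mdeg d (mwiden p).
Proof.
elim/mpolyind: p => [|c m p _ _ IH]; first by rewrite !raddf0.
rewrite mwidenD !pihomogD mwidenD IH; congr (_ + _).
rewrite mwidenZ !linearZ /= mwidenZ; congr (_ *: _).
rewrite mwidenX !pihomogX /=.
have -> : mdeg (mnmwiden m) = mdeg m.
  rewrite !mdegE big_ord_recr /= mnmwiden_ordmax addn0.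
  by apply: eq_bigr => i _; rewrite mnmwiden_widen.
by case: eqP; rewrite ?mwidenX ?raddf0.
Qed.

Lemma mwiden_homog (R : comNzRingType) n d (p : {mpoly R[n]}) :
  p \is d.-homog -> mwiden p \is d.-homog.
Proof. by move/pihomog_dE <-; rewrite mwiden_pihomog pihomogP. Qed.

Lemma unmuniC (R : comNzRingType) n (p : {mpoly R[n]}) : unmuni p%:P = mwiden p.
Proof. by rewrite /unmuni map_polyC hornerC. Qed.

Lemma pihomogM_lt (R : comNzRingType) n d e (p q : {mpoly R[n]}) :
  q \is e.-homog -> (d < e)%N -> pihomog mdeg d (p * q) = 0.
Proof.
move=> hq lt_de; elim/mpolyind: p => [|c m p _ _ IH]; first by rewrite mul0r raddf0.
rewrite mulrDl pihomogD IH addr0 -scalerAl linearZ /=.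
have hm : 'X_[m] * q \is (mdeg m + e).-homog by rewrite dhomogM // dhomogX.
by rewrite (pihomog_ne0 _ hm) ?scaler0 // gtn_eqF // ltn_addl.
Qed.

Lemma homog_component_neq0 (R : comNzRingType) n (p : {mpoly R[n]}) : p != 0 ->
  exists d, pihomog mdeg d p != 0.
Proof.
move=> /eqP p0; apply: NNPP => no; apply: p0.
rewrite (pihomog_partitionE (leqnn (msize p))) big1 // => d _.
by apply/eqP; apply: contra_notT no => h; exists d.
Qed.

Lemma mderivXn (R : comNzRingType) n i (p : {mpoly R[n]}) m :
  mderiv i (p ^+ m.+1) = m.+1%:R * p ^+ m * mderiv i p.
Proof.
elim: m => [|m IH]; first by rewrite expr1 expr0 !mul1r.
by rewrite exprS mderivM IH -(natr1 m.+1) (exprS p m); ring.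
Qed.

Lemma mderivXU (R : comNzRingType) n (i j : 'I_n) :
  mderiv i ('X_j : {mpoly R[n]}) = (i == j)%:R.
Proof.
rewrite mderivX mnm1E eq_sym; case: eqP => [->|_]; last by rewrite scale0r.
by rewrite scale1r -[X in (X - _)%MM]add0m addmK mpolyX0.
Qed.

Lemma homog1_mono (R : comNzRingType) n (i : 'I_n) : ('X_i : {mpoly R[n]}) \is 1.-homog.
Proof. by rewrite dhomogX /= mdeg1. Qed.

Lemma homog0_const (R : comNzRingType) n (p : {mpoly R[n]}) : p \is 0.-homog ->
  p = (p@_0)%:MP.
Proof.
move=> hp; apply/mpolyP => m; rewrite mcoeffC.
have [->|m0] := eqVneq m 0%MM; first by rewrite mulr1.
by rewrite mulr0; apply: (dhomog_nemf_coeff hp); rewrite mdeg_eq0.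
Qed.

(** * Forms vanishing on the curve *)

Section Van.
Variables (K : closedFieldType) (charK : [pchar K] =i pred0).
Local Notation A := {mpoly K[2]}.
Local Notation F := (sextic K).
Implicit Types (g h : {mpoly K[3]}) (u v : 'I_3 -> K).

Lemma sextic_homog : F \is 6.-homog.
Proof.
have h (i : 'I_3) m : ('X_i : {mpoly K[3]}) ^+ m \is m.-homog.
  by rewrite -[m in m.-homog]mul1n; apply/dhomogMn/homog1_mono.
by rewrite /sextic; do ![apply: rpredB|apply: rpredD|apply: rpredZ] => //; apply: (dhomogM (h _ 3) (h _ 3)).
Qed.

Definition van g := forall u, on_cone u -> g.@[u] = 0.

Lemma van_dvd g : van g -> exists q, g = q * F.
Proof. by move/vanishesP/(sextic_nullstellensatz charK). Qed.

Lemma dvd_van q : van (q * F).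
Proof. by move=> u [_ Fu]; rewrite mevalM Fu mulr0. Qed.

Lemma van_prime g h : van (g * h) -> van g \/ van h.
Proof.
move=> /van_dvd/(sextic_prime charK) [] [q ->]; [left|right]; exact: dvd_van.
Qed.

Lemma van_cancel g h : ~ van g -> van (g * h) -> van h.
Proof. by move=> ng /van_prime []. Qed.

(** Density on the irreducible curve: zeros of a form [h] that does not vanish on C may be
    ignored. *)
Lemma van_off g h : ~ van h ->
  (forall u, on_cone u -> h.@[u] != 0 -> g.@[u] = 0) -> van g.
Proof.
move=> nh hg; apply: (van_cancel nh) => u cu; rewrite mevalM.
by have [->|/(hg u cu) ->] := eqVneq h.@[u] 0; rewrite ?mul0r ?mulr0.
Qed.

Lemma van_eq g h : (forall u, on_cone u -> g.@[u] = h.@[u]) -> van g -> van h.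
Proof. by move=> e hg u cu; rewrite -e // hg. Qed.

Lemma not_van g : ~ van g -> exists2 u, on_cone u & g.@[u] != 0.
Proof.
move=> ng; apply: NNPP => no; apply: ng => u cu; apply/eqP.
by apply: contra_notT no => gu; exists u.
Qed.

Lemma van_pihomog d g : van g -> van (pihomog mdeg d g).
Proof.
move=> /van_dvd [q ->]; have [le6|lt6] := leqP 6 d; last first.
  by rewrite (pihomogM_lt _ sextic_homog lt6) => u _; rewrite meval0.
by rewrite -(subnK le6) (pihomogM _ _ sextic_homog); apply: dvd_van.
Qed.

(** This turns congruences modulo F between forms of degree below 6 into identities. *)
Lemma van_small d g : g \is d.-homog -> (d < 6)%N -> van g -> g = 0.
Proof.
move=> hg lt6 /van_dvd [q gE].
by rewrite -(pihomog_dE hg) gE (pihomogM_lt _ sextic_homog lt6).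
Qed.

Lemma van_sextic g : g \is 6.-homog -> van g -> exists c, g = c *: F.
Proof.
move=> hg /van_dvd [q gE].
have := pihomog_dE hg; rewrite gE -[6%N]add0n (pihomogM _ _ sextic_homog) => <-.
exists (pihomog mdeg 0 q)@_0.
by rewrite -mul_mpolyC -homog0_const // pihomogP.
Qed.

Lemma on_cone_scale c u : c != 0 -> on_cone u -> on_cone (fun i => c * u i).
Proof.
move=> c0 [[i ui] Fu]; split; first by exists i; rewrite mulf_neq0.
by rewrite (homog_eval _ _ sextic_homog) Fu mulr0.
Qed.

Definition grad u i := (mderiv i F).@[u].

(** Obtained from F = 6 (X^6 + Y^6 + Z^6) - 5 (X^3 + Y^3 + Z^3)^2. *)
Lemma mderiv_sextic i : mderiv i F =
  \sum_j (i == j)%:R * (6%:R * 'X_j ^+ 2 * (6%:R * 'X_j ^+ 3 -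
    5%:R * ('X_i0 ^+ 3 + 'X_i1 ^+ 3 + 'X_i2 ^+ 3))).
Proof.
rewrite /sextic mderivB 2!mderivD 3!mderivXn mderivZ 2!mderivD.
rewrite (mderivM _ ('X_i0 ^+ 3)) (mderivM _ ('X_i1 ^+ 3)) (mderivM _ ('X_i2 ^+ 3)).
rewrite 3!mderivXn !mderivXU.
rewrite sum3 -mul_mpolyC mpolyC_nat.
move: (i == i0)%:R (i == i1)%:R (i == i2)%:R 'X_i0 'X_i1 'X_i2 => d0 d1 d2 X Y Z.
ring.
Qed.

Lemma grad_formula u i : grad u i = 6%:R * u i ^+ 2 *
  (6%:R * u i ^+ 3 - 5%:R * (u i0 ^+ 3 + u i1 ^+ 3 + u i2 ^+ 3)).
Proof.
rewrite /grad mderiv_sextic (bigD1 i) //= big1 => [|j /negbTE ne]; last first.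
  by rewrite eq_sym ne mul0r.
rewrite eqxx mul1r addr0 mevalM mevalM meval_nat mevalXn mevalB.
rewrite mevalM meval_nat mevalXn (mevalM _ 5%:R) meval_nat 2!mevalD 3!mevalXn.
by rewrite !mevalXU.
Qed.

(** At a singular point each nonzero coordinate has a cube equal to 5/6 of the sum S of the cubes.
    With k nonzero coordinates S = (5k/6) S, so S and these cubes vanish in characteristic 0. *)
Lemma sextic_smooth u : on_cone u -> exists i, grad u i != 0.
Proof.
move=> [[k uk] Fu]; apply: NNPP => no; move: uk; apply/negP; rewrite negbK.
have {no} g0 i : u i = 0 \/ u i ^+ 3 *+ 6 = 5%:R * (u i0 ^+ 3 + u i1 ^+ 3 + u i2 ^+ 3).
  have /eqP : grad u i = 0 by apply/eqP; apply: contra_notT no => gi; exists i.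
  rewrite grad_formula mulf_eq0 mulf_eq0 (negbTE (natf_neq0_char0 charK _)) //= expf_eq0 /=.
  by rewrite subr_eq0 => /orP[] /eqP h; [left|right; rewrite -h mulr_natl].
have n2 := natf_neq0_char0 charK (isT : 2 != 0%N).
have n3 := natf_neq0_char0 charK (isT : 3 != 0%N).
move: Fu; rewrite sexticE.
have := g0 i0; have := g0 i1; have := g0 i2.
have cub0 (z : K) m : m.+1%:R != 0 :> K -> m.+1%:R * z ^+ 3 = 0 -> z = 0.
  by move=> m0 /eqP; rewrite mulf_eq0 (negbTE m0) expf_eq0 => /eqP.
have s6 (z : K) : z ^+ 6 = 0 -> z = 0 by move/eqP; rewrite expf_eq0 => /eqP.
suff all0 (a b c : K) :
    (c = 0 \/ c ^+ 3 *+ 6 = 5%:R * (a ^+ 3 + b ^+ 3 + c ^+ 3)) ->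
    (b = 0 \/ b ^+ 3 *+ 6 = 5%:R * (a ^+ 3 + b ^+ 3 + c ^+ 3)) ->
    (a = 0 \/ a ^+ 3 *+ 6 = 5%:R * (a ^+ 3 + b ^+ 3 + c ^+ 3)) ->
    sext a b c = 0 -> [/\ a = 0, b = 0 & c = 0].
  by move=> h2 h1 h0 h; have [u0 u1 u2] := all0 _ _ _ h2 h1 h0 h; apply/eqP; elim/ord3P: k.
have two (x y : K) : (x = 0 \/ x ^+ 3 *+ 6 = 5%:R * (x ^+ 3 + y ^+ 3)) ->
    (y = 0 \/ y ^+ 3 *+ 6 = 5%:R * (x ^+ 3 + y ^+ 3)) ->
    x ^+ 6 + y ^+ 6 - 10%:R * (x ^+ 3 * y ^+ 3) = 0 -> x = 0 /\ y = 0.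
  have e0 m : (0 : K) ^+ m.+1 = 0 by rewrite exprS mul0r.
  case=> [->|hx]; first by move=> _; rewrite !e0 mul0r mulr0 subr0 add0r => /s6.
  case=> [->|hy]; first by rewrite !e0 !mulr0 subr0 addr0 => /s6.
  move=> _; have x0 : x ^+ 3 = 5%:R * y ^+ 3.
    by transitivity (x ^+ 3 *+ 6 - 5%:R * x ^+ 3); [ring|rewrite hx; ring].
  have y0 : y = 0.
    apply: (cub0 y 23); first exact: natf_neq0_char0.
    transitivity (5%:R * x ^+ 3 + 5%:R * y ^+ 3 - (y ^+ 3 *+ 6)); last by rewrite hy; ring.
    by rewrite x0; ring.
  by split=> //; apply: (cub0 x 0); rewrite ?oner_eq0 // x0 y0; ring.
have sextC (x y z : K) : sext x y z = sext y z x by rewrite /sext; ring.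
have sext0 (y z : K) : sext 0 y z = y ^+ 6 + z ^+ 6 - 10%:R * (y ^+ 3 * z ^+ 3).
  by rewrite /sext; ring.
have z3 (x y : K) : 0 ^+ 3 + x + y = x + y by ring.
have z3' (x y : K) : x + 0 ^+ 3 + y = x + y by ring.
have z3'' (x y : K) : x + y + 0 ^+ 3 = x + y by ring.
case=> [->|hc] hb ha.
  move: hb ha; rewrite !z3'' -sextC sext0 => hb ha h.
  by have [-> ->] := two _ _ ha hb h.
case: hb => [b0|hb].
  move: b0 ha hc => ->; rewrite !z3' sextC sext0 [a ^+ 3 + _]addrC => ha hc h.
  by have [-> ->] := two _ _ (or_intror hc) ha h.
case: ha => [a0|ha].
  move: a0 hb hc => ->; rewrite !z3 sext0 => hb hc h.
  by have [-> ->] := two _ _ (or_intror hb) (or_intror hc) h.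
have ab : a ^+ 3 = b ^+ 3.
  apply: (mulfI (natf_neq0_char0 charK (isT : 6%N != 0%N))).
  by rewrite !mulr_natl ha hb.
have ac : a ^+ 3 = c ^+ 3.
  apply: (mulfI (natf_neq0_char0 charK (isT : 6%N != 0%N))).
  by rewrite !mulr_natl ha hc.
have a0 : a = 0.
  apply: (cub0 a 8); first exact: natf_neq0_char0.
  transitivity (5%:R * (a ^+ 3 + a ^+ 3 + a ^+ 3) - a ^+ 3 *+ 6); first by ring.
  by rewrite ha -ab -ac subrr.
by move=> _; split=> //; apply: (cub0 _ 0); rewrite ?oner_eq0 // -?ab -?ac a0; ring.
Qed.
End Van.

(** * Regularity of rational maps *)

Section Binary.
Variable K : closedFieldType.
Local Notation A := {mpoly K[2]}.
Local Notation o0 := (inord 0 : 'I_2).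
Local Notation o1 := (inord 1 : 'I_2).
Implicit Types (n : A) (v w : 'I_2 -> K).

Lemma ord2P (P : 'I_2 -> Prop) : P o0 -> P o1 -> forall i, P i.
Proof. by move=> P0 P1 i; rewrite -[i]inord_val; case: i => [[|[|]] /=]. Qed.

Lemma sum2 (V : nmodType) (f : 'I_2 -> V) : \sum_i f i = f o0 + f o1.
Proof.
rewrite !big_ord_recr big_ord0 /= add0r.
by congr (f _ + f _); apply: val_inj; rewrite /= inordK.
Qed.

Lemma inord2_eq : (o1 == o0) = false.
Proof. by rewrite -val_eqE /= !inordK. Qed.

(** Coefficients of the binary linear form that vanishes at [v]. *)
Definition dual2 v : 'I_2 -> K := fun i => if i == o0 then v o1 else - v o0.

Lemma dual2_neq0 v : (exists i, v i != 0) -> exists i, dual2 v i != 0.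
Proof.
case=> i; elim/ord2P: i => vi; [exists o1|exists o0]; rewrite /dual2 ?eqxx //.
by rewrite inord2_eq oppr_eq0.
Qed.

Lemma on_plane_dual2 v w : (exists i, v i != 0) -> on_plane (dual2 v) w ->
  exists c, forall i, w i = c * v i.
Proof.
rewrite /on_plane sum2 /dual2 eqxx inord2_eq mulNr => -[i vi] /eqP.
rewrite subr_eq0 => /eqP e; elim/ord2P: i vi => vi.
  exists (w o0 / v o0); elim/ord2P; first by rewrite divfK.
  by apply: (mulfI vi); rewrite -e; field.
exists (w o1 / v o1); elim/ord2P; last by rewrite divfK.
by apply: (mulfI vi); rewrite e; field.
Qed.

Lemma dual2_self v : on_plane (dual2 v) v.
Proof. by rewrite /on_plane sum2 /dual2 eqxx inord2_eq mulrC; ring. Qed.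

Lemma binary_factor e n v : (exists i, v i != 0) -> n \is e.+1.-homog ->
  n.@[v] = 0 -> exists2 m, m \is e.-homog & n = m * lform (dual2 v).
Proof.
move=> v0 hn nv; apply: vanish_plane_dvd_homog => //; first exact: dual2_neq0.
move=> w /(on_plane_dual2 v0) [c cw].
by rewrite (meval_eq _ (cw : w =1 _)) (homog_eval _ _ hn) nv mulr0.
Qed.

Lemma binary_root e n : n \is e.+1.-homog -> exists2 v, (exists i, v i != 0) & n.@[v] = 0.
Proof.
move=> hn; pose pt (a b : K) (i : 'I_2) := if i == o0 then a else b.
have sl y : (slice 1 n).[y] = n.@[pt 1 y].
  elim/mpoly_ring_ind: n {hn} => [c|i|p q IHp IHq|p q IHp IHq].
  - by rewrite sliceC hornerC mevalC.
  - rewrite mevalXU; elim/ord2P: i; rewrite /pt ?eqxx ?inord2_eq.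
      by rewrite sliceX hornerC.
    by rewrite sliceY hornerX.
  - by rewrite mevalD -IHp -IHq rmorphD hornerD.
  - by rewrite mevalM -IHp -IHq rmorphM hornerM.
have [/size_poly1P[c c0 sc]|] := boolP (size (slice 1 n) == 1%N); last first.
  move/closed_rootP => [y /rootP]; rewrite sl => ny.
  by exists (pt 1 y) => //; exists o0; rewrite /pt eqxx oner_eq0.
(* The dehomogenization is a nonzero constant, so [n] is a multiple of a power of the first variable
   and vanishes at (0 : 1). *)
exists (pt 0 1); first by exists o1; rewrite /pt inord2_eq oner_eq0.
have X0 : ('X_o0 : A) != 0 by rewrite -msize_poly_eq0 msizeX.
suff -> : n = c *: 'X_o0 ^+ e.+1.
  by rewrite mevalZ mevalXn mevalXU /pt eqxx expr0n mulr0.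
apply/eqP; rewrite -subr_eq0; apply/eqP/(mpoly_zero_fun_off X0) => v.
rewrite mevalXU mevalB mevalZ mevalXn mevalXU => v0.
have -> : n.@[v] = n.@[fun i => v o0 * pt 1 (v o1 / v o0) i].
  apply: meval_eq; elim/ord2P; rewrite /pt ?eqxx ?inord2_eq ?mulr1 //.
  by rewrite mulrC divfK.
by rewrite (homog_eval _ _ hn) -sl sc hornerC mulrC subrr.
Qed.
End Binary.

(** Divisibility may be tested locally at each root of [f], which allows multiple roots: a root of
    the part of [f] missing in [r] would be a root of the local unit [h]. *)
Lemma closed_dvdp_local (K : closedFieldType) (f r : {poly K}) : f != 0 ->
  (forall z, root f z -> exists2 h, h.[z] != 0 & f %| r * h) -> f %| r.
Proof.
move=> f0 H; pose g := gcdp f r; pose D := f %/ g; pose r' := r %/ g.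
have g0 : g != 0 by rewrite gcdp_eq0 negb_and f0.
have fE : f = D * g by rewrite divpK ?dvdp_gcdl.
have rE : r = r' * g by rewrite divpK ?dvdp_gcdr.
have co : coprimep D r'.
  by apply: coprimep_div_gcd; rewrite f0.
have [sD|/closed_rootP[z Dz]] := boolP (size D == 1%N).
  apply: (dvdp_trans _ (dvdp_gcdr f r)); rewrite -/g [f in f %| _]fE.
  by case/size_poly1P: sD => c c0 ->; rewrite mul_polyC dvdpZl.
have Df : D %| f by rewrite fE dvdp_mulr.
have [h hz fh] := H z (root_dvdp Df Dz).
have Dh : D %| h.
  by move: fh; rewrite {1}fE rE mulrAC dvdp_mul2r // Gauss_dvdpr.
by have := root_dvdp Dh Dz; rewrite rootE (negbTE hz).
Qed.

(** * Norms to binary forms *)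

Section LocalDivision.
Variables (K : closedFieldType) (charK : [pchar K] =i pred0).
Local Notation A := {mpoly K[2]}.
Local Notation F := (sextic K).
Implicit Types (g h b : {mpoly K[3]}) (u v : 'I_3 -> K) (n : A).

Lemma muni_prime (p q r : {poly A}) : p * q = r * muni F ->
  (exists t, p = t * muni F) \/ (exists t, q = t * muni F).
Proof.
rewrite muni_sextic; have [w [w0 w1]] := cube_root1_exists charK.
apply: (@trisextic_prime A w%:MP).
- by rewrite -(rmorphXn (@mpolyC 2 K)) -mpolyC1 -!mpolyCD w0 mpolyC0.
- by rewrite -mpolyC1 -subr_eq0 -mpolyCB mpolyC_eq0 subr_eq0.
- exact: sext_no_quadratic_root.
- exact: sext_n_not_cube.
Qed.

Lemma fibre_exists (w : 'I_2 -> K) : exists z, F.@[mappend w z] = 0.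
Proof.
have : size (map_poly (meval w) (muni F)) != 1%N.
  by rewrite muni_sextic map_trisextic size_trisextic_domain.
by case/closed_rootP => z /rootP; rewrite muni_eval_append; exists z.
Qed.

Lemma mappend_neq0 (w : 'I_2 -> K) z : (exists i, w i != 0) -> exists i, mappend w z i != 0.
Proof.
case=> i wi; exists (widen_ord (leqnSn 2) i).
by rewrite -[mappend w z _]/(mfirst (mappend w z) i) mfirst_append.
Qed.

Lemma van_mwiden n : van (mwiden n) -> n = 0.
Proof.
move=> vn; have X0 : ('X_(inord 0) : A) != 0 by rewrite -msize_poly_eq0 msizeX.
apply: (mpoly_zero_fun_off X0) => w; rewrite mevalXU => w0.
have [z Fz] := fibre_exists w.
rewrite -(meval_eq _ (mfirst_append w z)) -mwiden_eval; apply: vn; split=> //.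
by apply: mappend_neq0; exists (inord 0).
Qed.

(** The resultant with F in the last variable serves as a norm of [b] to K[x,y]; it lies in the
    ideal of F and [b]. *)
Lemma norm_exists b : ~ van b ->
  exists a n, n != 0 /\ van (a * b - mwiden n).
Proof.
move=> nb; have [q [r []]] := trisextic_rem (sext_s K) (sext_n K) (muni b).
rewrite -muni_sextic => bE sr.
have sF : size (muni F) = 7%N by rewrite muni_sextic size_trisextic_domain.
have r0 : r != 0.
  apply: contra_notN nb => /eqP r0; rewrite r0 addr0 in bE.
  have [p ->] := sextic_dvd_quo bE; exact: dvd_van.
have lift (c : A) (a k : {poly A}) : c%:P = k * muni F + a * r -> 
    van (unmuni a * b - mwiden c).
  move=> cE; apply: (@van_eq _ ((unmuni (a * q) - unmuni k) * F)); last exact: dvd_van.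
  move=> u _; congr (_.@[u]); rewrite -unmuniC cE unmuniD !unmuniM muniK.
  have -> : unmuni r = b - unmuni q * F.
    by rewrite -[b in RHS]muniK bE unmuniD unmuniM muniK addrC addKr.
  by ring.
have [sr1|sr1] := leqP (size r) 1.
  exists (unmuni 1), r`_0; split; last first.
    by apply: (@lift _ _ 0); rewrite mul0r mul1r add0r -size1_polyC.
  by apply: contraNneq r0 => r00; rewrite (size1_polyC sr1) r00.
have [|[a1 a2] /= _ resE] := resultant_in_ideal (_ : 1 < size (muni F))%N sr1.
  by rewrite sF.
exists (unmuni a2), (resultant (muni F) r); split; last exact: lift resE.
(* The resultant is nonzero when the gcd [D] is constant. F is prime and divides [E * D]; it cannot
   divide [D], whose degree is below 6, and if it divides [E] then [D] divides a constant. *)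
rewrite resultant_eq0 -leqNgt leq_eqVlt; apply/orP; left.
set D := Pdiv.Idomain.gcdp _ _.
have D0 : D != 0 by rewrite /D Pdiv.Idomain.gcdp_eq0 negb_and r0 orbT.
have [[c E] /= c0 FE] := Pdiv.Idomain.dvdpP _ _ (Pdiv.Idomain.dvdp_gcdl (muni F) r).
have Dr : (size D <= size r)%N by apply: Pdiv.Idomain.dvdp_leq => //; apply: Pdiv.Idomain.dvdp_gcdr.
have F0 : muni F != 0 by rewrite -size_poly_eq0 sF.
have cP0 : c%:P != 0 by rewrite polyC_eq0.
have ED : E * D = c%:P * muni F by rewrite mul_polyC FE.
case: (muni_prime ED) => -[t tE].
  have cE : c%:P = t * D by apply: (mulIf F0); rewrite -ED tE mulrAC.
  have t0 : t != 0 by apply: contraNneq cP0 => t0; rewrite cE t0 mul0r.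
  have := size_mul t0 D0; rewrite -cE size_polyC c0.
  move: t0 D0; rewrite -!size_poly_gt0; move: (size t) (size D) => x y; clear; lia.
have t0 : t != 0 by apply: contraNneq D0 => t0; rewrite tE t0 mul0r.
have := size_mul t0 F0; rewrite -tE sF.
move: t0 Dr sr; rewrite -size_poly_gt0; move: (size t) (size D) (size r) => x y z; clear; lia.
Qed.
End LocalDivision.

(** * A local parameter at a point of the curve *)

Section Regular.
Variables (K : closedFieldType) (charK : [pchar K] =i pred0).
Local Notation A := {mpoly K[2]}.
Local Notation F := (sextic K).
Implicit Types (g h b : {mpoly K[3]}) (u v : 'I_3 -> K) (n : A).

Lemma norm_homog d b : b \is d.-homog -> ~ van b -> exists k a n,
  [/\ n != 0, a \is k.-homog, n \is (k + d).-homog & van (a * b - mwiden n)].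
Proof.
move=> hb nb; have [a [n [n0 anb]]] := norm_exists charK nb.
have [e ne] := homog_component_neq0 n0.
have := van_pihomog charK e anb; rewrite pihomogB -mwiden_pihomog.
have [de|ed] := leqP d e; last first.
  rewrite (pihomogM_lt _ hb ed) sub0r => vn; case/eqP: ne.
  by apply: (van_mwiden (K := K)) => u cu; have /eqP := vn u cu; rewrite mevalN oppr_eq0 => /eqP.
rewrite -[e in pihomog _ e (a * b)](subnK de) (pihomogM _ _ hb) => vn.
exists (e - d)%N, (pihomog mdeg (e - d) a), (pihomog mdeg e n); split=> //.
  exact: pihomogP.
by rewrite subnK // pihomogP.
Qed.

(** The line joining [v] to (0 : 0 : 1). Where the partial derivative of F in Z is nonzero it is
    transversal to the curve, hence a local parameter at [v]. *)
Definition tangent_form v : {mpoly K[3]} := mwiden (lform (dual2 (mfirst v))).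

Lemma tangent_form_homog v : tangent_form v \is 1.-homog.
Proof. exact/mwiden_homog/lform_homog. Qed.

Lemma tangent_form_not_van v : (exists i, mfirst v i != 0) -> ~ van (tangent_form v).
Proof. by move=> v0 /van_mwiden /eqP; rewrite (negbTE (lform_neq0 (dual2_neq0 v0))). Qed.

Lemma tangent_form_self v : (tangent_form v).@[v] = 0.
Proof. by rewrite mwiden_eval lform_eval; exact: dual2_self. Qed.

Lemma on_cone_mfirst v : on_cone v -> exists i, mfirst v i != 0.
Proof.
move=> [[i vi] Fv]; apply: NNPP => no.
have w0 j : mfirst v j = 0 by apply/eqP; apply: contra_notT no => h; exists j.
have e0 : v i0 = 0 by rewrite -(w0 (inord 0)) /mfirst; congr v; apply: val_inj; rewrite /= !inordK.
have e1 : v i1 = 0 by rewrite -(w0 (inord 1)) /mfirst; congr v; apply: val_inj; rewrite /= !inordK.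
have e2 : v i2 = 0.
  move: Fv; rewrite sexticE e0 e1 /sext.
  have -> : 0 ^+ 6 + 0 ^+ 6 + v i2 ^+ 6 - 10%:R * (0 ^+ 3 * 0 ^+ 3 + 0 ^+ 3 * v i2 ^+ 3
     + v i2 ^+ 3 * 0 ^+ 3) = v i2 ^+ 6 by ring.
  by move/eqP; rewrite expf_eq0 => /eqP.
by move: vi; elim/ord3P: i; rewrite ?e0 ?e1 ?e2 eqxx.
Qed.

(** The order of [n] at [v] is finite. A binary form that vanishes at [v] contains the factor
    [tangent_form v], which can be cancelled; when none is left, evaluation at [v] refutes the
    relation with exponent 1. *)
Lemma order_bound v e n : on_cone v -> n \is e.-homog -> n != 0 ->
  exists k, forall B Q, B.@[v] != 0 -> ~ van (B * mwiden n - tangent_form v ^+ k * Q).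
Proof.
move=> cv; have v0 := on_cone_mfirst cv.
have base m : m.@[mfirst v] != 0 -> exists k, forall B Q, B.@[v] != 0 ->
    ~ van (B * mwiden m - tangent_form v ^+ k * Q).
  move=> nv; exists 1%N => B Q Bv /(_ v cv) /eqP.
  rewrite expr1 mevalB !mevalM tangent_form_self mul0r subr0 mwiden_eval.
  by rewrite mulf_eq0 (negbTE nv) (negbTE Bv).
elim: e n => [|e IH] n hn n0; have [nv|/base //] := eqVneq n.@[mfirst v] 0.
  case/eqP: n0; move: nv; rewrite (homog0_const hn) mevalC => ->.
  exact: mpolyC0.
have [m hm nE] := binary_factor v0 hn nv.
have m0 : m != 0 by apply: contraNneq n0 => m0; rewrite nE m0 mul0r.
have [k kP] := IH m hm m0; exists k.+1 => B Q Bv vn; apply: (kP B Q Bv).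
apply: (van_cancel charK (tangent_form_not_van v0)).
apply: van_eq vn => u _; congr (_.@[u]).
by rewrite nE mwidenM exprS -/(tangent_form v); ring.
Qed.

(* The ideal of a point is generated by two linear forms, one of them tangent_form. *)
Lemma point_ideal v : (exists i, mfirst v i != 0) ->
  exists lam : {mpoly K[3]}, [/\ lam \is 1.-homog, lam.@[v] = 0, mderiv i2 lam = 1 &
  forall d g, g \is d.-homog -> g.@[v] = 0 ->
    exists a b, g = a * lam + b * tangent_form v].
Proof.
have wE (i : 'I_2) : mfirst v i = v (inord i).
  by rewrite /mfirst; congr v; apply: val_inj; rewrite /= inordK // ltnS ltnW.
case=> j vj; pose J : 'I_3 := inord j.
have vJ : v J != 0 by rewrite -wE.
pose lam : {mpoly K[3]} := 'X_i2 - (v i2 / v J) *: 'X_J.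
have tfE : tangent_form v = v i1 *: 'X_i0 - v i0 *: 'X_i1.
  rewrite /tangent_form /lform sum2 /dual2 eqxx inord2_eq !wE !inordK // mwidenD !mwidenZ.
  rewrite !mwidenX !mnmwiden1 scaleNr; congr (_ *: 'X_ _ - _ *: 'X_ _);
   by apply: val_inj; rewrite /= !inordK.
exists lam; split.
- by apply: rpredB; rewrite ?rpredZ ?homog1_mono.
- by rewrite mevalB mevalZ !mevalXU divfK ?subrr.
- rewrite mderivB mderivZ !mderivXU eqxx /J.
  have -> : (i2 == inord j) = false.
    by apply/negbTE; rewrite -val_eqE /= !inordK ?neq_ltn ?ltn_ord ?orbT // ltnS ltnW.
  by rewrite scaler0 subr0.
move=> d g hg gv.
pose p : 3.-tuple {mpoly K[3]} := [tuple (v i / v J) *: 'X_J | i < 3].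
have gp : g \mPo p = 0.
  apply: mpoly_zero_fun => u; rewrite comp_mpoly_meval.
  have e : (fun i => (tnth p i).@[u]) =1 (fun i => (u J / v J) * v i).
    by move=> i; rewrite tnth_mktuple mevalZ mevalXU mulrAC [RHS]mulrC mulrA.
  by rewrite (meval_eq _ e) (homog_eval _ _ hg) gv mulr0.
suff [a [b ab]] : exists a b, g - (g \mPo p) = a * lam + b * tangent_form v.
  by exists a, b; rewrite -ab gp subr0.
elim/mpoly_ring_ind: g {hg gv gp} => [c|i|q r [a [b ab]] [a' [b' ab']]|q r [a [b ab]] [a' [b' ab']]].
- by exists 0, 0; rewrite comp_mpolyC subrr !mul0r addr0.
- rewrite comp_mpolyXU -tnth_nth tnth_mktuple.
  have [->|iJ] := eqVneq i J.
    by exists 0, 0; rewrite divff // scale1r subrr !mul0r addr0.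
  have [->|i2'] := eqVneq i i2; first by exists 1, 0; rewrite mul1r mul0r addr0.
  exists 0; rewrite tfE.
  have JE : J = i0 \/ J = i1.
    by rewrite /J; elim/ord2P: (j); rewrite inordK //; [left|right].
  case: JE => JE; rewrite JE in iJ vJ *; elim/ord3P: i iJ i2'; rewrite ?eqxx // => _ _.
    exists (- (v i0)^-1)%:MP; rewrite mul0r add0r; apply: mpoly_fun_inj => u.
    by rewrite mevalM mevalC !mevalB !mevalZ !mevalXU; field.
  exists ((v i1)^-1)%:MP; rewrite mul0r add0r; apply: mpoly_fun_inj => u.
  by rewrite mevalM mevalC !mevalB !mevalZ !mevalXU; field.
- by exists (a + a'), (b + b'); rewrite comp_mpolyD; have := congr2 +%R ab ab' => e;
    rewrite opprD addrACA e; ring.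
- exists (a * r + (q \mPo p) * a'), (b * r + (q \mPo p) * b'); rewrite rmorphM /=.
  transitivity ((q - (q \mPo p)) * r + (q \mPo p) * (r - (r \mPo p))); first by ring.
  by rewrite ab ab'; ring.
Qed.

(** Write F = a lam + b l with l the local parameter; then a(v) is the partial derivative of F in Z,
    so [a] is a unit at [v]. For g = a' lam + b' l this gives a g = l (a b' - a' b) modulo F. *)
Lemma local_division v : on_cone v -> grad v i2 != 0 ->
  exists a, [/\ a \is 5.-homog, a.@[v] != 0 & forall d g, g \is d.-homog -> g.@[v] = 0 ->
    exists2 q, q \is (d + 4).-homog & van (a * g - tangent_form v * q)].
Proof.
move=> cv gv; have v0 := on_cone_mfirst cv.
have [lam [hlam lamv dlam gen]] := point_ideal v0.
have htf := tangent_form_homog v.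
have [a0 [b0 FE]] := gen _ _ (sextic_homog K) cv.2.
have {}FE : F = pihomog mdeg 5 a0 * lam + pihomog mdeg 5 b0 * tangent_form v.
  by rewrite -(pihomog_dE (sextic_homog K)) {1}FE pihomogD -[6%N]/(5 + 1)%N !pihomogM.
have := @pihomogP 3 K mdeg 5 a0; have := @pihomogP 3 K mdeg 5 b0.
move: (pihomog _ _ a0) (pihomog _ _ b0) FE => a b FE hb ha {a0 b0}.
exists a; split=> //.
  apply: contraNneq gv => av.
  have dtf : mderiv i2 (tangent_form v) = 0.
    rewrite /tangent_form /lform sum2 mwidenD !mwidenZ !mwidenX !mnmwiden1.
    rewrite mderivD !mderivZ !mderivXU.
    have ne (i : 'I_2) : (i2 == widen_ord (leqnSn 2) i) = false.
      by apply/negbTE; rewrite -val_eqE /= inordK // neq_ltn ltn_ord orbT.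
    by rewrite !ne !scaler0 addr0.
  rewrite /grad {1}FE mderivD !mderivM dlam dtf !mevalD !mevalM av lamv.
  by rewrite tangent_form_self meval0; apply/eqP; ring.
move=> d g hg gv'; have [a' [b' gE]] := gen _ _ hg gv'.
exists (pihomog mdeg (d + 4) (a * b' - a' * b)); first exact: pihomogP.
have e : van (a * g - tangent_form v * (a * b' - a' * b)).
  apply: (@van_eq _ (a' * F)); last exact: dvd_van.
  by move=> u _; congr (_.@[u]); rewrite gE [in LHS]FE; ring.
have := van_pihomog charK (d + 5) e; rewrite pihomogB.
rewrite (pihomog_dE (_ : a * g \is (d + 5).-homog)) ?[(d + 5)%N]addnC ?dhomogM //.
rewrite [(5 + d)%N](_ : _ = (d + 4) + 1)%N; last by lia.
by rewrite [tangent_form v * _]mulrC pihomogM // [_ * tangent_form v]mulrC.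
Qed.
End Regular.

Lemma muni_mwiden (R : comNzRingType) n (p : {mpoly R[n]}) : muni (mwiden p) = p%:P.
Proof.
elim/mpoly_ring_ind: p => [c|i|p q IHp IHq|p q IHp IHq].
- by rewrite mwidenC muniC.
- by rewrite mwidenX mnmwiden1 muni_widen.
- by rewrite mwidenD muniD polyCD; congr (_ + _).
- by rewrite mwidenM muniM polyCM; congr (_ * _).
Qed.

(** * Regularity of rational maps and everywhere regular quotients *)

Section Extend.
Variables (K : closedFieldType) (charK : [pchar K] =i pred0).
Local Notation A := {mpoly K[2]}.
Local Notation F := (sextic K).
Implicit Types (g h b : {mpoly K[3]}) (u v : 'I_3 -> K) (n : A).
Implicit Types (s t : 3.-tuple {mpoly K[3]}).

Lemma same_mapP k (s t : k.-tuple {mpoly K[3]}) : same_map F s t <->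
  [/\ is_ratmap F s, is_ratmap F t &
    forall i j, van (tnth s i * tnth t j - tnth s j * tnth t i)].
Proof. by split=> -[hs ht st]; split=> // i j; apply/vanishesP/st. Qed.

Lemma is_ratmapP k (t : k.-tuple {mpoly K[3]}) : is_ratmap F t <->
  (exists d, forall i, tnth t i \is d.-homog) /\ exists i, ~ van (tnth t i).
Proof.
by split=> -[hd [i ti]]; split=> //; exists i => vi; apply: ti; apply/vanishesP.
Qed.

Lemma same_map_refl k (t : k.-tuple {mpoly K[3]}) : is_ratmap F t -> same_map F t t.
Proof.
by move=> ht; apply/same_mapP; split=> // i j u _; rewrite mulrC subrr meval0.
Qed.

Lemma vanB_eq g h u : van (g - h) -> on_cone u -> g.@[u] = h.@[u].
Proof. by move=> gh cu; apply/eqP; rewrite -subr_eq0 -mevalB gh. Qed.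

Lemma vanB_intro g h : (forall u, on_cone u -> g.@[u] = h.@[u]) -> van (g - h).
Proof. by move=> gh u cu; rewrite mevalB gh // subrr. Qed.

(** While all representatives vanish at [v], the local parameter can be divided out again and again.
    The norm of a nonzero component of [t] would then have infinite order at [v]. *)
Lemma ratmap_regular2 t v : is_ratmap F t -> on_cone v -> grad v i2 != 0 ->
  exists2 s, same_map F t s & exists i, (tnth s i).@[v] != 0.
Proof.
move=> ht cv gv; apply: NNPP => noreg.
have v0 := on_cone_mfirst cv; have nl := tangent_form_not_van v0.
have [a [ha av divide]] := local_division charK cv gv.
have nva : ~ van a by move=> /(_ v cv)/eqP; rewrite (negbTE av).
have step k : exists B s, [/\ B.@[v] != 0, same_map F t s &
    forall i, van (B * tnth t i - tangent_form v ^+ k * tnth s i)].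
  elim: k => [|k [B [s [Bv st Bs]]]].
    exists 1, t; split; [by rewrite meval1 oner_eq0 | exact: same_map_refl |].
    by move=> i u _; rewrite expr0 subrr meval0.
  have /same_mapP [_ /is_ratmapP [[d hs] [j sj]] cross] := st.
  have sv i : (tnth s i).@[v] = 0.
    by apply/eqP; apply: contra_notT noreg => si; exists s => //; exists i.
  have /fin_all_exists2 [q hq vq] i := divide d (tnth s i) (hs i) (sv i).
  exists (a * B), [tuple q i | i < 3]; split.
  - by rewrite mevalM mulf_neq0.
  - apply/same_mapP; split=> //.
      apply/is_ratmapP; split; first by exists (d + 4)%N => i; rewrite tnth_mktuple.
      exists j; rewrite tnth_mktuple => vqj.
      have [//|//] : van a \/ van (tnth s j).
      apply: (van_prime charK) => u cu; have /eqP := vq j u cu.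
      by rewrite mevalB [X in _ - X]mevalM (vqj u cu) mulr0 subr0 => /eqP.
    move=> i l; rewrite !tnth_mktuple; apply: (van_cancel charK nl) => u cu.
    have ei : a.@[u] * (tnth s i).@[u] = (tangent_form v).@[u] * (q i).@[u].
      by apply/eqP; rewrite -subr_eq0 -!mevalM -mevalB vq.
    have el : a.@[u] * (tnth s l).@[u] = (tangent_form v).@[u] * (q l).@[u].
      by apply/eqP; rewrite -subr_eq0 -!mevalM -mevalB vq.
    have ec := cross i l u cu; rewrite mevalB !mevalM in ec.
    rewrite mevalM mevalB (mevalM _ (tnth t i)) (mevalM _ (tnth t l)).
    transitivity ((tnth t i).@[u] * ((tangent_form v).@[u] * (q l).@[u])
      - (tnth t l).@[u] * ((tangent_form v).@[u] * (q i).@[u])); first by ring.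
    rewrite -ei -el; transitivity (a.@[u] * ((tnth t i).@[u] * (tnth s l).@[u] -
      (tnth t l).@[u] * (tnth s i).@[u])); first by ring.
    by rewrite ec mulr0.
  move=> i; rewrite tnth_mktuple => u cu.
  have e1 := Bs i u cu; have e2 := vq i u cu.
  move: e1 e2; rewrite !mevalB !mevalM !mevalXn => e1 e2.
  transitivity (a.@[u] * (B.@[u] * (tnth t i).@[u] - (tangent_form v).@[u] ^+ k * (tnth s i).@[u])
    + (tangent_form v).@[u] ^+ k * (a.@[u] * (tnth s i).@[u] - (tangent_form v).@[u] * (q i).@[u])).
    by rewrite exprS; ring.
  by rewrite e1 e2 !mulr0 addr0.
have /is_ratmapP [[d hd] [j tj]] := ht.
have [e [al [n [n0 hal hn aln]]]] := norm_homog charK (hd j) tj.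
have [k kP] := order_bound charK cv hn n0.
have [B [s [Bv _ Bs]]] := step k.
apply: (kP B (al * tnth s j) Bv) => u cu.
have e1 := Bs j u cu; have e2 := aln u cu.
move: e1 e2; rewrite !mevalB !mevalM => e1 e2.
transitivity (al.@[u] * (B.@[u] * (tnth t j).@[u] - (tangent_form v ^+ k).@[u] * (tnth s j).@[u])
  - B.@[u] * (al.@[u] * (tnth t j).@[u] - (mwiden n).@[u])); first by ring.
by rewrite e1 e2 !mulr0 subr0.
Qed.

(** The curve is symmetric in the coordinates, so a nonzero partial derivative can be moved to the
    last variable. *)
Definition swap_vars k : 3.-tuple {mpoly K[3]} := [tuple 'X_(tperm k i2 i) | i < 3].

Lemma swap_vars_eval k g u : (g \mPo swap_vars k).@[u] = g.@[u \o tperm k i2].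
Proof.
rewrite comp_mpoly_meval; apply: meval_eq => i.
by rewrite tnth_mktuple mevalXU.
Qed.

Lemma swap_varsK k g : (g \mPo swap_vars k) \mPo swap_vars k = g.
Proof.
apply: mpoly_fun_inj => u; rewrite !swap_vars_eval; apply: meval_eq => i /=.
by rewrite tpermK.
Qed.

Lemma perm_sum3 (p : 'S_3) (f : 'I_3 -> K) :
  f (p i0) + f (p i1) + f (p i2) = f i0 + f i1 + f i2.
Proof.
by rewrite -(sum3 f) -(sum3 (fun i => f (p i))) [RHS](reindex_inj (@perm_inj _ p)).
Qed.

Lemma sextic_perm (p : 'S_3) u : F.@[u \o p] = F.@[u].
Proof.
rewrite !sexticE /sext /=.
have S6 := perm_sum3 p (fun i => u i ^+ 6); have S3 := perm_sum3 p (fun i => u i ^+ 3).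
have e (a b c : K) : a ^+ 6 + b ^+ 6 + c ^+ 6
  - 10%:R * (a ^+ 3 * b ^+ 3 + b ^+ 3 * c ^+ 3 + c ^+ 3 * a ^+ 3) =
  6%:R * (a ^+ 6 + b ^+ 6 + c ^+ 6) - 5%:R * (a ^+ 3 + b ^+ 3 + c ^+ 3) ^+ 2 by ring.
by rewrite !e S6 S3.
Qed.

Lemma on_cone_swap k u : on_cone u -> on_cone (u \o tperm k i2).
Proof.
move=> [[i ui] Fu]; split; first by exists (tperm k i2 i); rewrite /= tpermK.
by rewrite sextic_perm.
Qed.

Lemma grad_swap k u : grad (u \o tperm k i2) i2 = grad u k.
Proof.
have S3 := perm_sum3 (tperm k i2) (fun i => u i ^+ 3).
by rewrite !grad_formula /= S3 tpermR.
Qed.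

Lemma van_swap k g : van g -> van (g \mPo swap_vars k).
Proof. by move=> vg u cu; rewrite swap_vars_eval vg //; apply: on_cone_swap. Qed.

Lemma ratmap_swap k t : is_ratmap F t -> is_ratmap F (rcomp t (swap_vars k)).
Proof.
move=> /is_ratmapP [[d hd] [j tj]]; apply/is_ratmapP; split.
  exists d => i; rewrite tnth_mktuple -[d]muln1; apply: homog_comp => // l.
  by rewrite tnth_mktuple homog1_mono.
by exists j; rewrite tnth_mktuple => /(van_swap k); rewrite swap_varsK.
Qed.

Lemma ratmap_regular t v : is_ratmap F t -> on_cone v ->
  exists2 s, same_map F t s & exists i, (tnth s i).@[v] != 0.
Proof.
move=> ht cv; have [k gk] := sextic_smooth charK cv.
have gk' : grad (v \o tperm k i2) i2 != 0 by rewrite grad_swap.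
have [s /same_mapP[_ hs st] [i si]] :=
  ratmap_regular2 (ratmap_swap k ht) (on_cone_swap k cv) gk'.
exists (rcomp s (swap_vars k)); last first.
  by exists i; rewrite tnth_mktuple swap_vars_eval.
apply/same_mapP; split=> //; first exact: ratmap_swap.
move=> a b; have := van_swap k (st a b).
by rewrite !tnth_mktuple rmorphB !rmorphM /= !swap_varsK.
Qed.

(** Regularity of a/b at every point: locally it is a'/b' with b' not zero there. *)
Definition regular_quotient a b := forall v, on_cone v ->
  exists a' b', (b'.@[v] != 0) /\ van (a * b' - a' * b).

(** Induction on the degree of the denominator. Take a linear factor l of [n] and the remainder of
    [a] modulo F in Z. On the line l = 0 regularity makes F divide this remainder locally, hence
    globally; as its degree is below 6 it vanishes there, and l can be cancelled. *)
Lemma form_of_regular_binary m e n a : n != 0 -> n \is e.-homog ->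
  a \is (m + e).-homog -> regular_quotient a (mwiden n) ->
  exists2 c, c \is m.-homog & van (a - c * mwiden n).
Proof.
elim: e n a => [|e IH] n a n0 hn hm reg.
  move: n0 reg; rewrite (homog0_const hn) mwidenC; move: (n@_0) => c c0 _.
  have {}c0 : c != 0 by apply: contraNneq c0 => ->; rewrite mpolyC0.
  exists (c^-1 *: a); first by rewrite rpredZ // -[m]addn0.
  by move=> u _; rewrite mevalB mevalM mevalC mevalZ; field.
have [v v0 nv] := binary_root hn.
have [n' hn' nE] := binary_factor v0 hn nv.
have n'0 : n' != 0 by apply: contraNneq n0 => m0; rewrite nE m0 mul0r.
have [q [r []]] := trisextic_rem (sext_s K) (sext_n K) (muni a).
rewrite -muni_sextic => aE sr.
pose l := lform (dual2 v).
have rl i : vanish_plane (dual2 v) r`_i.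
  have [j vj] := v0.
  suff: vanish_plane (dual2 v) ('X_j : A) \/ vanish_plane (dual2 v) r`_i.
    case=> // /(_ v (dual2_self v)); rewrite mevalXU => vj0.
    by rewrite vj0 eqxx in vj.
  (* The factor ['X_j] removes the origin of the (x, y)-plane, over which the cone has no nonzero
     point. *)
  apply: (vanish_plane_mul (dual2_neq0 v0)) => w pw; rewrite mevalM mevalXU.
  have [->|wj] := eqVneq (w j) 0; first by rewrite mul0r.
  suff /polyP/(_ i) : map_poly (meval w) r = 0.
    by rewrite coef_map coef0 => ->; rewrite mulr0.
  pose Fw := map_poly (meval w) (muni F).
  have sFw : size Fw = 7%N by rewrite /Fw muni_sextic map_trisextic size_trisextic_domain.
  pose ev (g : {mpoly K[3]}) := map_poly (meval w) (muni g).
  have evB g h : ev (g - h) = ev g - ev h by rewrite /ev muniB; apply: rmorphB.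
  have evM g h : ev (g * h) = ev g * ev h by rewrite /ev muniM; apply: rmorphM.
  have evW k : ev (mwiden k) = (k.@[w])%:P by rewrite /ev muni_mwiden map_polyC.
  have evF : ev F = Fw by [].
  have evA : ev a = map_poly (meval w) q * Fw + map_poly (meval w) r.
    rewrite /ev aE; etransitivity; first exact: rmorphD.
    by congr (_ + _); apply: rmorphM.
  have evX g z : (ev g).[z] = g.@[mappend w z] by apply: muni_eval_append.
  have FwX z : Fw.[z] = F.@[mappend w z] by apply: muni_eval_append.
  clearbody ev Fw.
  have : Fw %| map_poly (meval w) r.
    apply: closed_dvdp_local; first by rewrite -size_poly_eq0 sFw.
    move=> z /rootP; rewrite FwX => Fz.
    have cz : on_cone (mappend w z) by split=> //; apply: mappend_neq0; exists j.
    have [a' [b' [bz ab]]] := reg _ cz.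
    exists (ev b'); first by rewrite evX.
    have [p pE] := van_dvd charK ab.
    have := congr1 ev pE; rewrite evB !evM evW evF.
    have -> : n.@[w] = 0 by rewrite nE mevalM lform_eval pw mulr0.
    rewrite polyC0 mulr0 subr0 evA mulrDl; move: (map_poly _ r) (map_poly _ q) => R0 Q0 eq0.
    have -> : R0 * ev b' = ev p * Fw - Q0 * Fw * ev b' by rewrite -eq0 addrC addKr.
    apply: dvdp_sub; first exact: dvdp_mulIr.
    by rewrite [X in _ %| X](mulrAC Q0 Fw); apply: dvdp_mulIr.
  have [-> //|rw0 /dvdp_leq] := eqVneq (map_poly (meval w) r) 0.
  by rewrite rw0 sFw => /(_ isT); rewrite leqNgt (leq_ltn_trans (size_poly _ _) sr).
have /fin_all_exists [c cE] (i : 'I_7) := vanish_plane_dvd (dual2_neq0 v0) (rl i).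
have rE : r = (\poly_(i < 7) c (inord i)) * l%:P.
  apply/polyP => i; rewrite coefMC coef_poly; case: ltnP => i7.
    by rewrite -cE inordK.
  by rewrite mul0r nth_default // (leq_trans (ltnW sr)).
have hl : mwiden l \is 1.-homog by apply/mwiden_homog/lform_homog.
have [U aU] : exists U, van (a - U * mwiden l).
  exists (unmuni (\poly_(i < 7) c (inord i))).
  apply: (@van_eq _ (unmuni q * F)); last exact: dvd_van.
  by move=> u _; congr (_.@[u]); rewrite -[a]muniK aE rE unmuniD !unmuniM muniK unmuniC; ring.
pose a2 := pihomog mdeg (m + e) U.
have aa2 : van (a - a2 * mwiden l).
  move: aU => /(van_pihomog charK (m + e.+1)); rewrite pihomogB (pihomog_dE hm).
  by rewrite (_ : (m + e.+1 = (m + e) + 1)%N) ?pihomogM // addnS addn1.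
have nl : ~ van (mwiden l).
  by move=> /van_mwiden/eqP; rewrite (negbTE (lform_neq0 (dual2_neq0 v0))).
have ha2 : a2 \is (m + e).-homog by apply: pihomogP.
have reg2 : regular_quotient a2 (mwiden n').
  move=> x cx; have [a' [b' [bx ab]]] := reg x cx; exists a', b'; split; first exact: bx.
  apply: (van_cancel charK nl) => u cu.
  have e1 := vanB_eq ab cu; have e2 := vanB_eq aa2 cu.
  move: e1; rewrite nE mwidenM !mevalM mevalB !mevalM e2 mevalM => e1.
  transitivity (a2.@[u] * (mwiden l).@[u] * b'.@[u] -
     a'.@[u] * ((mwiden n').@[u] * (mwiden l).@[u])); first by ring.
  by rewrite e1 subrr.
have [c' hc' cn'] := IH n' a2 n'0 hn' ha2 reg2.
exists c'; first exact: hc'.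
apply: vanB_intro => u cu.
rewrite (vanB_eq aa2 cu) mevalM (vanB_eq cn' cu) nE mwidenM !mevalM; ring.
Qed.

(** Multiplying numerator and denominator by the cofactor [al] of the norm makes the denominator
    binary. *)
Lemma form_of_regular m d a b : b \is d.-homog -> a \is (m + d).-homog ->
  ~ van b -> regular_quotient a b ->
  exists2 c, c \is m.-homog & van (a - c * b).
Proof.
move=> hb ha nb reg; have [k [al [n [n0 hal hn aln]]]] := norm_homog charK hb nb.
have nal : ~ van al.
  move=> val; suff n00 : n = 0 by rewrite n00 eqxx in n0.
  apply: van_mwiden => u cu.
  by rewrite -(vanB_eq aln cu) mevalM val // mul0r.
have reg2 : regular_quotient (al * a) (mwiden n).
  move=> x cx; have [a' [b' [bx ab]]] := reg x cx; exists a', b'; split; first exact: bx.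
  apply: vanB_intro => u cu; have := vanB_eq ab cu; have := vanB_eq aln cu.
  rewrite !mevalM => <- e1.
  transitivity (al.@[u] * (a.@[u] * b'.@[u])); first by ring.
  by rewrite e1; ring.
have hala : al * a \is (m + (k + d)).-homog by rewrite addnCA dhomogM.
have [c hc cn] := form_of_regular_binary n0 hn hala reg2.
exists c; first exact: hc.
apply: (van_cancel charK nal) => u cu.
have := vanB_eq cn cu; have := vanB_eq aln cu.
rewrite !mevalM mevalB !mevalM => <- e1; rewrite mulrBr e1; ring.
Qed.
End Extend.

Definition next3 (i : 'I_3) : 'I_3 := inord (i.+1 %% 3).

Lemma next3_0 : next3 i0 = i1. Proof. by rewrite /next3 inordK. Qed.
Lemma next3_1 : next3 i1 = i2. Proof. by rewrite /next3 inordK. Qed.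
Lemma next3_2 : next3 i2 = i0. Proof. by rewrite /next3 inordK. Qed.
Definition next3E := (next3_0, next3_1, next3_2).

(** * Pull-back of differentials *)

Section Differential.
Variables (K : closedFieldType) (charK : [pchar K] =i pred0).
Local Notation F := (sextic K).
Implicit Types (g h p q : {mpoly K[3]}) (u v T N : 'I_3 -> K).
Implicit Types (s t : 3.-tuple {mpoly K[3]}).

Definition det3 (R : pzRingType) (a b c : 'I_3 -> R) : R :=
  a i0 * (b i1 * c i2 - b i2 * c i1) + a i1 * (b i2 * c i0 - b i0 * c i2)
  + a i2 * (b i0 * c i1 - b i1 * c i0).

(* The Poisson bracket of the cone over the curve. *)
Definition bracket p q : {mpoly K[3]} :=
  det3 (fun j => mderiv j F) (fun j => mderiv j p) (fun j => mderiv j q).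

Definition dir p u v : K := \sum_j (mderiv j p).@[u] * v j.

Lemma bracket_eval p q u : (bracket p q).@[u] =
  det3 (grad u) (fun j => (mderiv j p).@[u]) (fun j => (mderiv j q).@[u]).
Proof. by rewrite /bracket /det3 !mevalD !mevalM !mevalB !mevalM. Qed.

(** By Euler's relation the gradient is orthogonal to [u], hence a cross product of [u] with some
    [v]. Such a [v] is tangent to the cone, and its scaling turns brackets into derivatives along
    [v]. *)
Lemma cone_tangent u : on_cone u -> exists v,
  [/\ grad u i0 = u i1 * v i2 - u i2 * v i1, grad u i1 = u i2 * v i0 - u i0 * v i2
    & grad u i2 = u i0 * v i1 - u i1 * v i0].
Proof.
move=> [[k uk] Fu]; have := euler_eval u (sextic_homog K); rewrite Fu mulr0 sum3.
rewrite -!/(grad u _); move: (grad u i0) (grad u i1) (grad u i2) => a b c.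
have ne (i j : nat) : (i < 3)%N -> (j < 3)%N -> i != j -> ((inord i : 'I_3) == inord j) = false.
  by move=> i3 j3 ij; rewrite inord3_eq // (negbTE ij).
pose vec (x y z : K) (i : 'I_3) := if i == i0 then x else if i == i1 then y else z.
have v0 x y z : vec x y z i0 = x by rewrite /vec eqxx.
have v1 x y z : vec x y z i1 = y by rewrite /vec eqxx ne.
have v2 x y z : vec x y z i2 = z by rewrite /vec !ne.
elim/ord3P: k uk => uk E.
- exists (vec 0 (c / u i0) (- b / u i0)); rewrite !v0 !v1 !v2; split; try by field.
  apply: (mulfI uk); transitivity (- (u i1 * b + u i2 * c)); last by field.
  by apply/eqP; rewrite -addr_eq0 addrA E.
- exists (vec (- c / u i1) 0 (a / u i1)); rewrite !v0 !v1 !v2; split; try by field.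
  apply: (mulfI uk); transitivity (- (u i0 * a + u i2 * c)); last by field.
  by apply/eqP; rewrite -addr_eq0 -E; apply/eqP; ring.
- exists (vec (b / u i2) (- a / u i2) 0); rewrite !v0 !v1 !v2; split; try by field.
  apply: (mulfI uk); transitivity (- (u i0 * a + u i1 * b)); last by field.
  by apply/eqP; rewrite -addr_eq0 -E; apply/eqP; ring.
Qed.

Definition tangent u v := [/\ grad u i0 = u i1 * v i2 - u i2 * v i1,
  grad u i1 = u i2 * v i0 - u i0 * v i2 & grad u i2 = u i0 * v i1 - u i1 * v i0].

(** The determinant is the scalar product of u x v with the cross product of the gradients of [p]
    and [q]; expand it by Lagrange's identity and apply Euler's relation to [p] and [q]. *)
Lemma bracket_tangent m p q u v : tangent u v -> p \is m.-homog -> q \is m.-homog ->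
  (bracket p q).@[u] = m%:R * (p.@[u] * dir q u v - q.@[u] * dir p u v).
Proof.
move=> [G0 G1 G2] hp hq; rewrite bracket_eval.
rewrite mulrBr !mulrA -(euler_eval u hp) -(euler_eval u hq) /dir !sum3 /det3 G0 G1 G2.
ring.
Qed.

Lemma dir_vanish g u v : on_cone u -> tangent u v -> van g -> dir g u v = 0.
Proof.
move=> [_ Fu] [G0 G1 G2] /(van_dvd charK) [q ->].
have e j : (mderiv j (q * F)).@[u] = q.@[u] * grad u j.
  by rewrite mderivM mevalD !mevalM Fu mulr0 add0r.
rewrite /dir; under eq_bigr => j _ do rewrite e.
rewrite sum3 G0 G1 G2; ring.
Qed.

Lemma dirM p q u v : dir (p * q) u v = dir p u v * q.@[u] + p.@[u] * dir q u v.
Proof.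
rewrite /dir mulr_suml mulr_sumr -big_split /=; apply: eq_bigr => j _.
by rewrite mderivM mevalD !mevalM; ring.
Qed.

Lemma dirB p q u v : dir (p - q) u v = dir p u v - dir q u v.
Proof.
by rewrite /dir -sumrB; apply: eq_bigr => j _; rewrite mderivB mevalB mulrBl.
Qed.

Definition teval t u : 'I_3 -> K := fun i => (tnth t i).@[u].

Lemma dir_comp g t u v : dir (g \mPo t) u v =
  \sum_i (mderiv i g).@[teval t u] * dir (tnth t i) u v.
Proof.
rewrite /dir; under eq_bigr => j _ do rewrite mderiv_comp raddf_sum mulr_suml /=.
rewrite exchange_big /=; apply: eq_bigr => i _; rewrite mulr_sumr.
by apply: eq_bigr => j _; rewrite mevalM comp_mpoly_meval mulrA.
Qed.

(* w_i = {t_(i+1), t_(i+2)}: the pull-back of the residue form. *)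
Definition wedge t i : {mpoly K[3]} := bracket (tnth t (next3 i)) (tnth t (next3 (next3 i))).

Definition cross T S i : K := T (next3 i) * S (next3 (next3 i)) - T (next3 (next3 i)) * S (next3 i).

Lemma wedge_eval m t u v i : tangent u v -> (forall i, tnth t i \is m.-homog) ->
  (wedge t i).@[u] = m%:R * cross (teval t u) (fun i => dir (tnth t i) u v) i.
Proof. by move=> tuv ht; apply: bracket_tangent. Qed.

(** In dimension 3 two vectors orthogonal to [N] have a cross product parallel to [N]. *)
Lemma cross_parallel T S N : \sum_i N i * T i = 0 -> \sum_i N i * S i = 0 ->
  forall i j, N i * cross T S j = N j * cross T S i.
Proof.
rewrite !sum3 => NT NS i j; apply/eqP; rewrite -subr_eq0; apply/eqP.
have e (a b : K) : a * (N i0 * T i0 + N i1 * T i1 + N i2 * T i2)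
   + b * (N i0 * S i0 + N i1 * S i1 + N i2 * S i2) = 0 by rewrite NT NS !mulr0 addr0.
rewrite /cross; elim/ord3P: i; elim/ord3P: j; rewrite !next3E.
- ring.
- by rewrite -(e (- S i2) (T i2)); ring.
- by rewrite -(e (S i1) (- T i1)); ring.
- by rewrite -(e (S i2) (- T i2)); ring.
- ring.
- by rewrite -(e (- S i0) (T i0)); ring.
- by rewrite -(e (- S i1) (T i1)); ring.
- by rewrite -(e (S i0) (- T i0)); ring.
- ring.
Qed.

Lemma selfmap_orth t u v : on_cone u -> tangent u v -> van (F \mPo t) ->
  \sum_i grad (teval t u) i * teval t u i = 0 /\
  \sum_i grad (teval t u) i * dir (tnth t i) u v = 0.
Proof.
move=> cu tuv Ft; split.
  transitivity (\sum_i teval t u i * grad (teval t u) i).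
    by apply: eq_bigr => i _; rewrite mulrC.
  by rewrite (euler_eval _ (sextic_homog K)) -comp_mpoly_meval Ft // mulr0.
by rewrite -dir_comp (dir_vanish cu tuv Ft).
Qed.

(* Two representatives t, t' = rho t of the same map: T' x S' = rho^2 T x S. *)
Lemma cross_same t t' u v (rho : K) : on_cone u -> tangent u v ->
  (forall i j, van (tnth t i * tnth t' j - tnth t j * tnth t' i)) ->
  (forall i, teval t' u i = rho * teval t u i) -> forall i,
  cross (teval t' u) (fun i => dir (tnth t' i) u v) i =
  rho ^+ 2 * cross (teval t u) (fun i => dir (tnth t i) u v) i.
Proof.
move=> cu tuv tt' rhoE i; rewrite /cross.
have := dir_vanish cu tuv (tt' (next3 i) (next3 (next3 i))).
rewrite dirB !dirM -!/(teval _ _ _) !rhoE; set j := next3 i; set k := next3 j.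
move: (teval t u j) (teval t u k) (dir _ _ _) (dir _ _ _) (dir _ _ _) (dir _ _ _).
move=> Tj Tk Sj Sk' Sk Sj' e.
apply/eqP; rewrite -subr_eq0 -[X in _ == X](mulr0 rho) -e; apply/eqP; ring.
Qed.

(** The quotient of [wedge t i] by the pulled back partial derivative is thus independent of i: it
    expresses the pull-back of the residue of Omega / F. *)
Lemma wedge_parallel m t i j : (forall i, tnth t i \is m.-homog) -> van (F \mPo t) ->
  van (wedge t i * (mderiv j F \mPo t) - wedge t j * (mderiv i F \mPo t)).
Proof.
move=> ht Ft; apply: vanB_intro => u cu; have [v tuv] := cone_tangent cu.
rewrite !mevalM !comp_mpoly_meval !(wedge_eval _ tuv ht) -!/(teval t u) -!/(grad _ _).
have [NT NS] := selfmap_orth cu tuv Ft; have := cross_parallel NT NS i j.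
rewrite -!/(teval t u) -!mulrA ![cross _ _ _ * _]mulrC => e.
by congr (_ * _); rewrite e.
Qed.
End Differential.

(** * Pull-back of cubic forms along a birational map *)

Section Birational.
Variables (K : closedFieldType) (charK : [pchar K] =i pred0).
Local Notation F := (sextic K).
Implicit Types (g h p q c : {mpoly K[3]}) (u v T N : 'I_3 -> K).
Implicit Types (s t : 3.-tuple {mpoly K[3]}).

Lemma homog_eval0 d g u : g \is d.+1.-homog -> (forall i, u i = 0) -> g.@[u] = 0.
Proof.
move=> hg u0; have e : u =1 (fun i => 0 * u i) by move=> i; rewrite u0 mulr0.
by rewrite (meval_eq _ e) (homog_eval _ _ hg) expr0n mul0r.
Qed.

Lemma teval_ratid u : teval (ratid K) u =1 u.
Proof. by move=> i; rewrite /teval tnth_mktuple mevalXU. Qed.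

Lemma teval_rcomp s t u i : teval (rcomp s t) u i = (tnth s i).@[teval t u].
Proof. by rewrite /teval tnth_mktuple comp_mpoly_meval. Qed.

Lemma cross_at t t' u i : on_cone u ->
  (forall i j, van (tnth t i * tnth t' j - tnth t j * tnth t' i)) ->
  teval t u i != 0 -> forall j, teval t' u j = teval t' u i / teval t u i * teval t u j.
Proof.
move=> cu tt' ti j; have := vanB_eq (tt' i j) cu; rewrite !mevalM -!/(teval _ _ _) => e.
by apply: (mulfI ti); rewrite e; field.
Qed.

Lemma on_cone_teval t u i : on_cone u -> van (F \mPo t) -> teval t u i != 0 ->
  on_cone (teval t u).
Proof.
by move=> cu Ft ti; split; [exists i | rewrite -comp_mpoly_meval; apply: Ft].
Qed.

Variables (s t : 3.-tuple {mpoly K[3]}) (m d : nat).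
Hypothesis ht : forall i, tnth t i \is m.-homog.
Hypothesis hs : forall i, tnth s i \is d.-homog.
Hypothesis Ft : van (F \mPo t).
Hypothesis Fs : van (F \mPo s).
Hypothesis st : same_map F (rcomp s t) (ratid K).
Hypothesis ts : same_map F (rcomp t s) (ratid K).

Lemma rcomp_homog i : tnth (rcomp s t) i \is (d * m).-homog.
Proof. by rewrite tnth_mktuple; apply: homog_comp. Qed.

(** A constant composite would give a linear relation between two coordinates on C. *)
Lemma rcomp_degree_neq0 : (d * m)%N != 0%N.
Proof.
apply/eqP => dm; have [/is_ratmapP [_ [i ri]] _ cr] := (same_mapP (rcomp s t) (ratid K)).1 st.
have hr k : tnth (rcomp s t) k = ((tnth (rcomp s t) k)@_0)%:MP.
  by apply: homog0_const; have := rcomp_homog k; rewrite dm.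
have [j ij] : exists j : 'I_3, i != j.
  by elim/ord3P: (i); [exists i1|exists i0|exists i0]; rewrite inord3_eq.
have := cr i j; rewrite !(tnth_mktuple (fun i => 'X_i)) hr [tnth _ j]hr.
move: (_@_0) (_@_0) (hr i) ri => b a -> na vab.
have e0 : a%:MP * 'X_j - b%:MP * 'X_i = 0 :> {mpoly K[3]}.
  apply: (@van_small _ charK 1) => //.
  by rewrite !mul_mpolyC; apply: rpredB; rewrite rpredZ ?homog1_mono.
have : (a%:MP * 'X_j - b%:MP * 'X_i : {mpoly K[3]}).@[fun k => (k == j)%:R] = 0.
  by rewrite e0 meval0.
rewrite mevalB !mevalM !mevalC !mevalXU eqxx (negbTE ij) mulr1 mulr0 subr0 => a0.
by apply: na => u _; rewrite a0 mevalC.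
Qed.

Lemma m_gt0 : (0 < m)%N.
Proof. by have := rcomp_degree_neq0; rewrite muln_eq0 negb_or -!lt0n => /andP[]. Qed.

Lemma d_gt0 : (0 < d)%N.
Proof. by have := rcomp_degree_neq0; rewrite muln_eq0 negb_or -!lt0n => /andP[]. Qed.

Lemma t_at u i : teval (rcomp s t) u i != 0 -> exists l, teval t u l != 0.
Proof.
move=> ri; apply: NNPP => no; case/eqP: ri; rewrite teval_rcomp.
have hd : tnth s i \is d.-1.+1.-homog by rewrite prednK ?d_gt0.
apply: (homog_eval0 hd) => l.
by apply/eqP; apply: contra_notT no => tl; exists l.
Qed.

(** Otherwise the derivative of [t] along the curve is parallel to [t]. By the chain rule and
    Euler's relation the same holds for the composite of [s] and [t], a multiple of the identity, so
    u x v, which is the gradient, would vanish at a point of C. *)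
Lemma wedge_not_van : exists i, ~ van (wedge t i).
Proof.
apply: NNPP => no; have {no} w0 i : van (wedge t i) by apply: NNPP => wi; apply: no; exists i.
have [/is_ratmapP [_ [i ri]] _ cr] := (same_mapP (rcomp s t) (ratid K)).1 st.
have [u cu rui] := not_van ri; rewrite -/(teval _ u i) in rui.
have [v tuv] := cone_tangent cu.
have [l Tl] := t_at rui.
pose S k := dir (tnth t k) u v.
have mK : m%:R != 0 :> K by apply: natf_neq0_char0; rewrite // -lt0n m_gt0.
have cr0 k : cross (teval t u) S k = 0.
  apply: (mulfI mK); rewrite mulr0 -(wedge_eval _ tuv ht); exact: w0.
have TS a b : teval t u a * S b = teval t u b * S a.
  have c0 := cr0 i0; have c1 := cr0 i1; have c2 := cr0 i2.
  move: c0 c1 c2; rewrite /cross !next3E => /eqP + /eqP + /eqP.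
  rewrite !subr_eq0 => /eqP e0 /eqP e1 /eqP e2.
  by elim/ord3P: a; elim/ord3P: b.
pose R := rcomp s t.
have dR k : dir (tnth R k) u v = d%:R * (S l / teval t u l) * teval R u k.
  rewrite tnth_mktuple dir_comp teval_rcomp.
  have := euler_eval (teval t u) (hs k) => E.
  transitivity (S l / teval t u l * (d%:R * (tnth s k).@[teval t u])); last by ring.
  rewrite -E mulr_sumr; apply: eq_bigr => j _; rewrite -/(S j).
  have -> : S j = S l / teval t u l * teval t u j.
    by apply: (mulfI Tl); rewrite (TS l j); field.
  by ring.
have crR k : cross (teval R u) (fun k => dir (tnth R k) u v) k = 0.
  by rewrite /cross !dR; ring.
have cr' a b : van (tnth (ratid K) a * tnth R b - tnth (ratid K) b * tnth R a).
  apply: van_eq (cr b a) => w _; congr (_.@[w]); ring.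
have [k uk] := cu.1.
have uk' : teval (ratid K) u k != 0 by rewrite teval_ratid.
have rho := cross_at cu cr' uk'; set rh := (X in forall j, _ = X * _) in rho.
have := cross_same charK cu tuv cr' rho.
have rh0 : rh != 0 by apply: contraNneq rui => r0; rewrite -/R rho r0 mul0r.
move=> E; have [a ga] := sextic_smooth charK cu; case/eqP: ga.
have : cross (teval (ratid K) u) (fun i => dir (tnth (ratid K) i) u v) a = 0.
  by apply: (mulfI (expf_neq0 2 rh0)); rewrite mulr0 -E crR.
have dX j : dir (tnth (ratid K) j) u v = v j.
  rewrite tnth_mktuple /dir (bigD1 j) //= big1 => [|k' ne].
    by rewrite mderivXU eqxx meval1 mul1r addr0.
  by rewrite mderivXU (negbTE ne) meval0 mul0r.
rewrite /cross !dX !teval_ratid; case: tuv => G0 G1 G2.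
by elim/ord3P: a; rewrite !next3E ?G0 ?G1 ?G2.
Qed.

Lemma grad_comp_not_van : exists a, ~ van (mderiv a F \mPo t).
Proof.
have [/is_ratmapP [_ [i ri]] _ cr] := (same_mapP (rcomp s t) (ratid K)).1 st.
have [u cu rui] := not_van ri; have [l Tl] := t_at rui.
have [a ga] := sextic_smooth charK (on_cone_teval cu Ft Tl).
by exists a => /(_ u cu)/eqP; rewrite comp_mpoly_meval -/(grad _ _) (negbTE ga).
Qed.

Lemma wedge_a_not_van a : ~ van (mderiv a F \mPo t) -> ~ van (wedge t a).
Proof.
move=> na wa; have [j] := wedge_not_van; apply.
apply: (van_cancel charK na) => u cu.
have -> : (mderiv a F \mPo t) * wedge t j = wedge t j * (mderiv a F \mPo t) by exact: mulrC.
have -> := vanB_eq (wedge_parallel charK j a ht Ft) cu.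
by rewrite (mevalM _ (wedge t a)) (wa u cu) mul0r.
Qed.

Lemma wedge_homog a : wedge t a \is (5 + (m.-1 + m.-1)).-homog.
Proof.
have hF j : mderiv j F \is 5.-homog by apply: (mderiv_homog _ (sextic_homog K)).
have hd j i : mderiv j (tnth t i) \is m.-1.-homog by apply: mderiv_homog.
rewrite /wedge /bracket /det3.
have hdd j k (i i' : 'I_3) : mderiv j (tnth t i) * mderiv k (tnth t i') -
    mderiv k (tnth t i) * mderiv j (tnth t i') \is (m.-1 + m.-1).-homog.
  by apply: rpredB; apply: dhomogM.
by apply: rpredD; first apply: rpredD; apply: dhomogM.
Qed.

(** Near [v] use a representative t' that does not vanish there and an index b whose partial
    derivative is nonzero at t'(v). Replacing [t] by rho t multiplies numerator and denominator by
    rho^5: a cubic gives 3, the wedge 2, a derivative of F gives 5. *)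
Lemma pullback_regular g a : g \is 3.-homog ->
  regular_quotient ((g \mPo t) * wedge t a) (mderiv a F \mPo t).
Proof.
move=> hg v cv.
have [/is_ratmapP [_ [i ri]] _ cr] := (same_mapP (rcomp s t) (ratid K)).1 st.
have trat : is_ratmap F t.
  apply/is_ratmapP; split; first by exists m.
  have [u cu rui] := not_van ri; have [l Tl] := t_at rui.
  by exists l => /(_ u cu)/eqP; rewrite -/(teval t u l) (negbTE Tl).
have [t' tt' [l t'l]] := ratmap_regular charK trat cv.
have [/is_ratmapP [_ [i' ti']] /is_ratmapP [[m' ht'] _] tc] := (same_mapP t t').1 tt'.
have Ft' : van (F \mPo t').
  apply: (van_off charK ti') => u cu tu; rewrite comp_mpoly_meval.
  rewrite (meval_eq _ (cross_at cu tc tu : teval t' u =1 _)) (homog_eval _ _ (sextic_homog K)).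
  by rewrite -comp_mpoly_meval Ft // mulr0.
have rel u : on_cone u -> teval t u i' != 0 -> forall w, tangent u w ->
  exists rho, (forall j, teval t' u j = rho * teval t u j) /\
   forall j, cross (teval t' u) (fun k => dir (tnth t' k) u w) j =
     rho ^+ 2 * cross (teval t u) (fun k => dir (tnth t k) u w) j.
  move=> cu tu w tuw; exists (teval t' u i' / teval t u i').
  have rho := cross_at cu tc tu; split; first exact: rho.
  exact: (cross_same charK cu tuw tc rho).
(* A constant t' would have derivative 0 and make all wedges vanish; [m'] occurs as a factor of the
   denominator below. *)
have m'0 : m' != 0%N.
  apply/eqP => m'0; rewrite m'0 in ht'.
  have c0 j : tnth t' j = ((tnth t' j)@_0)%:MP := homog0_const (ht' j).
  have [k nk] := wedge_not_van; apply: nk.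
  apply: (van_off charK ti') => u cu tu; have [w tuw] := cone_tangent cu.
  rewrite (wedge_eval _ tuw ht).
  have [l' t'l'] : exists l', teval t' u l' != 0.
    by exists l; rewrite /teval (c0 l) mevalC; move: t'l; rewrite {1}(c0 l) mevalC.
  have dt' j : dir (tnth t' j) u w = 0.
    rewrite (c0 j) /dir big1 // => j' _.
    by rewrite mderivC meval0 mul0r.
  have [rho [rE cE]] := rel u cu tu w tuw.
  have rho0 : rho != 0 by apply: contraNneq t'l' => r0; rewrite rE r0 mul0r.
  apply/eqP; rewrite mulf_eq0; apply/orP; right.
  rewrite -(inj_eq (mulfI (expf_neq0 2 rho0))) mulr0 -cE /cross !dt' !mulr0 subrr.
  by [].
have cT' := on_cone_teval cv Ft' t'l.
have [b gb] := sextic_smooth charK cT'.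
(* The factors [m] and [m'] balance the degrees that Euler's relation brings into the two wedges. *)
exists (m%:R *: ((g \mPo t') * wedge t' b)), (m'%:R *: (mderiv b F \mPo t')); split.
  rewrite mevalZ mulf_neq0 //; first exact: natf_neq0_char0.
  by rewrite comp_mpoly_meval.
apply: (van_off charK ti') => u cu tu; have [w tuw] := cone_tangent cu.
have [rho [rE cE]] := rel u cu tu w tuw.
have [NT NS] := selfmap_orth charK cu tuw Ft; have par := cross_parallel NT NS a b.
have hF j : mderiv j F \is 5.-homog by apply: (mderiv_homog _ (sextic_homog K)).
have EF j : (mderiv j F \mPo t').@[u] = rho ^+ 5 * grad (teval t u) j.
  rewrite comp_mpoly_meval (meval_eq _ (rE : teval t' u =1 _)).
  by rewrite (homog_eval _ _ (hF j)).
have Eg : (g \mPo t').@[u] = rho ^+ 3 * g.@[teval t u].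
  by rewrite comp_mpoly_meval (meval_eq _ (rE : teval t' u =1 _)) (homog_eval _ _ hg).
have Et : (mderiv a F \mPo t).@[u] = grad (teval t u) a by rewrite comp_mpoly_meval.
have Egt : (g \mPo t).@[u] = g.@[teval t u] by rewrite comp_mpoly_meval.
rewrite mevalB !mevalM !mevalZ mevalM (wedge_eval _ tuw ht) (wedge_eval _ tuw ht').
rewrite EF Eg Et Egt cE; move: par.
move: (cross _ _ a) (cross _ _ b) (grad _ a) (grad _ b) (g.@[_]) => x y na nb z par.
apply/eqP; rewrite subr_eq0; apply/eqP.
transitivity (rho ^+ 5 * m%:R * m'%:R * z * (nb * x)); first by ring.
by rewrite -par; ring.
Qed.

Lemma pullback_exists g a : ~ van (mderiv a F \mPo t) -> g \is 3.-homog ->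
  exists2 c, c \is 3.-homog & van ((g \mPo t) * wedge t a - c * (mderiv a F \mPo t)).
Proof.
move=> na hg; have hF : mderiv a F \is 5.-homog by apply: (mderiv_homog _ (sextic_homog K)).
have hb : mderiv a F \mPo t \is (5 * m).-homog by apply: homog_comp.
have ha : (g \mPo t) * wedge t a \is (3 + 5 * m).-homog.
  have -> : (3 + 5 * m = 3 * m + (5 + (m.-1 + m.-1)))%N.
    by move: m_gt0; clear; lia.
  by apply: dhomogM; [apply: homog_comp | apply: wedge_homog].
exact: (form_of_regular charK hb ha na (@pullback_regular g a hg)).
Qed.

(** The image of [t] is dense since [t] after [s] is the identity, so [g] vanishes on C; its degree
    is below 6. *)
Lemma pullback_inj g : g \is 3.-homog -> van (g \mPo t) -> g = 0.
Proof.
move=> hg gt; apply: (van_small charK hg) => //.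
have [/is_ratmapP [_ [i ri]] _ cr] := (same_mapP (rcomp t s) (ratid K)).1 ts.
apply: (van_off charK ri) => u cu rui; rewrite -/(teval _ u i) in rui.
have [l Sl] : exists l, teval s u l != 0.
  apply: NNPP => no; case/eqP: rui; rewrite teval_rcomp.
  have hm : tnth t i \is m.-1.+1.-homog by rewrite prednK ?m_gt0.
  apply: (homog_eval0 hm) => l.
  by apply/eqP; apply: contra_notT no => tl; exists l.
have := gt _ (on_cone_teval cu Fs Sl); rewrite comp_mpoly_meval.
have e : teval t (teval s u) =1 (fun j => teval (rcomp t s) u j) by move=> j; rewrite teval_rcomp.
rewrite -/(teval t (teval s u)) (meval_eq _ e).
have [k uk] := cu.1.
have uk' : teval (ratid K) u k != 0 by rewrite teval_ratid.
have cr' a b : van (tnth (ratid K) a * tnth (rcomp t s) b - tnth (ratid K) b * tnth (rcomp t s) a).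
  apply: van_eq (cr b a) => w _; congr (_.@[w]); ring.
have := cross_at cu cr' uk'; set rh := (_ / _) => rho.
have rh0 : rh != 0 by apply: contraNneq rui => r0; rewrite rho r0 mul0r.
rewrite (meval_eq _ (rho : teval (rcomp t s) u =1 _)) (homog_eval _ _ hg).
rewrite (meval_eq _ (teval_ratid u)) => /eqP.
by rewrite mulf_eq0 expf_eq0 (negbTE rh0) => /eqP.
Qed.
End Birational.

(** * The array of cubics representing the products t_i t_j t_k *)

Section Pullback.
Variables (K : closedFieldType) (charK : [pchar K] =i pred0).
Local Notation F := (sextic K).
Implicit Types (g h p q : {mpoly K[3]}) (u v : 'I_3 -> K).

(** An injective endomorphism of a finite-dimensional space is onto. The map is a relation because
    pull-backs are known only through their existence. *)
Lemma homog_surj d (P : {mpoly K[3]} -> {mpoly K[3]} -> Prop) :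
  (forall g, g \is d.-homog -> exists2 c, c \is d.-homog & P g c) ->
  (forall g g' c c' a, P g c -> P g' c' -> P (a *: g + g') (a *: c + c')) -> P 0 0 ->
  (forall g, g \is d.-homog -> P g 0 -> g = 0) ->
  forall c, c \is d.-homog -> exists2 g, g \is d.-homog & P g c.
Proof.
move=> Pex Plin P00 Pinj c hc.
pose V := dhomog 3 K d; pose X := vbasis {:V}.
have /fin_all_exists [f fP] (i : 'I_(\dim {:V})) : exists c : V,
    P (mpoly_of_dhomog X`_i) (mpoly_of_dhomog c).
  have [c' hc' Pc'] := Pex _ (dhomog_is_dhomog X`_i).
  by exists (DHomog hc').
have Psum (k : 'I_(\dim {:V}) -> K) :
    P (mpoly_of_dhomog (\sum_i k i *: X`_i)) (mpoly_of_dhomog (\sum_i k i *: f i)).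
  elim/big_rec2: _ => [|i x y _ IH]; first exact: P00.
  exact: (Plin _ _ _ _ (k i) (fP i) IH).
pose Y := [tuple f i | i < \dim {:V}].
have YE (k : 'I_(\dim {:V}) -> K) : \sum_i k i *: Y`_i = \sum_i k i *: f i.
  by apply: eq_bigr => i _; rewrite -tnth_nth tnth_mktuple.
have freeY : free Y.
  apply/freeP => k; rewrite YE => k0 i.
  have := Psum k; rewrite k0 => /(Pinj _ (dhomog_is_dhomog _)) X0.
  have freeX : free X by apply: (basis_free (vbasisP _)).
  by move/freeP: freeX => /(_ k); apply; apply: val_inj.
have basisY : basis_of {:V} Y by rewrite basisEfree freeY subvf size_tuple leqnn.
exists (mpoly_of_dhomog (\sum_i coord Y i (DHomog hc) *: X`_i)).
  exact: dhomog_is_dhomog.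
have := Psum (fun i => coord Y i (DHomog hc)).
by rewrite -[X in P _ (mpoly_of_dhomog X)]YE -(coord_basis basisY (memvf _)).
Qed.

Lemma homog_decomp d p : p \is d.+1.-homog -> exists2 f : 'I_3 -> {mpoly K[3]},
  forall i, f i \is d.-homog & p = \sum_i 'X_i * f i.
Proof.
move=> hp; exists (fun i => d.+1%:R^-1 *: mderiv i p).
  by move=> i; apply/rpredZ/(mderiv_homog _ hp).
under eq_bigr => i _ do rewrite -scalerAr.
rewrite -scaler_sumr (euler hp) scalerA mulVf ?scale1r //.
exact: natf_neq0_char0.
Qed.

Lemma cubic_span g : g \is 3.-homog -> exists k : 'I_3 -> 'I_3 -> 'I_3 -> K,
  g = \sum_a \sum_b \sum_c k a b c *: ('X_a * ('X_b * 'X_c)).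
Proof.
move=> hg; have [f hf ->] := homog_decomp hg.
have /fin_all_exists2 [f2 hf2 f2E] i := homog_decomp (hf i).
have /fin_all_exists [f3 f3P] i : exists f3 : 'I_3 -> 'I_3 -> {mpoly K[3]},
    (forall b c, f3 b c \is 0.-homog) /\ forall b, f2 i b = \sum_c 'X_c * f3 b c.
  have /fin_all_exists2 [f3 h3 e3] b := homog_decomp (hf2 i b).
  by exists f3.
exists (fun a b c => (f3 a b c)@_0).
apply: eq_bigr => a _; rewrite f2E mulr_sumr; apply: eq_bigr => b _.
rewrite (f3P a).2 !mulr_sumr; apply: eq_bigr => c _.
rewrite {1}(homog0_const ((f3P a).1 b c)) -mul_mpolyC; ring.
Qed.

Variables (s t : 3.-tuple {mpoly K[3]}) (m d : nat).
Hypothesis ht : forall i, tnth t i \is m.-homog.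
Hypothesis hs : forall i, tnth s i \is d.-homog.
Hypothesis Ft : van (F \mPo t).
Hypothesis Fs : van (F \mPo s).
Hypothesis st : same_map F (rcomp s t) (ratid K).
Hypothesis ts : same_map F (rcomp t s) (ratid K).

(* The cubics C i j k represent t_i t_j t_k up to a common rational factor. *)
Record veronese (C : 'I_3 -> 'I_3 -> 'I_3 -> {mpoly K[3]}) : Prop := Veronese {
  ver_homog : forall i j k, C i j k \is 3.-homog;
  ver_prop : forall i j k l, van (tnth t l * C i j k - tnth t i * C l j k);
  ver_rel : forall i j k l a b, van (C i j k * C l a b - C l j k * C i a b);
  ver_sym1 : forall i j k, C i j k = C j i k;
  ver_sym2 : forall i j k, C i j k = C i k j;
  ver_span : forall e, e \is 3.-homog -> exists k : 'I_3 -> 'I_3 -> 'I_3 -> K,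
    e = \sum_a \sum_b \sum_c k a b c *: C a b c;
  ver_indep : forall i j (e : 'I_3 -> K), \sum_k e k *: C i j k = 0 -> forall k, e k = 0 }.

(** [C i j k] is the pull-back of X_i X_j X_k. Uniqueness of the pull-back gives the symmetries,
    surjectivity the span, and injectivity the independence, since the combination considered is X_i
    X_j times a linear form. *)
Lemma veronese_exists : exists C, veronese C.
Proof.
have [a na] := grad_comp_not_van charK ht hs Ft st.
have nw := wedge_a_not_van charK ht hs Ft st na.
pose w := wedge t a; pose N := mderiv a F \mPo t.
rewrite -/w in nw; rewrite -/N in na.
pose P g c := van ((g \mPo t) * w - c * N).
have Pex g : g \is 3.-homog -> exists2 c, c \is 3.-homog & P g c.
  by move=> hg; apply: (pullback_exists charK ht hs Ft st na hg).
clearbody w N.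
have Plin g g' c c' b : P g c -> P g' c' -> P (b *: g + g') (b *: c + c').
  move=> gc gc'; apply: vanB_intro => u cu.
  have e := vanB_eq gc cu; have e' := vanB_eq gc' cu.
  rewrite mevalM in e; rewrite [RHS]mevalM in e.
  rewrite mevalM in e'; rewrite [RHS]mevalM in e'.
  rewrite mevalM [RHS]mevalM comp_mpolyD comp_mpolyZ !mevalD !mevalZ.
  by rewrite mulrDl [RHS]mulrDl e' -2!mulrA e.
have P00 : P 0 0.
  by move=> u _; rewrite comp_mpoly0 !mul0r subrr meval0.
have Pinj g : g \is 3.-homog -> P g 0 -> g = 0.
  move=> hg g0; apply: (pullback_inj charK ht hs Fs st ts hg).
  apply: (van_cancel charK nw) => u cu; have := vanB_eq g0 cu.
  by rewrite mul0r meval0 mulrC.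
have Pfun g c c' : c \is 3.-homog -> c' \is 3.-homog -> P g c -> P g c' -> c = c'.
  move=> hc hc' gc gc'; apply/eqP; rewrite -subr_eq0; apply/eqP.
  apply: (@van_small _ charK 3); rewrite ?rpredB //.
  apply: (van_cancel charK na) => u cu.
  have e := vanB_eq gc cu; have e' := vanB_eq gc' cu.
  rewrite e in e'; rewrite mevalM [RHS]mevalM in e'.
  by rewrite mevalM mevalB mulrBr ![N.@[u] * _]mulrC e' subrr.
pose X3 (i j k : 'I_3) : {mpoly K[3]} := 'X_i * ('X_j * 'X_k).
have hX3 i j k : X3 i j k \is 3.-homog.
  by apply: (dhomogM (homog1_mono _ _) (dhomogM (homog1_mono _ _) (homog1_mono _ _))).
have /fin_all_exists [C CP] i : exists C : 'I_3 -> 'I_3 -> {mpoly K[3]},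
    forall j k, C j k \is 3.-homog /\ P (X3 i j k) (C j k).
  have /fin_all_exists [C CP] j : exists C : 'I_3 -> {mpoly K[3]},
      forall k, C k \is 3.-homog /\ P (X3 i j k) (C k).
    have /fin_all_exists [C CP] k : exists c, c \is 3.-homog /\ P (X3 i j k) c.
      by have [c hc Pc] := Pex _ (hX3 i j k); exists c.
    by exists C.
  by exists C.
have hC i j k : C i j k \is 3.-homog := (CP i j k).1.
have CE i j k u : on_cone u -> (C i j k).@[u] * N.@[u] =
    teval t u i * teval t u j * teval t u k * w.@[u].
  move=> cu; have := vanB_eq (CP i j k).2 cu; rewrite mevalM [RHS]mevalM => <-.
  congr (_ * _); rewrite comp_mpoly_meval /X3 mevalM mevalM !mevalXU.
  by rewrite mulrA.
have nNN : ~ van (N * N) by move=> /(van_prime charK) [].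
exists C; split=> //.
- move=> i j k l; apply: (van_cancel charK na) => u cu.
  rewrite mevalM mevalB !mevalM -!/(teval t u _) mulrC mulrBl -!mulrA !CE //.
  by rewrite -!/(teval t u _); ring.
- move=> i j k l b c; apply: (van_cancel charK nNN) => u cu.
  rewrite mevalM mevalM mevalB (mevalM _ (C i j k)) (mevalM _ (C l j k)).
  transitivity (((C i j k).@[u] * N.@[u]) * ((C l b c).@[u] * N.@[u]) -
    ((C l j k).@[u] * N.@[u]) * ((C i b c).@[u] * N.@[u])); first by ring.
  by rewrite !CE //; ring.
- move=> i j k; apply: (Pfun (X3 i j k)) => //; first exact: (CP i j k).2.
  have -> : X3 i j k = X3 j i k by rewrite /X3 mulrCA.
  exact: (CP j i k).2.
- move=> i j k; apply: (Pfun (X3 i j k)) => //; first exact: (CP i j k).2.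
  have -> : X3 i j k = X3 i k j by rewrite /X3 ['X_j * _]mulrC.
  exact: (CP i k j).2.
- move=> e he; have [g hg gP] := homog_surj Pex Plin P00 Pinj he.
  have [k gE] := cubic_span hg; exists k; apply: (Pfun g) => //.
    by rewrite !rpred_sum // => b _; rewrite rpred_sum // => c _; rewrite rpred_sum // => c' _; rewrite rpredZ.
  rewrite gE.
  have Psum (I : finType) (x y : I -> {mpoly K[3]}) : (forall i, P (x i) (y i)) ->
      P (\sum_i x i) (\sum_i y i).
    move=> xy; elim/big_rec2: _ => [|i x' y' _ IH]; first exact: P00.
    by rewrite -[x i]scale1r -[y i]scale1r; apply: Plin.
  have PZ x y b : P x y -> P (b *: x) (b *: y).
    by move=> xy; rewrite -[b *: x]addr0 -[b *: y]addr0; apply: Plin.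
  by do 3![apply: (Psum) => ?]; apply: PZ; apply: (CP _ _ _).2.
move=> i j e e0 k.
have : P (\sum_k e k *: X3 i j k) (\sum_k e k *: C i j k).
  elim/big_rec2: _ => [|k' x' y' _ IH]; first exact: P00.
  by apply: Plin => //; apply: (CP i j k').2.
rewrite e0 => PX; have : \sum_k e k *: X3 i j k = 0.
  by apply: Pinj PX; apply: rpred_sum => k' _; apply: rpredZ; apply: hX3.
have -> : \sum_k e k *: X3 i j k = 'X_i * ('X_j * lform e).
  rewrite /lform !mulr_sumr; apply: eq_bigr => k' _.
  by rewrite /X3 -!mul_mpolyC; ring.
have X0 (l : 'I_3) : ('X_l : {mpoly K[3]}) != 0 by rewrite -msize_poly_eq0 msizeX.
move/eqP; rewrite !mulf_eq0 !(negbTE (X0 _)) /= => l0; apply/eqP.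
by apply: contraTT l0 => ek; apply: lform_neq0; exists k.
Qed.
End Pullback.

(** * Linearity of birational maps *)

Section Lines.
Variables (K : closedFieldType) (charK : [pchar K] =i pred0).
Local Notation F := (sextic K).
Implicit Types (g h p q : {mpoly K[3]}) (u v w z : 'I_3 -> K).

(* Restriction to the line x |-> v + x w. *)
Definition line v w g : {poly K} :=
  mmap (@polyC K) (fun i => (v i)%:P + w i *: 'X) g.

Lemma lineM v w g h : line v w (g * h) = line v w g * line v w h.
Proof. exact: rmorphM. Qed.

Lemma line_sum v w (f : 'I_3 -> {mpoly K[3]}) :
  line v w (\sum_i f i) = \sum_i line v w (f i).
Proof. exact: raddf_sum. Qed.

Lemma lineX v w i : line v w 'X_i = (v i)%:P + w i *: 'X.
Proof. by rewrite /line mmapX mmap1U. Qed.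

Lemma lineC v w c : line v w c%:MP = c%:P.
Proof. by rewrite /line mmapC. Qed.

Lemma line_eval v w x g : (line v w g).[x] = g.@[fun i => v i + x * w i].
Proof.
elim/mpoly_ring_ind: g => [c|i|p q IHp IHq|p q IHp IHq].
- by rewrite lineC hornerC mevalC.
- by rewrite lineX mevalXU hornerD hornerC hornerZ hornerX mulrC.
- by rewrite mevalD -IHp -IHq -hornerD; congr (_.[_]); apply: rmorphD.
- by rewrite mevalM -IHp -IHq -hornerM lineM.
Qed.

Lemma line_homog v w d g : g \is d.-homog ->
  (size (line v w g) <= d.+1)%N /\ (line v w g)`_d = g.@[w].
Proof.
elim: d g => [|d IH] g hg.
  by rewrite (homog0_const hg) lineC mevalC coefC size_polyC_leq1.
have [f hf ->] := homog_decomp charK hg.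
have top i j : (d < j)%N -> (line v w (f i))`_j = 0.
  by move=> dj; rewrite nth_default // (leq_trans (IH _ (hf i)).1).
have cf i j : (line v w ('X_i * f i))`_j.+1 =
    v i * (line v w (f i))`_j.+1 + w i * (line v w (f i))`_j.
  by rewrite lineM lineX mulrDl -scalerAl coefD coefCM coefZ coefXM.
rewrite line_sum; split.
  apply/leq_sizeP => [[|j]] // dj; rewrite coef_sum big1 // => i _.
  by rewrite cf !top ?mulr0 ?addr0 // ltnW.
rewrite coef_sum raddf_sum /=; apply: eq_bigr => i _.
by rewrite cf top // mulr0 add0r (IH _ (hf i)).2 mevalM mevalXU.
Qed.

Lemma plane_span v w z : (exists i, cross v w i != 0) -> on_plane (cross v w) z ->
  exists a b, forall i, z i = a * v i + b * w i.
Proof.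
case=> k ck; rewrite /on_plane sum3 => E.
exists (cross z w k / cross v w k), (cross v z k / cross v w k) => i.
apply: (mulfI ck); transitivity (cross z w k * v i + cross v z k * w i); last by field.
apply/eqP; rewrite -subr_eq0; apply/eqP.
suff -> : cross v w k * z i - (cross z w k * v i + cross v z k * w i) =
  (i == k)%:R * (cross v w i0 * z i0 + cross v w i1 * z i1 + cross v w i2 * z i2).
  by rewrite E mulr0.
by rewrite /cross; elim/ord3P: (k); elim/ord3P: i; rewrite !next3E !inord3_eq //=; ring.
Qed.

(** Parametrize the plane by two variables and take a zero of the resulting binary form. *)
Lemma plane_root (n : nat) (p : 'I_3 -> K) g : (exists i, p i != 0) -> g \is n.+1.-homog ->
  exists v, [/\ exists i, v i != 0, on_plane p v & g.@[v] = 0].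
Proof.
case=> k pk hg; pose a := next3 k; pose b := next3 (next3 k).
have abk : [/\ (b == a) = false, (k == a) = false & (k == b) = false].
  by rewrite /a /b; elim/ord3P: (k); rewrite !next3E !inord3_eq.
have [ba ka kb] := abk.
pose X : {mpoly K[2]} := 'X_(inord 0); pose Y : {mpoly K[2]} := 'X_(inord 1).
pose l : 3.-tuple {mpoly K[2]} := [tuple if i == a then X else if i == b then Y
  else - (p k)^-1 *: (p a *: X + p b *: Y) | i < 3].
have hl i : tnth l i \is 1.-homog.
  rewrite tnth_mktuple; case: ifP => _; [|case: ifP => _]; rewrite ?homog1_mono //.
  by rewrite rpredZ // rpredD // rpredZ // homog1_mono.
have hgl : g \mPo l \is n.+1.-homog by rewrite -[n.+1]muln1; apply: homog_comp.
have [y y0 gy] := binary_root hgl.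
have va : (tnth l a).@[y] = y (inord 0) by rewrite tnth_mktuple eqxx mevalXU.
have vb : (tnth l b).@[y] = y (inord 1) by rewrite tnth_mktuple ba eqxx mevalXU.
have vk : (tnth l k).@[y] = - (p k)^-1 * (p a * y (inord 0) + p b * y (inord 1)).
  by rewrite tnth_mktuple ka kb mevalZ mevalD !mevalZ !mevalXU.
exists (fun i => (tnth l i).@[y]); split; last by rewrite -comp_mpoly_meval.
  by case: y0 => i; elim/ord2P: i => yi; [exists a; rewrite va|exists b; rewrite vb].
have -> : on_plane p (fun i => (tnth l i).@[y]) =
    (p k * (tnth l k).@[y] + p a * (tnth l a).@[y] + p b * (tnth l b).@[y] = 0).
  rewrite /on_plane sum3 /a /b; congr (_ = 0).
  by elim/ord3P: (k); rewrite !next3E; ring.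
by rewrite va vb vk; field.
Qed.

Lemma homog1_lform g : g \is 1.-homog -> exists e, g = lform e.
Proof.
move=> hg; have [f hf ->] := homog_decomp charK hg.
exists (fun i => (f i)@_0); rewrite /lform; apply: eq_bigr => i _.
by rewrite {1}(homog0_const (hf i)) mulrC mul_mpolyC.
Qed.

Lemma sextic_neq0 : F != 0.
Proof.
have : F.@[fun i => (i == i0)%:R] != 0.
  rewrite sexticE eqxx !inord3_eq //= -[X in X != 0]/(sext (1 : K) 0 0).
  have -> : sext (1 : K) 0 0 = 1 by rewrite /sext; ring.
  exact: oner_neq0.
by apply: contraNneq => ->; rewrite meval0.
Qed.
End Lines.

(** * An array with vanishing minors is linear up to two common factors *)

Section VeroneseLinear.
Variables (K : closedFieldType) (charK : [pchar K] =i pred0).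
Local Notation F := (sextic K).
Implicit Types (u v w z : 'I_3 -> K).
Variables (t : 3.-tuple {mpoly K[3]}) (C : 'I_3 -> 'I_3 -> 'I_3 -> {mpoly K[3]}).
Hypothesis verC : veronese t C.

Let hC := ver_homog verC.
Let sym1 := ver_sym1 verC.
Let sym2 := ver_sym2 verC.

(* The 2 x 2 minors are multiples of F; a 3 x 3 determinant with a repeated row and
   the independence of the cubics in a row show that these multiples are zero. *)
Lemma ver_minor i l a k m : C i a k * C l a m = C i a m * C l a k.
Proof.
have hD k' m' : C i a k' * C l a m' - C l a k' * C i a m' \is 6.-homog.
  by apply: rpredB; apply: (dhomogM (hC _ _ _) (hC _ _ _)).
have /fin_all_exists [L LP] k' : exists L : 'I_3 -> K, forall m',
    C i a k' * C l a m' - C l a k' * C i a m' = L m' *: F.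
  have /fin_all_exists [L LP] m' : exists c : K,
      C i a k' * C l a m' - C l a k' * C i a m' = c *: F.
    by apply: (van_sextic charK (hD k' m')); apply: (ver_rel verC).
  by exists L.
have F0 := sextic_neq0 K.
have L0 := ver_indep verC (_ : \sum_j L (next3 j) (next3 (next3 j)) *: C i a j = 0).
have {L0} : forall j, L (next3 j) (next3 (next3 j)) = 0.
  apply: L0; apply: (mulIf F0); rewrite mul0r sum3 !next3E !mulrDl -!scalerAl !scalerAr -!LP.
  ring.
move=> L0; have := L0 i0; have := L0 i1; have := L0 i2; rewrite !next3E => L01 L20 L12.
have E01 := LP i0 i1; have E20 := LP i2 i0; have E12 := LP i1 i2.
rewrite L01 L20 L12 !scale0r in E01 E20 E12.
have eq0 (x y : {mpoly K[3]}) : x - y = 0 -> x = y by move/eqP; rewrite subr_eq0 => /eqP.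
move/eq0: E01 => E01; move/eq0: E20 => E20; move/eq0: E12 => E12.
by elim/ord3P: k; elim/ord3P: m => //; rewrite ?E01 ?E20 ?E12 mulrC.
Qed.

Section Point.
Variable v : 'I_3 -> K.
Local Notation c i j k := (C i j k).@[v].

Lemma ver_minor_eval i l a k m : c i a k * c l a m = c i a m * c l a k.
Proof. by rewrite -!mevalM ver_minor. Qed.

Lemma sqr_eq0 (x y : K) : x * x = y -> y = 0 -> x = 0.
Proof. by move=> <- /eqP; rewrite mulf_eq0 orbb => /eqP. Qed.

(** For T_i T_j T_k this says that T_i^3 = 0 kills T_i; here minors express the squares of the
    remaining entries through entries already known to vanish. *)
Lemma ver_iii_eq0 i : c i i i = 0 -> forall j k, c i j k = 0.
Proof.
move=> i0 j k.
have i1 j' : c i i j' = 0.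
  apply: (sqr_eq0 (y := c i i i * c j' i j')); last by rewrite i0 mul0r.
  by rewrite [RHS]ver_minor_eval (sym1 j' i i) (sym2 i j' i).
have i2 j' : c i j' j' = 0.
  apply: (sqr_eq0 (y := c i j' i * c j' j' j')); last by rewrite sym2 i1 mul0r.
  by rewrite [RHS]ver_minor_eval (sym2 j' j' i) (sym1 j' i j').
apply: (sqr_eq0 (y := c j i j * c k i k)); last by rewrite sym1 i2 mul0r.
by rewrite [RHS]ver_minor_eval (sym1 j i k) (sym1 k i j) (sym2 i k j).
Qed.

(** The entries span all cubics, in particular the cube of a coordinate that is nonzero at [v]. *)
Lemma ver_base_point_free : (exists i, v i != 0) -> exists i, c i i i != 0.
Proof.
case=> k vk; apply: NNPP => no; case/eqP: (expf_neq0 3 vk).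
have c0 i j l : c i j l = 0.
  by apply: ver_iii_eq0; apply/eqP; apply: contra_notT no => ci; exists i.
have hX : ('X_k : {mpoly K[3]}) ^+ 3 \is (1 * 3).-homog by apply/dhomogMn/homog1_mono.
have [e eE] := ver_span verC hX.
rewrite -(mevalXU v k) -mevalXn eE raddf_sum big1 // => i _.
rewrite raddf_sum big1 // => j _; rewrite raddf_sum big1 // => l _ /=.
by rewrite mevalZ c0 mulr0.
Qed.
End Point.

Lemma ver_neq0 i j k : C i j k != 0.
Proof.
apply/negP => /eqP C0.
have H : \sum_l (l == k)%:R *: C i j l = 0.
  rewrite (bigD1 k) //= big1 ?addr0 ?C0 ?scaler0 // => l /negbTE ->.
  by rewrite scale0r.
by have /eqP := ver_indep verC H k; rewrite /= eqxx oner_eq0.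
Qed.

Lemma ver_cube i j : C i i i * C i i i * C j j j = C i i j * C i i j * C i i j.
Proof.
have I1 : C i i i * C i j j = C i i j * C i i j.
  have := ver_minor i j i i j; rewrite [C j i j]sym1 [C j i i]sym1 [C i j i]sym2.
  by [].
have I2 : C i i j * C j j j = C i j j * C i j j.
  by have := ver_minor i j j i j; rewrite [C i j i]sym2 [C j j i]sym2 [C j i j]sym1.
have I3 : C i i i * C j j j = C i i j * C i j j.
  apply: (mulfI (mulf_neq0 (ver_neq0 i i j) (ver_neq0 i j j))).
  transitivity ((C i i i * C i j j) * (C i i j * C j j j)); first by ring.
  by rewrite I1 I2; ring.
by rewrite -mulrA I3 mulrCA I1 mulrA.
Qed.

(** Restrict the identity of [ver_cube] to the line, choosing j with C_jjj(v) not 0. Twice the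
    multiplicity of C_iii at [v] is a multiple of 3, so this multiplicity is at least 3. A nonzero
    restriction of degree at most 3 would have top coefficient C_iii(w), which is 0. *)
Lemma ver_line i v w : (exists j, v j != 0) -> (C i i i).@[v] = 0 -> (C i i i).@[w] = 0 ->
  line v w (C i i i) = 0.
Proof.
move=> v0 cv cw; apply/eqP/negPn/negP => P0.
have [j cj] := ver_base_point_free v0.
pose P := line v w (C i i i); pose Q := line v w (C j j j); pose R := line v w (C i i j).
have PQR : P * P * Q = R * R * R by rewrite -!lineM ver_cube.
have at0 g : (line v w g).[0] = g.@[v].
  by rewrite line_eval; apply: meval_eq => l; rewrite mul0r addr0.
have rP : root P 0 by rewrite rootE at0 cv.
have nQ : ~~ root Q 0 by rewrite rootE at0.
have Q0 : Q != 0 by apply: contraNneq nQ => ->; rewrite root0.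
have R0 : R != 0.
  have PPQ0 : P * P * Q != 0 by rewrite !mulf_neq0.
  by apply: contraTneq PPQ0 => R0; rewrite PQR R0 mulr0 eqxx.
have mP : (0 < mup 0 P)%N by rewrite -XsubC_dvd // dvdp_XsubCl.
have : (2 < mup 0 P)%N.
  have := congr1 (mup 0) PQR; rewrite !mupM ?mulf_neq0 // (mupNroot nQ).
  by move: (mup 0 P) (mup 0 R) mP => a b; clear; lia.
rewrite ltnNge mup_leq // negbK => /(dvdp_leq P0).
rewrite subr0 size_polyXn; have [sP topP] := line_homog charK v w (hC i i i).
move=> s4; have sP4 : size P = 4%N by apply/eqP; rewrite eqn_leq sP s4.
have := lead_coef_eq0 P; rewrite (negbTE P0) lead_coefE sP4 [_`_3]topP cw.
by rewrite eqxx.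
Qed.

Lemma ver_plane i : exists2 p : 'I_3 -> K, exists k, p k != 0 &
  forall j k, vanish_plane p (C i j k).
Proof.
pose dl (k l : 'I_3) : K := (l == k)%:R.
have dl0 k : exists l, dl k l != 0 by exists k; rewrite /dl eqxx oner_eq0.
have dlP k z : on_plane (dl k) z -> z k = 0.
  by rewrite /on_plane (bigD1 k) //= big1 ?addr0 /dl ?eqxx ?mul1r // => l /negbTE ->; rewrite mul0r.
have [v [v0 /dlP v2 cv]] := plane_root (dl0 i2) (hC i i i).
(* A second zero, independent of [v], is taken on a coordinate line that misses [v]. *)
have [w [w0 cw ck]] : exists w, [/\ exists j, w j != 0, (C i i i).@[w] = 0 & exists k, cross v w k != 0].
  have [v_0|v_0] := eqVneq (v i0) 0.
    have v1 : v i1 != 0.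
      by case: v0 => j; elim/ord3P: j; rewrite ?v_0 ?v2 ?eqxx.
    have [w [w0 /dlP w1 cw]] := plane_root (dl0 i1) (hC i i i).
    exists w; split=> //; case: w0 => j; elim/ord3P: j => wj; last 1 first.
    - by exists i0; rewrite /cross !next3E w1 mulr0 subr0 mulf_neq0.
    - by exists i2; rewrite /cross !next3E w1 mulr0 sub0r oppr_eq0 mulf_neq0.
    by rewrite w1 eqxx in wj.
  have [w [w0 /dlP w1 cw]] := plane_root (dl0 i0) (hC i i i).
  exists w; split=> //; case: w0 => j; elim/ord3P: j => wj.
  - by rewrite w1 eqxx in wj.
  - by exists i2; rewrite /cross !next3E w1 mulr0 subr0 mulf_neq0.
  - by exists i1; rewrite /cross !next3E w1 mulr0 sub0r oppr_eq0 mulf_neq0.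
exists (cross v w) => // j k z pz; apply: ver_iii_eq0.
have [a [b zE]] := plane_span ck pz.
rewrite (meval_eq _ (zE : z =1 _)).
have [a0|a0] := eqVneq a 0.
  have e : (fun i => a * v i + b * w i) =1 (fun i => b * w i).
    by move=> l; rewrite a0 mul0r add0r.
  by rewrite (meval_eq _ e) (homog_eval _ _ (hC i i i)) cw mulr0.
have e : (fun i => a * v i + b * w i) =1 (fun i => a * (v i + b / a * w i)).
  by move=> l; field.
rewrite (meval_eq _ e) (homog_eval _ _ (hC i i i)) -line_eval (ver_line v0 cv cw).
by rewrite horner0 mulr0.
Qed.

Lemma ver_linear : exists2 r : 'I_3 -> {mpoly K[3]}, forall i, r i \is 1.-homog &
  (forall i j, van (tnth t i * r j - tnth t j * r i)) /\
  (forall e : 'I_3 -> K, \sum_k e k *: r k = 0 -> forall k, e k = 0).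
Proof.
have [p p0 pC] := ver_plane i0; have [q q0 qC] := ver_plane i1.
(* If the lines of [p] and [q] coincided, a zero of C_222 on them would be a base point of the
   array. *)
have npq : ~ vanish_plane q (lform p).
  move=> pq; have [v [v0 qv c2]] := plane_root q0 (hC i2 i2 i2).
  have [i] := ver_base_point_free v0; elim/ord3P: i; rewrite ?c2 ?eqxx //.
    by rewrite pC ?eqxx // /on_plane -lform_eval pq.
  by rewrite qC ?eqxx.
have /fin_all_exists2 [r hr rE] k : exists2 r, r \is 1.-homog & C i0 i1 k = r * lform q * lform p.
  have [g hg gE] := vanish_plane_dvd_homog p0 (hC i0 i1 k) (pC i1 k).
  have vgp : vanish_plane q (g * lform p) by move=> z qz; rewrite -gE sym1 qC.
  have [vg|//] := vanish_plane_mul q0 vgp.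
  have [r hr rE] := vanish_plane_dvd_homog q0 hg vg.
  by exists r; rewrite // gE rE.
have nlp (x : 'I_3 -> K) : (exists k, x k != 0) -> ~ van (lform x).
  by move=> x0 vx; have := van_small charK (lform_homog x) isT vx; apply/eqP; apply: lform_neq0.
exists r => //; split=> [i j|e e0].
  have npq2 : ~ van (lform q * lform p).
    by move=> /(van_prime charK) [] /nlp; apply.
  apply: (van_cancel charK npq2).
  apply: van_eq (ver_prop verC j i0 i1 i) => u _; congr (_.@[u]).
  have -> : C j i0 i1 = C i0 i1 j by rewrite sym1 sym2.
  have -> : C i i0 i1 = C i0 i1 i by rewrite sym1 sym2.
  by rewrite !rE; ring.
apply: (ver_indep verC (i := i0) (j := i1)); transitivity ((\sum_k e k *: r k) * (lform q * lform p)).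
  by rewrite mulr_suml; apply: eq_bigr => k _; rewrite rE -scalerAl mulrA.
by rewrite e0 mul0r.
Qed.
End VeroneseLinear.

(** * Linear representatives of birational maps *)

Section LinearMaps.
Variables (K : closedFieldType) (charK : [pchar K] =i pred0).
Local Notation F := (sextic K).
Implicit Types (g h p q : {mpoly K[3]}) (u v w x : 'I_3 -> K) (M N : 'M[K]_3).
Implicit Types (s t : 3.-tuple {mpoly K[3]}).

Definition mxact M u : 'I_3 -> K := fun i => \sum_j M i j * u j.

Definition lin M : 3.-tuple {mpoly K[3]} := [tuple lform (M i) | i < 3].

Lemma teval_lin M u : teval (lin M) u =1 mxact M u.
Proof. by move=> i; rewrite /teval tnth_mktuple lform_eval. Qed.

Lemma mxact1 u : mxact 1%:M u =1 u.
Proof.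
move=> i; rewrite /mxact (bigD1 i) //= big1 => [|j ne]; rewrite !mxE ?eqxx ?mul1r ?addr0 //.
by rewrite eq_sym (negbTE ne) mul0r.
Qed.

Lemma mxactM M N u : mxact (M *m N) u =1 mxact M (mxact N u).
Proof.
move=> i; rewrite /mxact; under eq_bigr => j _ do rewrite mxE mulr_suml.
rewrite exchange_big; apply: eq_bigr => k _; rewrite mulr_sumr.
by apply: eq_bigr => j _; rewrite mulrA.
Qed.

Lemma mxactZ c M u : mxact (c *: M) u =1 (fun i => c * mxact M u i).
Proof. by move=> i; rewrite /mxact mulr_sumr; apply: eq_bigr => j _; rewrite mxE mulrA. Qed.

Lemma mxact_scale c M u : mxact M (fun i => c * u i) =1 (fun i => c * mxact M u i).
Proof. by move=> i; rewrite /mxact mulr_sumr; apply: eq_bigr => j _; rewrite mulrCA. Qed.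

Lemma eq_mxact M u v : u =1 v -> mxact M u =1 mxact M v.
Proof. by move=> uv i; apply: eq_bigr => j _; rewrite uv. Qed.

Lemma mxact_invK M u : M \in unitmx -> mxact (invmx M) (mxact M u) =1 u.
Proof. by move=> uM i; rewrite -mxactM mulVmx // mxact1. Qed.

Lemma mxact_Kinv M u : M \in unitmx -> mxact M (mxact (invmx M) u) =1 u.
Proof. by move=> uM i; rewrite -mxactM mulmxV // mxact1. Qed.

Lemma mxact_neq0 M u : M \in unitmx -> (exists i, u i != 0) -> exists i, mxact M u i != 0.
Proof.
move=> uM [i ui]; apply: NNPP => no; case/eqP: ui.
rewrite -(mxact_invK u uM) /mxact big1 // => j _.
suff -> : \sum_k M j k * u k = 0 by rewrite mulr0.
by apply/eqP; apply: contra_notT no => aj; exists j.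
Qed.

Lemma comp_lin_eval g M u : (g \mPo lin M).@[u] = g.@[mxact M u].
Proof. by rewrite comp_mpoly_meval; apply/meval_eq/teval_lin. Qed.

Lemma rcomp_lin M N : rcomp (lin M) (lin N) = lin (M *m N).
Proof.
apply: eq_from_tnth => i; apply: mpoly_fun_inj => u.
have := teval_rcomp (lin M) (lin N) u i; rewrite /teval => ->.
rewrite -[RHS]/(teval (lin (M *m N)) u i) teval_lin mxactM.
rewrite -[LHS]/(teval (lin M) (teval (lin N) u) i) teval_lin.
by apply: eq_mxact; apply: teval_lin.
Qed.

Lemma lin1 : lin 1%:M = ratid K.
Proof.
apply: eq_from_tnth => i; apply: mpoly_fun_inj => u.
by rewrite -[LHS]/(teval (lin 1%:M) u i) -[RHS]/(teval (ratid K) u i) teval_lin mxact1 teval_ratid.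
Qed.

Definition preserves M :=
  M \in unitmx /\ exists2 c, c != 0 & forall u, F.@[mxact M u] = c * F.@[u].

Lemma preserves1 : preserves 1%:M.
Proof.
split; first exact: unitmx1.
by exists 1 => [|u]; rewrite ?oner_neq0 // mul1r; apply: meval_eq; apply: mxact1.
Qed.

Lemma preservesM M N : preserves M -> preserves N -> preserves (M *m N).
Proof.
move=> [uM [c c0 cM]] [uN [d d0 dN]]; split; first by rewrite unitmx_mul uM.
exists (c * d) => [|u]; first by rewrite mulf_neq0.
by rewrite -mulrA -dN -cM; apply: meval_eq; apply: mxactM.
Qed.

Lemma preservesV M : preserves M -> preserves (invmx M).
Proof.
move=> [uM [c c0 cM]]; split; first by rewrite unitmx_inv.
exists c^-1 => [|u]; first by rewrite invr_eq0.
apply: (mulfI c0); rewrite mulVKf // -cM.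
by apply: meval_eq; apply: mxact_Kinv.
Qed.

Lemma preservesZ c M : c != 0 -> preserves M -> preserves (c *: M).
Proof.
move=> c0 [uM [d d0 dM]]; split; first by rewrite unitmxZ // unitfE.
exists (c ^+ 6 * d) => [|u]; first by rewrite mulf_neq0 // expf_neq0.
rewrite -mulrA -dM -(homog_eval _ _ (sextic_homog K)).
by apply: meval_eq; apply: mxactZ.
Qed.

Lemma preserves_comp M : preserves M -> exists2 c, c != 0 & F \mPo lin M = c *: F.
Proof.
move=> [_ [c c0 cM]]; exists c => //; apply: mpoly_fun_inj => u.
by rewrite comp_lin_eval cM mevalZ.
Qed.

Lemma on_cone_mxact M u : preserves M -> on_cone u -> on_cone (mxact M u).
Proof.
move=> [uM [c c0 cM]] [u0 Fu]; split; first exact: mxact_neq0.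
by rewrite cM Fu mulr0.
Qed.

Lemma not_van_mxact M g : preserves M -> ~ van g -> ~ van (g \mPo lin M).
Proof.
move=> pM ng vgM; apply: ng => u cu.
have := vgM _ (on_cone_mxact (preservesV pM) cu); rewrite comp_lin_eval => <-.
by apply: meval_eq => i; rewrite (mxact_Kinv _ pM.1).
Qed.

Lemma unitmx_row_neq0 M i : M \in unitmx -> exists j, M i j != 0.
Proof.
move=> uM; apply: NNPP => no; have /eqP := oner_neq0 K; apply.
transitivity ((M *m invmx M) i i); first by rewrite mulmxV // mxE eqxx.
rewrite mxE big1 // => j _.
suff -> : M i j = 0 by rewrite mul0r.
by apply/eqP; apply: contra_notT no => aj; exists j.
Qed.

Lemma lform_not_van (a : 'I_3 -> K) : (exists i, a i != 0) -> ~ van (lform a).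
Proof.
move=> a0 va; have := van_small charK (lform_homog a) isT va.
by apply/eqP; apply: lform_neq0.
Qed.

Lemma is_ratmap_lin M : M \in unitmx -> is_ratmap F (lin M).
Proof.
move=> uM; apply/is_ratmapP; split.
  by exists 1%N => i; rewrite tnth_mktuple lform_homog.
by exists i0; rewrite tnth_mktuple; apply/lform_not_van/unitmx_row_neq0.
Qed.

(** The factor may be 0: a representative of a map may vanish at a point of the curve. *)
Definition parallel u v := exists c, forall i, u i = c * v i.

Lemma rep_at M t u : preserves M -> same_map F t (lin M) -> on_cone u ->
  parallel (teval t u) (mxact M u).
Proof.
move=> pM /same_mapP [_ _ tM] cu.
have [i Mi] := mxact_neq0 pM.1 cu.1.
exists (teval t u i / mxact M u i) => j; have := vanB_eq (tM i j) cu.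
rewrite !mevalM -!/(teval _ _ _) !teval_lin => e.
by apply: (mulIf Mi); rewrite -e; field.
Qed.

Lemma rep_intro M t h : preserves M -> is_ratmap F t -> ~ van h ->
  (forall u, on_cone u -> h.@[u] != 0 -> parallel (teval t u) (mxact M u)) ->
  same_map F t (lin M).
Proof.
move=> pM rt nh tM; apply/same_mapP; split=> //; first exact: is_ratmap_lin pM.1.
move=> i j; apply: (van_off charK nh) => u cu hu; have [c cM] := tM u cu hu.
rewrite mevalB !mevalM -!/(teval _ _ _) !teval_lin !cM; ring.
Qed.

Lemma rep_same M s t : preserves M -> same_map F s (lin M) -> same_map F t (lin M) ->
  same_map F s t.
Proof.
move=> pM sM tM; have /same_mapP [rs _ _] := sM; have /same_mapP [rt _ _] := tM.
apply/same_mapP; split=> // i j u cu.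
have [c cs] := rep_at pM sM cu; have [d dt] := rep_at pM tM cu.
by rewrite mevalB !mevalM -!/(teval _ _ _) !cs !dt; ring.
Qed.

Lemma same_rep M s t : preserves M -> same_map F s (lin M) -> same_map F s t ->
  same_map F t (lin M).
Proof.
move=> pM sM /same_mapP [/is_ratmapP [_ [i si]] rt st].
apply: (rep_intro pM rt si) => u cu sui; have [c cs] := rep_at pM sM cu.
exists (teval t u i / teval s u i * c) => j.
by rewrite (cross_at cu st sui) (cs j) mulrA.
Qed.

Lemma rep_comp M N s t : preserves M -> preserves N ->
  same_map F s (lin M) -> same_map F t (lin N) ->
  same_map F (rcomp s t) (lin (M *m N)).
Proof.
move=> pM pN sM tN.
have /same_mapP [/is_ratmapP [[d hs] [i si]] _ _] := sM.
have /same_mapP [/is_ratmapP [[m ht] [j tj]] _ _] := tN.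
have siN := not_van_mxact pN si.
apply: (rep_intro (h := tnth t j) (preservesM pM pN)) => //.
  apply/is_ratmapP; split.
    by exists (d * m)%N => k; rewrite tnth_mktuple; apply: homog_comp.
  exists i => vi; have [//|//] : van (tnth t j) \/ van (tnth s i \mPo lin N).
  apply: (van_prime charK) => u cu; rewrite mevalM comp_lin_eval.
  have [->|tu] := eqVneq (tnth t j).@[u] 0; first by rewrite mul0r.
  have [c cN] := rep_at pN tN cu.
  have c0 : c != 0 by apply: contraNneq tu => c0; rewrite -/(teval t u j) cN c0 mul0r.
  have := vi u cu; rewrite -/(teval (rcomp s t) u i) teval_rcomp (meval_eq _ cN).
  rewrite (homog_eval _ _ (hs i)) => /eqP; rewrite mulf_eq0 expf_eq0 (negbTE c0) andbF /=.
  by move/eqP ->; rewrite mulr0.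
move=> u cu tu; have [c cN] := rep_at pN tN cu.
have c0 : c != 0 by apply: contraNneq tu => c0; rewrite -/(teval t u j) cN c0 mul0r.
have [e eM] := rep_at pM sM (on_cone_scale c0 (on_cone_mxact pN cu)).
exists (e * c) => k; rewrite teval_rcomp (meval_eq _ cN) -/(teval s _ k) eM.
by rewrite mxact_scale mxactM mulrA.
Qed.

Lemma rep_refl M : preserves M -> same_map F (lin M) (lin M).
Proof. by move=> pM; apply/same_map_refl/is_ratmap_lin/pM.1. Qed.

Lemma rep_scale M c : c != 0 -> preserves M -> same_map F (lin M) (lin (c *: M)).
Proof.
move=> c0 pM; apply: (rep_intro (h := 1)); first exact: preservesZ.
- exact: is_ratmap_lin pM.1.
- by have [u cu _] := not_van (lform_not_van (unitmx_row_neq0 i0 (unitmx1 _ _)));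
  move=> /(_ u cu)/eqP; rewrite meval1 oner_eq0.
move=> u cu _; exists c^-1 => i; rewrite teval_lin mxactZ mulrA mulVf // mul1r //.
Qed.

(** Independence of the linear forms r_k makes [M] invertible. F after [M] vanishes on C and has
    degree 6, so it is a multiple of F, and the factor is nonzero because [M] is onto. *)
Lemma linear_of_birational t : in_Bir F t ->
  exists2 M, preserves M & same_map F t (lin M).
Proof.
move=> [s [[rs /vanishesP Fs] [rt /vanishesP Ft] st ts]].
have /is_ratmapP [[d hs] _] := rs; have /is_ratmapP [[m ht] [i ti]] := rt.
have [C vC] := veronese_exists charK ht hs Ft Fs st ts.
have [r hr [tr rind]] := ver_linear charK vC.
have /fin_all_exists [e eE] i' := homog1_lform charK (hr i').
pose M := \matrix_(i, j) e i j.
have rM k : r k = lform (M k).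
  by rewrite eE; apply: eq_bigr => j _; rewrite mxE.
clearbody M.
have uM : M \in unitmx.
  rewrite -row_free_unit; apply: inj_row_free => v vM.
  apply/rowP => k; rewrite mxE; apply: (rind (fun k => v 0 k)).
  apply: mpoly_fun_inj => u; rewrite meval0 raddf_sum /=.
  transitivity ((v *m M *m \col_j u j) 0 0); last by rewrite vM mul0mx mxE.
  rewrite -mulmxA mxE; apply: eq_bigr => l _.
  rewrite mevalZ rM lform_eval mxE; congr (_ * _).
  by apply: eq_bigr => j _; rewrite mxE.
have rl j u : (r j).@[u] = mxact M u j by rewrite rM lform_eval.
have cr u j : on_cone u -> (tnth t i).@[u] != 0 ->
    mxact M u j = mxact M u i / (tnth t i).@[u] * (tnth t j).@[u].
  move=> cu tu; have := vanB_eq (tr i j) cu; rewrite !mevalM !rl => E.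
  by apply: (mulfI tu); rewrite E; field.
have vFM : van (F \mPo lin M).
  apply: (van_off charK ti) => u cu tu; rewrite comp_lin_eval (meval_eq _ (fun j => cr u j cu tu)).
  by rewrite (homog_eval _ _ (sextic_homog K)) -comp_mpoly_meval (Ft _ cu) mulr0.
have [|c cE] := van_sextic charK _ vFM.
  rewrite -[6%N]muln1; apply: homog_comp (sextic_homog K) _ => j.
  by rewrite tnth_mktuple lform_homog.
have pM : preserves M.
  have FM u : F.@[mxact M u] = c * F.@[u] by rewrite -comp_lin_eval cE mevalZ.
  split=> //; exists c => //; apply: contraNneq (sextic_neq0 K) => c0.
  apply/eqP; apply: mpoly_zero_fun => u.
  rewrite -(meval_eq _ (mxact_Kinv u uM)) FM c0 mul0r //.
exists M; first exact: pM.
apply: (rep_intro pM rt ti) => u cu tu.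
have [j Mj] := mxact_neq0 uM cu.1.
have Mi : mxact M u i != 0.
  by apply: contraNneq Mj => Mi; rewrite (cr u j cu tu) Mi !mul0r.
exists ((tnth t i).@[u] / mxact M u i) => k; rewrite /teval (cr u k cu tu).
by rewrite mulrA; field; rewrite ?Mi ?tu.
Qed.

Lemma inverse_lin M t : preserves M -> same_map F t (lin M) ->
  inverse_maps F (lin (invmx M)) t.
Proof.
move=> pM tM; have pV := preservesV pM; have p1 := preserves1.
have rV := rep_refl pV; have r1 := rep_refl p1; rewrite {1}lin1 in r1.
have self N s : preserves N -> same_map F s (lin N) -> is_selfmap F s.
  move=> pN sN; split; first by case: sN.
  apply/vanishesP => u cu; have [c cN] := rep_at pN sN cu.
  rewrite comp_mpoly_meval (meval_eq _ cN) (homog_eval _ _ (sextic_homog K)).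
  by rewrite (on_cone_mxact pN cu).2 mulr0.
split; [exact: self pV rV | exact: self pM tM | |]; apply: (rep_same p1 _ r1).
  by have := rep_comp pV pM rV tM; rewrite mulVmx // pM.1.
by have := rep_comp pM pV tM rV; rewrite mulmxV // pM.1.
Qed.

Lemma automorphism_of_linear M t : preserves M -> same_map F t (lin M) -> in_Aut F t.
Proof.
move=> pM tM; have pV := preservesV pM; have inv := inverse_lin pM tM.
have mor N s : preserves N -> same_map F s (lin N) -> is_selfmap F s -> is_morphism F s.
  move=> pN sN ss; split=> // v [v0 Fv]; exists (lin N); first exact: sN.
  have /(mxact_neq0 pN.1) [i Ni] : exists i, v 0 i != 0.
    apply: NNPP => no; case/negP: v0; apply/eqP/rowP => i; rewrite mxE.
    by apply/eqP; apply: contra_notT no => vi; exists i.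
  by exists i; rewrite -/(teval _ _ _) teval_lin.
exists (lin (invmx M)); have [si ti _ _] := inv; split=> //; [exact: mor pV (rep_refl pV) si|].
exact: mor pM tM ti.
Qed.

Lemma generated_linear (S : _ -> Prop) t : (forall s, S s -> in_Bir F s) -> Defs.generated F S t ->
  exists2 M, preserves M & same_map F t (lin M).
Proof.
move=> SB; elim=> {t} [t /SB|||s t _ _ inv|s t _ [M pM sM] st].
- exact: linear_of_birational.
- by exists 1%:M; rewrite ?lin1; [exact: preserves1 | have := rep_refl preserves1; rewrite lin1].
- move=> s t _ [M pM sM] _ [N pN tN]; exists (M *m N); first exact: preservesM.
  exact: rep_comp.
- by apply: linear_of_birational; exists s.
by exists M; last exact: same_rep sM st.
Qed.
End LinearMaps.

(** * Galois groups of points *)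

Section GaloisPoints.
Variables (K : closedFieldType) (charK : [pchar K] =i pred0).
Local Notation F := (sextic K).
Implicit Types (g h p q : {mpoly K[3]}) (u v w a b : 'I_3 -> K) (M N Phi : 'M[K]_3).
Implicit Types (s t : 3.-tuple {mpoly K[3]}) (P : 'rV[K]_3).

Definition diag3 (d : 'I_3 -> K) : 'M[K]_3 := diag_mx (\row_i d i).

Lemma mxact_diag3 d u : mxact (diag3 d) u =1 (fun i => d i * u i).
Proof.
move=> i; rewrite /mxact (bigD1 i) //= big1 => [|j ne]; rewrite !mxE ?eqxx ?mulr1n ?addr0 //.
by rewrite eq_sym (negbTE ne) mulr0n mul0r.
Qed.

Lemma preserves_diag3 d c : c != 0 -> (forall i, d i ^+ 3 = c) -> preserves (diag3 d).
Proof.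
move=> c0 dc; have d0 i : d i != 0.
  by apply: contraNneq c0 => d0; rewrite -(dc i) d0 expr0n.
split; first by rewrite unitmxE det_diag unitfE; apply/prodf_neq0 => i _; rewrite mxE.
exists (c ^+ 2) => [|u]; first by rewrite expf_neq0.
rewrite (meval_eq _ (mxact_diag3 d u)) !sexticE /sext !exprMn.
have d6 i : d i ^+ 6 = c ^+ 2 by rewrite -(dc i) -exprM.
by rewrite !d6 !dc; ring.
Qed.

Lemma vanish_plane_lform a b : (exists i, a i != 0) -> vanish_plane a (lform b) ->
  exists c, forall i, b i = c * a i.
Proof.
move=> [k ak] ab; exists (b k / a k) => j.
have [->|jk] := eqVneq j k; first by field.
pose u (i : 'I_3) := if i == j then a k else if i == k then - a j else 0.
have S (f : 'I_3 -> K) : \sum_i f i * u i = f j * a k - f k * a j.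
  rewrite (bigD1 j) //= (bigD1 k) 1?eq_sym //= big1 => [|i /andP [/negbTE ij /negbTE ik]].
    by rewrite /u eqxx eq_sym (negbTE jk) eqxx addr0 mulrN.
  by rewrite /u ij ik mulr0.
have /ab : on_plane a u by rewrite /on_plane S mulrC subrr.
rewrite lform_eval S => /eqP; rewrite subr_eq0 => /eqP e.
by apply: (mulIf ak); rewrite e; field.
Qed.

Lemma quintic_coef (a l k1 k2 c k3 k4 : K) :
  (forall z, (a + l * z) ^+ 6 + k1 * (a + l * z) ^+ 3 + k2 = c * z ^+ 6 + k3 * z ^+ 3 + k4) ->
  a * l ^+ 5 = 0.
Proof.
(* 1440 = 240 * 6: the interpolation below yields 240 times the coefficient of z^5, which is 6 a
   l^5. *)
move=> e; have n0 := natf_neq0_char0 charK (isT : 1440%N != 0%N).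
apply: (mulfI n0); rewrite mulr0.
pose f z := (a + l * z) ^+ 6 + k1 * (a + l * z) ^+ 3 + k2.
(* Lagrange interpolation of the coefficient of z^5 at the nodes 1, -1, 2, -2, 3, -3. *)
transitivity (f 3%:R - f (- 3%:R) - 4%:R * (f 2%:R - f (- 2%:R)) + 5%:R * (f 1 - f (- 1))).
  by rewrite /f; ring.
by rewrite /f !e; ring.
Qed.

Definition homology (z : K) := diag3 (fun i => if i == i2 then z else 1).

(** Such an [M] changes only Z, up to the scalar [m]. The absent monomials X Z^5 and Y Z^5 kill the
    first two entries of [L]; comparing the sixth powers and X^3 Z^3 then makes the ratio of the two
    eigenvalues a cube root of unity. *)
Lemma homology_of_axis M (m : K) (L : 'rV[K]_3) : preserves M ->
  M = m%:M + delta_mx i2 0 *m L -> exists2 z, z ^+ 3 = 1 & m != 0 /\ M = m *: homology z.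
Proof.
move=> [uM [c c0 cM]] ME.
have actE u : F.@[mxact M u] =
    sext (m * u i0) (m * u i1) (L 0 i0 * u i0 + L 0 i1 * u i1 + (L 0 i2 + m) * u i2).
  rewrite sexticE /mxact !sum3 ME !mxE !big_ord_recl !big_ord0 !mxE !eqxx !inord3_eq //=.
  by congr sext; ring.
have [l lE] : {l | l = L 0 i2 + m} by exists (L 0 i2 + m).
rewrite -lE in actE.
pose pt (x y z : K) (i : 'I_3) := if i == i0 then x else if i == i1 then y else z.
have E x y z : sext (m * x) (m * y) (L 0 i0 * x + L 0 i1 * y + l * z) = c * sext x y z.
  by have := cM (pt x y z); rewrite actE sexticE /pt !eqxx !inord3_eq.
have lc : l ^+ 6 = c.
  transitivity (sext (m * 0) (m * 0) (L 0 i0 * 0 + L 0 i1 * 0 + l * 1)).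
    by rewrite /sext; ring.
  by rewrite E /sext; ring.
have l0 : l != 0 by apply: contraNneq c0 => l0; rewrite -lc l0 expr0n.
have L0 : L 0 i0 = 0.
  apply/eqP; have /eqP : L 0 i0 * l ^+ 5 = 0; last by rewrite mulf_eq0 (negbTE (expf_neq0 _ l0)) orbF.
  apply: (@quintic_coef _ _ (- (10%:R * m ^+ 3)) (m ^+ 6) c (- (10%:R * c)) c) => z.
  have := E 1 0 z; rewrite /sext => e.
  transitivity (c * (1 ^+ 6 + 0 ^+ 6 + z ^+ 6 -
    10%:R * (1 ^+ 3 * 0 ^+ 3 + 0 ^+ 3 * z ^+ 3 + z ^+ 3 * 1 ^+ 3))); last by ring.
  by rewrite -e; ring.
have L1 : L 0 i1 = 0.
  apply/eqP; have /eqP : L 0 i1 * l ^+ 5 = 0; last by rewrite mulf_eq0 (negbTE (expf_neq0 _ l0)) orbF.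
  apply: (@quintic_coef _ _ (- (10%:R * m ^+ 3)) (m ^+ 6) c (- (10%:R * c)) c) => z.
  have := E 0 1 z; rewrite /sext => e.
  transitivity (c * (0 ^+ 6 + 1 ^+ 6 + z ^+ 6 -
    10%:R * (0 ^+ 3 * 1 ^+ 3 + 1 ^+ 3 * z ^+ 3 + z ^+ 3 * 0 ^+ 3))); last by ring.
  by rewrite -e; ring.
have mc : m ^+ 6 = c.
  transitivity (sext (m * 1) (m * 0) (L 0 i0 * 1 + L 0 i1 * 0 + l * 0)).
    by rewrite L0 L1 /sext; ring.
  by rewrite E /sext; ring.
have m0 : m != 0 by apply: contraNneq c0 => m0; rewrite -mc m0 expr0n.
have m3 : l ^+ 3 = m ^+ 3.
  apply: (mulfI (expf_neq0 3 m0)); rewrite -exprD mc.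
  have n10 := natf_neq0_char0 charK (isT : 10%N != 0%N).
  apply: (mulfI n10); apply: oppr_inj.
  have := E 1 0 1; rewrite L0 L1 /sext => e.
  transitivity (c * (1 ^+ 6 + 0 ^+ 6 + 1 ^+ 6 -
    10%:R * (1 ^+ 3 * 0 ^+ 3 + 0 ^+ 3 * 1 ^+ 3 + 1 ^+ 3 * 1 ^+ 3)) - m ^+ 6 - l ^+ 6).
    by rewrite -e; ring.
  by rewrite mc lc; ring.
exists (l / m); first by rewrite expr_div_n m3 divff // expf_neq0.
split; first exact: m0.
apply/matrixP => i j; rewrite ME !mxE big_ord1 !mxE andbT.
have -> : L 0 j = (if j == i2 then l - m else 0).
  by elim/ord3P: j; rewrite ?inord3_eq //= lE addrK.
by elim/ord3P: i; elim/ord3P: j; rewrite ?eqxx ?inord3_eq /= ?mulr1n ?mulr0n; try by field.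
Qed.

(** Let a_j be the two forms of the projection and b_j their composites with [M]. The relation b_0
    a_1 = b_1 a_0 has degree 2, so it is an identity; as the a_j are independent, b_j = c a_j with
    one c. Hence the columns of M - c are multiples of [P]. *)
Lemma pencil_linear P t : P != 0 -> in_G F P t -> exists M (m : K) (L : 'rV[K]_3),
  [/\ preserves M, same_map F t (lin M) & M = m%:M + P^T *m L].
Proof.
move=> P0 [/(linear_of_birational charK) [M pM tM] [p [A [rA PA pE]] tp]].
have /same_mapP [_ _ cr] := tp; have /same_mapP [/is_ratmapP [[d ht] [i ti]] _ _] := tM.
pose a (j : 'I_2) (k : 'I_3) := A k j; pose B := M^T *m A; pose b (j : 'I_2) (k : 'I_3) := B k j.
have pa j : tnth p j = lform (a j) by rewrite pE tnth_mktuple.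
have bE j u : (lform (b j)).@[u] = (lform (a j)).@[mxact M u].
  rewrite !lform_eval /b /B; under eq_bigr => k _ do rewrite mxE mulr_suml.
  rewrite exchange_big; apply: eq_bigr => k _; rewrite /a mulr_sumr.
  by apply: eq_bigr => l _; rewrite mxE; ring.
have q0 j k : lform (b j) * lform (a k) = lform (b k) * lform (a j).
  apply/eqP; rewrite -subr_eq0; apply/eqP.
  apply: (@van_small _ charK 2) => //.
    by apply: rpredB; apply: (dhomogM (lform_homog _) (lform_homog _)).
  apply: (van_off charK ti) => u cu tu; have [c cM] := rep_at pM tM cu.
  have c0 : c != 0 by apply: contraNneq tu => c0; rewrite -/(teval t u i) cM c0 mul0r.
  have pt l : (tnth (rcomp p t) l).@[u] = c * (lform (b l)).@[u].
    rewrite tnth_mktuple comp_mpoly_meval pa -[meval _ _]/(meval (teval t u) _) (meval_eq _ cM).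
    by rewrite (homog_eval _ _ (lform_homog _)) bE.
  have := vanB_eq (cr j k) cu; rewrite !mevalM !pt !pa => e.
  by apply: (mulfI c0); rewrite mevalB !mevalM mulr0 mulrBr !mulrA e subrr.
have fA : row_free A^T by rewrite /row_free mxrank_tr rA.
have indep (e : 'I_2 -> K) : (forall k, \sum_j e j * a j k = 0) -> forall j, e j = 0.
  move=> e0 j; have : (\row_j e j) *m A^T = 0.
    apply/rowP => k; rewrite !mxE -[RHS](e0 k).
    by apply: eq_bigr => l _; rewrite !mxE.
  by move=> /eqP; rewrite mulmx_free_eq0 // => /eqP/rowP/(_ j); rewrite !mxE.
have a0 j : exists k, a j k != 0.
  apply: NNPP => no; have /eqP := oner_neq0 K; apply.
  rewrite -(indep (fun l => (l == j)%:R) _ j) ?eqxx // => k.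
  rewrite big1 // => l _; have [->|_] := eqVneq l j; last by rewrite mul0r.
  suff -> : a j k = 0 by rewrite mulr0.
  by apply/eqP; apply: contra_notT no => aj; exists k.
have prop j k : j != k -> exists c, forall l, b j l = c * a j l.
  move=> jk; have : vanish_plane (a j) (lform (b j) * lform (a k)).
    by move=> u pu; rewrite q0 mevalM (lform_eval (a j)) pu mulr0.
  case/(vanish_plane_mul (a0 j)) => /(vanish_plane_lform (a0 j)) [c cE]; first by exists c.
  have : - 1 = 0 :> K.
    rewrite -(indep (fun l => if l == j then c else - 1) _ k).
      by rewrite eq_sym (negbTE jk).
    move=> l; rewrite (bigD1 j) //= (bigD1 k) 1?eq_sym //= big1 => [|x /andP [xj xk]].
      by rewrite eqxx (negbTE jk) cE; ring.
    have := ltn_ord x; have := ltn_ord j; have := ltn_ord k; move: jk xj xk.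
    rewrite -!val_eqE /= => jk xj xk kl jl xl; exfalso.
    by move: (nat_of_ord k) (nat_of_ord x) (nat_of_ord j) jk xj xk kl jl xl; clear; lia.
  by move/eqP; rewrite oppr_eq0 oner_eq0.
pose j0 : 'I_2 := ord0; pose j1 : 'I_2 := lift ord0 ord0.
have [c cE] := prop j0 j1 isT; have [c' cE'] := prop j1 j0 isT.
have lb j e : (forall l, b j l = e * a j l) -> lform (b j) = e *: lform (a j).
  by move=> h; rewrite /lform scaler_sumr; apply: eq_bigr => l _; rewrite h scalerA.
have cc : c = c'.
  have := q0 j0 j1; rewrite (lb _ _ cE) (lb _ _ cE') -!scalerAl (mulrC (lform (a j1))) => /eqP.
  rewrite -subr_eq0 -scalerBl scaler_eq0 subr_eq0 => /orP [/eqP //|].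
  by rewrite mulf_eq0 !(negbTE (lform_neq0 (a0 _))).
have BE : (M - c%:M)^T *m A = 0.
  rewrite linearB /= tr_scalar_mx mulmxBl mul_scalar_mx -/B.
  apply/matrixP => k j; rewrite [RHS]mxE -[0](subrr (b j k)) [LHS]mxE; congr (_ + _).
  rewrite mxE [in LHS]mxE -[A k j]/(a j k); congr (- _).
  have [->|->] : j = j0 \/ j = j1.
    by case: j => [[|[|]]] //= hj; [left|right]; apply: val_inj.
  - by rewrite cE.
  by rewrite cE' cc.
have PkA : (P <= kermx A)%MS by apply/sub_kermxP.
have kAP : (kermx A <= P)%MS.
  have := mxrank_leqif_sup PkA; rewrite mxrank_ker rA rank_rV P0 => h.
  by rewrite -(geq_leqif h).
have : ((M - c%:M)^T <= P)%MS by apply: submx_trans kAP; apply/sub_kermxP.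
case/submxP => X XE; exists M, c, X^T; split=> //.
by rewrite -trmx_mul -XE trmxK addrC subrK.
Qed.

Lemma col_tr_neq0 Phi k : Phi \in unitmx -> (col k Phi)^T != 0.
Proof.
move=> uPhi; have d0 : exists i, ((i == k)%:R : K) != 0 by exists k; rewrite eqxx oner_neq0.
have [l] := mxact_neq0 uPhi d0; apply: contraNneq => /rowP/(_ l).
rewrite !mxE => P0; rewrite /mxact big1 // => j _.
by have [->|_] := eqVneq j k; rewrite ?P0 ?mul0r ?mulr0.
Qed.

Lemma in_G_conj Phi t : preserves Phi -> in_G F (col i2 Phi)^T t ->
  exists2 z, z ^+ 3 = 1 & same_map F t (lin (Phi *m homology z *m invmx Phi)).
Proof.
move=> pPhi; have uPhi := pPhi.1; have pV := preservesV pPhi.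
have P0 := col_tr_neq0 i2 uPhi.
move=> /(pencil_linear P0) [M [m [L [pM tM ME]]]].
have pN := preservesM (preservesM pV pM) pPhi.
have NE : invmx Phi *m M *m Phi = m%:M + delta_mx i2 0 *m (L *m Phi).
  rewrite ME mulmxDr mulmxDl trmxK colE; congr (_ + _).
    by rewrite -scalemx1 -scalemxAr mulmx1 -scalemxAl mulVmx.
  by rewrite !mulmxA mulVmx // mul1mx.
have [z z3 [m0 zE]] := homology_of_axis pN NE.
have pH : preserves (homology z).
  by apply: (@preserves_diag3 _ 1) => [|i]; rewrite ?oner_neq0 //; case: ifP => // _; rewrite expr1n.
exists z => //; apply: (rep_same pM tM).
have -> : M = m *: (Phi *m homology z *m invmx Phi).
  by rewrite scalemxAl scalemxAr -zE !mulmxA mulmxV // mul1mx -mulmxA mulmxV // mulmx1.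
by apply: rep_scale => //; do 2!apply: preservesM => //.
Qed.
End GaloisPoints.

Section GaloisGroups.
Variables (K : closedFieldType) (charK : [pchar K] =i pred0).
Local Notation F := (sextic K).
Implicit Types (u v : 'I_3 -> K) (M N Phi : 'M[K]_3) (z : K).
Implicit Types (s t : 3.-tuple {mpoly K[3]}) (P : 'rV[K]_3).

Lemma preserves_homology z : z ^+ 3 = 1 -> preserves (homology z).
Proof.
move=> z3; apply: (@preserves_diag3 _ _ 1); first exact: oner_neq0.
by move=> i; case: ifP => // _; rewrite expr1n.
Qed.

Definition conj_homology Phi z := Phi *m homology z *m invmx Phi.

Lemma preserves_conj Phi z : preserves Phi -> z ^+ 3 = 1 -> preserves (conj_homology Phi z).
Proof.
move=> pPhi z3; apply: preservesM (preservesV pPhi).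
by apply: preservesM pPhi _; apply: preserves_homology.
Qed.

Lemma conj_homology_in_G Phi z : preserves Phi -> z ^+ 3 = 1 ->
  in_G F (col i2 Phi)^T (lin (conj_homology Phi z)).
Proof.
move=> pPhi z3; have uPhi := pPhi.1; have pM := preserves_conj pPhi z3.
have rM := rep_refl charK pM; have inv := inverse_lin charK pM rM.
split; first by exists (lin (invmx (conj_homology Phi z))).
(* The forms X and Y composed with the inverse of [Phi]; their common zero is Phi(0,0,1). *)
pose A : 'M[K]_(3, 2) := (invmx Phi)^T *m pid_mx 2.
have uV : (invmx Phi)^T \in unitmx by rewrite unitmx_tr unitmx_inv.
have VT : Phi^T *m (invmx Phi)^T = 1%:M by rewrite -trmx_mul mulVmx // trmx1.
have rA : \rank A = 2%N.
  by rewrite (eqmxMfull _ (_ : row_full (invmx Phi)^T)) ?row_full_unit // rank_pid_mx.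
have i2E : val i2 = 2%N by rewrite /= inordK.
have PA : (col i2 Phi)^T *m A = 0.
  rewrite colE trmx_mul mulmxA -(mulmxA _ Phi^T) VT mulmx1.
  rewrite trmx_delta -rowE; apply/rowP => j; rewrite !mxE i2E ltnn andbF //.
have MA : (conj_homology Phi z)^T *m A = A.
  rewrite /conj_homology !trmx_mul /A !mulmxA -(mulmxA _ Phi^T) VT mulmx1.
  rewrite -mulmxA; congr (_ *m _); rewrite /homology /diag3 tr_diag_mx.
  apply/matrixP => i j; rewrite mul_diag_mx !mxE.
  have [->|_] := eqVneq i i2; last by rewrite mul1r.
  by rewrite i2E ltnn andbF mulr0.
clearbody A.
pose p : 2.-tuple {mpoly K[3]} := [tuple \sum_(i < 3) A i j *: 'X_i | j < 2].
exists p; first by exists A.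
have -> : rcomp p (lin (conj_homology Phi z)) = p.
  apply: eq_from_tnth => j; rewrite !tnth_mktuple; apply: mpoly_fun_inj => u.
  rewrite comp_lin_eval -!/(lform (fun i => A i j)) !lform_eval -[in RHS]MA /mxact.
  under eq_bigr => i _ do rewrite mulr_sumr.
  rewrite exchange_big; apply: eq_bigr => k _ /=; rewrite mxE mulr_suml.
  by apply: eq_bigr => i _; rewrite [in RHS]mxE mulrA [A i j * _]mulrC.
apply: same_map_refl; apply/is_ratmapP; split.
  by exists 1%N => i; rewrite tnth_mktuple; apply: lform_homog.
exists ord0; rewrite tnth_mktuple; suff A0 : exists i, A i ord0 != 0 by exact: (lform_not_van charK A0).
apply: NNPP => no; have : A *m delta_mx ord0 (0 : 'I_1) = 0.
  rewrite -colE; apply/colP => k; rewrite !mxE; apply/eqP.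
  by apply: contra_notT no => Ak; exists k.
move/(congr1 trmx); rewrite trmx_mul trmx0 => /eqP.
rewrite mulmx_free_eq0; last by rewrite /row_free mxrank_tr rA.
by rewrite trmx_delta => /eqP/rowP/(_ ord0)/eqP; rewrite !mxE oner_eq0.
Qed.

Lemma conj_homology_inj Phi y z : preserves Phi -> y ^+ 3 = 1 -> z ^+ 3 = 1 ->
  same_map F (lin (conj_homology Phi y)) (lin (conj_homology Phi z)) -> y = z.
Proof.
move=> pPhi y3 z3 yz; have uPhi := pPhi.1.
have [u cu [u0 u2]] : exists2 u : 'I_3 -> K, on_cone u & u i0 = 1 /\ u i2 = 1.
  (* F(1, b, 1) = b^6 - 20 b^3 - 8, a quadratic in b^3. *)
  have [r r0] := closed_quad (- 20%:R : K) (- 8%:R).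
  have [b b3] := closed_cbrt r.
  pose u (i : 'I_3) := if i == i1 then b else 1.
  exists u; last by rewrite /u !inord3_eq.
  split; first by exists i0; rewrite /u inord3_eq // oner_eq0.
  rewrite sexticE /u eqxx !inord3_eq //= /sext -r0.
  rewrite (exprM b 3 2) b3; ring.
pose w := mxact Phi u.
have cw : on_cone w by apply: on_cone_mxact.
have [c cE] := rep_at (preserves_conj pPhi z3) yz cw.
have cD i : mxact (homology y) u i = c * mxact (homology z) u i.
  rewrite -(mxact_invK (mxact (homology y) u) uPhi i) -(mxact_invK (mxact (homology z) u) uPhi i).
  rewrite -(mxact_scale c) /=; apply: eq_mxact => j.
  have E x k : mxact (conj_homology Phi x) w k = mxact Phi (mxact (homology x) u) k.
    rewrite !mxactM; apply: eq_mxact => l; apply: eq_mxact => m; exact: mxact_invK.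
  by have := cE j; rewrite teval_lin !E.
have c1 : c = 1.
  by have := cD i0; rewrite !mxact_diag3 inord3_eq //= u0 !mul1r mulr1 => <-.
by have := cD i2; rewrite !mxact_diag3 eqxx c1 u2 !mulr1 mul1r.
Qed.

Lemma conj_homology_in_Gn Phi z : preserves Phi -> z ^+ 3 = 1 ->
  in_Gn F 3 (lin (conj_homology Phi z)).
Proof.
move=> pPhi z3; have uPhi := pPhi.1.
have [w [w0 w1]] := cube_root1_exists charK.
have w3 := cube_root_expr3 w0.
have wk3 k : (w ^+ k) ^+ 3 = 1 by rewrite exprAC w3 expr1n.
have roots x : x ^+ 3 = 1 -> exists k : 'I_3, x = w ^+ k.
  move=> x3; have : (x - 1) * (x - w) * (x - w ^+ 2) = 0.
    transitivity (x ^+ 3 - 1 - (w ^+ 2 + w + 1) * (x ^+ 2 - w * x + w - 1)).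
      ring.
    by rewrite w0 x3; ring.
  move/eqP; rewrite !mulf_eq0 !subr_eq0 -orbA => /or3P [] /eqP ->.
  - by exists i0; rewrite inordK.
  - by exists i1; rewrite inordK.
  by exists i2; rewrite inordK.
have w21 : w ^+ 2 != 1.
  by apply: contra w1 => /eqP w2; rewrite -w3 exprSr w2 mul1r.
have winj (i j : 'I_3) : w ^+ i = w ^+ j -> i = j.
  elim/ord3P: i; elim/ord3P: j; rewrite !inordK // ?expr0 ?expr1 // => /eqP.
  - by rewrite eq_sym (negbTE w1).
  - by rewrite eq_sym (negbTE w21).
  - by rewrite (negbTE w1).
  - rewrite -[X in X == _]mulr1 expr2 => /eqP/mulfI e.
    by case/eqP: w1; rewrite e //; apply: contra_eq_neq w3 => ->; rewrite expr0n eq_sym oner_eq0.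
  - by rewrite (negbTE w21).
  rewrite -[X in _ == X]mulr1 expr2 => /eqP/mulfI e.
  by case/eqP: w1; rewrite -e //; apply: contra_eq_neq w3 => ->; rewrite expr0n eq_sym oner_eq0.
apply: generated_in; exists (col i2 Phi)^T; split.
- exact: col_tr_neq0.
- exists (lin (conj_homology Phi (w ^+ i0))), (lin (conj_homology Phi (w ^+ i1))).
  split; [exact: conj_homology_in_G|exact: conj_homology_in_G|].
  move/(conj_homology_inj pPhi (wk3 _) (wk3 _))/winj/eqP; by rewrite inord3_eq.
- exists (fun i : 'I_3 => lin (conj_homology Phi (w ^+ i))); split.
  + by move=> i; apply: conj_homology_in_G.
  + by move=> i j /(conj_homology_inj pPhi (wk3 _) (wk3 _))/winj.
  move=> t /(in_G_conj charK pPhi) [x x3 tx]; have [k kE] := roots x x3.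
  by exists k; rewrite -kE.
exact: conj_homology_in_G.
Qed.
End GaloisGroups.

(** * The Hessian *)

Section Hessian.
Variables (K : closedFieldType) (charK : [pchar K] =i pred0).
Local Notation F := (sextic K).
Implicit Types (u v n a : 'I_3 -> K) (M : 'M[K]_3) (g h : {mpoly K[3]}).

Definition hess u i j := (mderiv j (mderiv i F)).@[u].

Lemma hess_formula u i j : hess u i j =
  (i == j)%:R * (180%:R * u i ^+ 4 - 60%:R * u i * (u i0 ^+ 3 + u i1 ^+ 3 + u i2 ^+ 3))
  - 90%:R * u i ^+ 2 * u j ^+ 2.
Proof.
rewrite /hess mderiv_sextic (bigD1 i) //= big1 => [|k /negbTE ne]; last first.
  by rewrite eq_sym ne mul0r.
rewrite eqxx mul1r addr0.
have dS : mderiv j ('X_i0 ^+ 3 + 'X_i1 ^+ 3 + 'X_i2 ^+ 3 : {mpoly K[3]}) = 3%:R * 'X_j ^+ 2.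
  rewrite 2!mderivD 3!mderivXn !mderivXU.
  by elim/ord3P: (j); rewrite ?eqxx ?inord3_eq //=; ring.
have Su : ('X_i0 ^+ 3 + 'X_i1 ^+ 3 + 'X_i2 ^+ 3 : {mpoly K[3]}).@[u] = u i0 ^+ 3 + u i1 ^+ 3 + u i2 ^+ 3.
  by rewrite 2!mevalD 3!mevalXn !mevalXU.
move: ('X_i0 ^+ 3 + 'X_i1 ^+ 3 + 'X_i2 ^+ 3) dS Su => S dS <-.
have C k (p : {mpoly K[3]}) : mderiv j (k%:R * p) = k%:R * mderiv j p.
  by rewrite -mpolyC_nat 2!mul_mpolyC mderivZ.
rewrite mderivM C 1!mderivXn mderivB 2!C 1!mderivXn dS mderivXU (eq_sym j).
pose X : {mpoly K[3]} := 'X_i; pose Y : {mpoly K[3]} := 'X_j; rewrite -/X -/Y.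
pose d : {mpoly K[3]} := (i == j)%:R; rewrite -/d.
transitivity (((180%:R * X ^+ 4 - 60%:R * X * S) * d - 90%:R * X ^+ 2 * Y ^+ 2).@[u]).
  by congr (meval u _); ring.
rewrite mevalB (mevalM _ (180%:R * X ^+ 4 - 60%:R * X * S)) mevalB (mevalM _ 180%:R) (mevalM _ _ S).
rewrite (mevalM _ 60%:R) (mevalM _ _ (Y ^+ 2)) (mevalM _ 90%:R) !mevalXn !meval_nat !mevalXU.
by rewrite mulrC.
Qed.

Lemma hess_sym u i j : hess u i j = hess u j i.
Proof.
rewrite !hess_formula eq_sym; have [->|_] := eqVneq j i; first by [].
by rewrite !mul0r; ring.
Qed.

Lemma hess_row0 u i j : u i = 0 -> hess u i j = 0.
Proof. by move=> ui; rewrite hess_formula ui; ring. Qed.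

Lemma mderiv_lin M i j : mderiv j (tnth (lin M) i) = (M i j)%:MP.
Proof.
rewrite tnth_mktuple /lform (linear_sum (mderiv j)) (bigD1 j) //= big1 => [|l /negbTE ne].
  by rewrite mderivZ mderivXU eqxx addr0 -mul_mpolyC mulr1.
by rewrite mderivZ mderivXU eq_sym ne scaler0.
Qed.

Lemma hess_lin M : preserves M -> exists2 c, c != 0 & forall u j k,
  \sum_i \sum_l hess (mxact M u) i l * M l k * M i j = c * hess u j k.
Proof.
move=> /preserves_comp [c c0 cE]; exists c => // u j k.
have := congr1 (fun g => (mderiv k (mderiv j g)).@[u]) cE.
rewrite /= !mderivZ mevalZ -/(hess u j k) => <-.
rewrite mderiv_comp (linear_sum (mderiv k)) (linear_sum (meval u)) /=; apply: eq_bigr => i _.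
rewrite mderiv_lin mulrC mul_mpolyC mderivZ mevalZ mderiv_comp (linear_sum (meval u)) /= mulr_sumr.
apply: eq_bigr => l _; rewrite mderiv_lin mevalM mevalC comp_lin_eval -/(hess _ i l); ring.
Qed.

(** Where a coordinate vanishes, so does the corresponding row of the Hessian, because F depends on
    that coordinate through its cube. The kernel vector is carried back by the inverse of [M]. *)
Lemma hess_degenerate M u i : preserves M -> mxact M u i = 0 ->
  exists2 n, exists k, n k != 0 & forall j, \sum_k hess u j k * n k = 0.
Proof.
move=> pM Mu; have [uM _] := pM; have [c c0 cE] := hess_lin pM.
pose e (k : 'I_3) : K := (k == i)%:R; pose n := mxact (invmx M) e; exists n.
  by apply: mxact_neq0; rewrite ?unitmx_inv //; exists i; rewrite /e eqxx oner_neq0.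
move=> j; apply: (mulfI c0); rewrite mulr0 mulr_sumr.
under eq_bigr => k _ do rewrite mulrA -cE mulr_suml.
rewrite exchange_big big1 // => a _; under eq_bigr => k _ do rewrite mulr_suml.
rewrite exchange_big big1 // => b _.
transitivity (hess (mxact M u) a b * M a j * mxact M n b).
  by rewrite /mxact mulr_sumr; apply: eq_bigr => k _; ring.
rewrite mxact_Kinv // /e; have [->|_] := eqVneq b i; last by rewrite mulr0.
by rewrite hess_sym hess_row0 // !mul0r.
Qed.

Lemma hess_det u n : (exists k, n k != 0) -> (forall j, \sum_k hess u j k * n k = 0) ->
  u i0 * u i1 * u i2 * ((u i0 ^+ 3 + u i1 ^+ 3 + u i2 ^+ 3) ^+ 3
    - 27%:R * (u i0 * u i1 * u i2) ^+ 3) = 0.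
Proof.
(* The Hessian determinant is 4 * 30^3 times the product in the statement; the determinant times
   [n k] is 0 by Cramer's rule. *)
move=> [k nk] hn; have n0 : 4%:R * 30%:R ^+ 3 != 0 :> K.
  by rewrite mulf_neq0 ?expf_neq0 ?(natf_neq0_char0 charK).
apply: (mulfI n0); rewrite mulr0.
pose h := hess u.
have hE j : h j i0 * n i0 + h j i1 * n i1 + h j i2 * n i2 = 0 by rewrite -(hn j) sum3.
transitivity (h i0 i0 * (h i1 i1 * h i2 i2 - h i1 i2 * h i2 i1)
  - h i0 i1 * (h i1 i0 * h i2 i2 - h i1 i2 * h i2 i0)
  + h i0 i2 * (h i1 i0 * h i2 i1 - h i1 i1 * h i2 i0)).
  by rewrite /h !hess_formula ?eqxx ?inord3_eq //=; ring.
apply: (mulIf nk); rewrite mul0r.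
move: (h i0 i0) (h i0 i1) (h i0 i2) (h i1 i0) (h i1 i1) (h i1 i2) (h i2 i0) (h i2 i1) (h i2 i2)
  (hE i0) (hE i1) (hE i2) => a b c d e f p q r E0 E1 E2.
elim/ord3P: (k).
- transitivity ((e * r - f * q) * (a * n i0 + b * n i1 + c * n i2)
    - (b * r - c * q) * (d * n i0 + e * n i1 + f * n i2)
    + (b * f - c * e) * (p * n i0 + q * n i1 + r * n i2)); first by ring.
  by rewrite E0 E1 E2; ring.
- transitivity (- (d * r - f * p) * (a * n i0 + b * n i1 + c * n i2)
    + (a * r - c * p) * (d * n i0 + e * n i1 + f * n i2)
    - (a * f - c * d) * (p * n i0 + q * n i1 + r * n i2)); first by ring.
  by rewrite E0 E1 E2; ring.
transitivity ((d * q - e * p) * (a * n i0 + b * n i1 + c * n i2)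
  - (a * q - b * p) * (d * n i0 + e * n i1 + f * n i2)
  + (a * e - b * d) * (p * n i0 + q * n i1 + r * n i2)); first by ring.
by rewrite E0 E1 E2; ring.
Qed.

Lemma cube_sum_factor (w x y z : K) : w ^+ 2 + w + 1 = 0 ->
  (x + y + z) * (x + w * y + w ^+ 2 * z) * (x + w ^+ 2 * y + w * z) =
  x ^+ 3 + y ^+ 3 + z ^+ 3 - 3%:R * (x * y * z).
Proof.
move=> w0; transitivity (x ^+ 3 + y ^+ 3 + z ^+ 3 - 3%:R * (x * y * z) + (w ^+ 2 + w + 1) *
  ((x + y + z) * (x * y + x * z + (w - 1) * (y ^+ 2 + z ^+ 2) + (w ^+ 2 - w + 1) * (y * z)))).
  by ring.
by rewrite w0 mul0r addr0.
Qed.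

Lemma cube_diff_factor (w a b : K) : w ^+ 2 + w + 1 = 0 ->
  (a - b) * (a - w * b) * (a - w ^+ 2 * b) = a ^+ 3 - b ^+ 3.
Proof.
move=> w0; transitivity (a ^+ 3 - b ^+ 3 + (w ^+ 2 + w + 1) *
  ((a - b) * (- a * b + (w - 1) * b ^+ 2))); first by ring.
by rewrite w0 mul0r addr0.
Qed.

(** Among nonzero rows these are, up to scaling, the twelve lines through three of the nine base
    points of the Hesse pencil. *)
Definition flex_line a := (exists k, forall j, j != k -> a j = 0) \/
  (exists2 d, d != 0 & forall j, a j ^+ 3 = d).

(** The line given by the row lies in the zero set of the Hessian determinant. This is a product of
    twelve linear forms, and a line is irreducible, so one of the forms is proportional to the
    row. *)
Lemma row_flex_line M i : preserves M -> flex_line (M i).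
Proof.
move=> pM; have r0 := unitmx_row_neq0 i pM.1.
have [w [w0 w1]] := cube_root1_exists charK.
have w3 := cube_root_expr3 w0.
have wk3 k : (w ^+ k) ^+ 3 = 1 by rewrite exprAC w3 expr1n.
pose good g := vanish_plane (M i) g -> flex_line (M i).
have goodM g h : good g -> good h -> good (g * h).
  by move=> gg gh /(vanish_plane_mul r0) [].
pose a b c (j : 'I_3) : K := if j == i0 then 1 else if j == i1 then w ^+ b else w ^+ c.
pose l b c := lform (a b c).
have goodX k : good 'X_k.
  move=> vX; left; exists k => j jk.
  have /(vanish_plane_lform r0) [c cE] : vanish_plane (M i) (lform (fun j => (j == k)%:R)).
    move=> v /vX; rewrite mevalXU lform_eval (bigD1 k) //= big1 => [->|m /negbTE ->].
      by rewrite mulr0 addr0.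
    by rewrite mul0r.
  have c0 : c != 0.
    by apply/eqP => c0; have /eqP := cE k; rewrite eqxx c0 mul0r oner_eq0.
  by apply: (mulfI c0); rewrite -cE (negbTE jk) mulr0.
have goodl b c : good (l b c).
  move=> /(vanish_plane_lform r0) [d dE]; right.
  have d0 : d != 0.
    by apply/eqP => d0; have /eqP := dE i0; rewrite /a eqxx d0 mul0r oner_eq0.
  exists (d^-1 ^+ 3) => [|j]; first by rewrite expf_neq0 // invr_eq0.
  rewrite -[M i j](mulKf d0) -dE exprMn -[RHS]mulr1; congr (_ * _).
  by rewrite /a; case: ifP => _; [rewrite expr1n | case: ifP => _].
have : good ('X_i0 * 'X_i1 * 'X_i2 * ((l 0%N 0%N * l 1%N 2%N * l 2%N 1%N) *
  (l 0%N 1%N * l 1%N 0%N * l 2%N 2%N) * (l 0%N 2%N * l 1%N 1%N * l 2%N 0%N))).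
  have goodL (b b1 c c1 d d1 : nat) : good (l b c * l b1 c1 * l d d1).
    by apply: (goodM); [apply: (goodM)|]; exact: (goodl).
  apply: (goodM); first by apply: (goodM); [apply: (goodM)|]; exact: (goodX).
  by apply: (goodM); [apply: (goodM)|]; exact: (goodL).
apply => u pu.
have Mu : mxact M u i = 0 by [].
have [n n0 hn] := hess_degenerate pM Mu; rewrite -[RHS](hess_det n0 hn).
have lE b c : (l b c).@[u] = u i0 + w ^+ b * u i1 + w ^+ c * u i2.
  by rewrite /l lform_eval sum3 /a ?eqxx ?inord3_eq //= mul1r.
rewrite !mevalM !lE !mevalXU; congr (_ * _); rewrite !expr0 !expr1 !mul1r.
move: (u i0) (u i1) (u i2) => x y z.
have h1 : w ^+ 2 * (w * z) = z by rewrite mulrA -exprSr w3 mul1r.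
have h2 : w * (w * z) = w ^+ 2 * z by rewrite mulrA.
have h3 : w ^+ 2 * (w ^+ 2 * z) = w * z by rewrite -[in RHS]h1; ring.
have h4 : w * (w ^+ 2 * z) = z by rewrite -[RHS]h1; ring.
have e1 := cube_sum_factor x y z w0.
(* Replacing z by w z and by w^2 z passes from one triangle of the Hesse pencil to the two others;
   the three cubics multiply to a difference of cubes. *)
have e2 := cube_sum_factor x y (w * z) w0; rewrite h1 h2 exprMn w3 mul1r in e2.
have e3 := cube_sum_factor x y (w ^+ 2 * z) w0; rewrite h3 h4 exprMn wk3 mul1r in e3.
rewrite e1 e2 e3.
transitivity ((x ^+ 3 + y ^+ 3 + z ^+ 3) ^+ 3 - (3%:R * (x * y * z)) ^+ 3); last by ring.
by rewrite -(cube_diff_factor _ _ w0); congr (_ * _ * _); ring.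
Qed.
End Hessian.

(** * Generation by homologies of order 3 *)

Section GaloisGenerated.
Variables (K : closedFieldType) (charK : [pchar K] =i pred0).
Local Notation F := (sextic K).
Implicit Types (u v d : 'I_3 -> K) (M N A Phi : 'M[K]_3) (z : K).
Implicit Types (s t : 3.-tuple {mpoly K[3]}).

Definition galois_gen M := preserves M /\ in_Gn F 3 (lin M).

Lemma galois_genM M N : galois_gen M -> galois_gen N -> galois_gen (M *m N).
Proof.
move=> [pM gM] [pN gN]; split; first exact: preservesM.
by rewrite -rcomp_lin; apply: generated_comp.
Qed.

Lemma galois_genZ c M : c != 0 -> galois_gen M -> galois_gen (c *: M).
Proof.
move=> c0 [pM gM]; split; first exact: preservesZ.
by apply: (generated_same gM); apply: rep_scale.
Qed.

Lemma galois_genV M : galois_gen M -> galois_gen (invmx M).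
Proof.
move=> [pM gM]; have pV := preservesV pM; split; first exact: pV.
apply: (generated_inv gM); have := inverse_lin charK pV (rep_refl charK pV).
by rewrite invmxK.
Qed.

Lemma galois_gen_right A M : galois_gen A -> galois_gen (M *m A) -> galois_gen M.
Proof.
move=> gA /galois_genM /(_ (galois_genV gA)).
by rewrite mulmxK // gA.1.1.
Qed.

Lemma galois_gen_conj Phi z : preserves Phi -> z ^+ 3 = 1 -> galois_gen (conj_homology Phi z).
Proof. by move=> pPhi z3; split; [exact: preserves_conj|exact: conj_homology_in_Gn]. Qed.

Lemma preserves_perm (s : 'S_3) : preserves (perm_mx s : 'M[K]_3).
Proof.
split; first exact: unitmx_perm.
exists 1 => [|u]; first exact: oner_neq0.
have aE : mxact (perm_mx s) u =1 (fun i => u (s i)).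
  move=> i; rewrite /mxact (bigD1 (s i)) //= big1 => [|j ne]; rewrite !mxE ?eqxx ?mul1r ?addr0 //.
  by rewrite eq_sym (negbTE ne) mul0r.
by rewrite mul1r (meval_eq _ aE) -(sextic_perm s u).
Qed.

Lemma galois_gen_reflection k z : z ^+ 3 = 1 ->
  galois_gen (diag3 (fun i => if i == k then z else 1)).
Proof.
move=> z3; have := galois_gen_conj (preserves_perm (tperm k i2)) z3.
suff -> : conj_homology (perm_mx (tperm k i2)) z = diag3 (fun i => if i == k then z else 1) by [].
apply: (canLR (mulmxK (unitmx_perm _ _))); apply/matrixP => i j.
rewrite mul_mx_diag mul_diag_mx !mxE.
have [ij|] := eqVneq (tperm k i2 i) j; last by rewrite !(mulr0, mul0r).
rewrite mulr1 mul1r -ij; congr (if _ then _ else _).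
by rewrite -(inj_eq (@perm_inj _ (tperm k i2))) tpermK tpermR.
Qed.

Lemma galois_gen_diag d c : c != 0 -> (forall i, d i ^+ 3 = c) -> galois_gen (diag3 d).
Proof.
move=> c0 dc; have d0 i : d i != 0.
  by apply: contraNneq c0 => d0; rewrite -(dc i) d0 expr0n.
have z3 k : (d k / d i2) ^+ 3 = 1 by rewrite expr_div_n !dc divff.
have := galois_genZ (d0 i2) (galois_genM (galois_gen_reflection i0 (z3 i0))
  (galois_gen_reflection i1 (z3 i1))).
congr galois_gen; apply/matrixP => i j; rewrite mxE /diag3 mul_diag_mx !mxE.
have [_|_] := eqVneq i j; last by rewrite !(mulr0, mulr0n).
rewrite !mulr1n; elim/ord3P: i; rewrite ?eqxx ?inord3_eq //=.
- by field.
- by field.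
by rewrite !mulr1.
Qed.

(** * The reflection group generated by homologies of order 3 *)

Section Omega.
Variable w : K.
Hypotheses (w0 : w ^+ 2 + w + 1 = 0) (w1 : w != 1).

Lemma omega_sqr : w ^+ 2 = - w - 1.
Proof. by apply/eqP; rewrite -subr_eq0 -w0; apply/eqP; ring. Qed.

(** The Fourier matrix of Z/3, with indices shifted so that the trivial character comes last; it
    sends (0,0,1) to (1,1,1). *)
Definition fourier : 'M[K]_3 := \matrix_(i, j) w ^+ (i.+1 * j.+1).

Lemma fourierE : [/\ fourier i0 i0 = w, fourier i0 i1 = w ^+ 2 & fourier i0 i2 = 1] /\
  [/\ fourier i1 i0 = w ^+ 2, fourier i1 i1 = w & fourier i1 i2 = 1] /\
  [/\ fourier i2 i0 = 1, fourier i2 i1 = 1 & fourier i2 i2 = 1].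
Proof. by do !split; rewrite mxE !inordK //; ring: omega_sqr. Qed.

Lemma preserves_fourier : preserves fourier.
Proof.
have [[a00 a01 a02] [[a10 a11 a12] [a20 a21 a22]]] := fourierE; have w2 := omega_sqr.
move: fourier a00 a01 a02 a10 a11 a12 a20 a21 a22 => Q a00 a01 a02 a10 a11 a12 a20 a21 a22.
have n3 := natf_neq0_char0 charK (isT : 3%N != 0%N).
split.
  rewrite -row_free_unit; apply: inj_row_free => v /rowP v0.
  have E j : v 0 i0 * Q i0 j + v 0 i1 * Q i1 j + v 0 i2 * Q i2 j = 0.
    by have := v0 j; rewrite !mxE sum3.
  have := (E i0, E i1, E i2); rewrite a00 a01 a02 a10 a11 a12 a20 a21 a22 => -[[E0 E1] E2].
  (* The inverse Fourier transform recovers 3 times each coordinate of [v]. *)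
  apply/rowP => k; rewrite mxE; apply: (mulfI n3); rewrite mulr0.
  elim/ord3P: k.
  - transitivity (w ^+ 2 * 0 + w * 0 + 0 : K); last by ring.
    by rewrite -{1}E0 -{1}E1 -{1}E2; ring: w2.
  - transitivity (w * 0 + w ^+ 2 * 0 + 0 : K); last by ring.
    by rewrite -{1}E0 -{1}E1 -{1}E2; ring: w2.
  transitivity (0 + 0 + 0 : K); last by ring.
  by rewrite -{1}E0 -{1}E1 -{1}E2; ring: w2.
exists (- 27%:R) => [|u]; first by rewrite oppr_eq0 (natf_neq0_char0 charK).
rewrite !sexticE /mxact !sum3 a00 a01 a02 a10 a11 a12 a20 a21 a22 /sext.
move: (u i0) (u i1) (u i2) => x y z.
ring: w2.
Qed.

(** The homology with axis x + y + z = 0 and centre (1,1,1), where its eigenvalue is 1 + 3 (w - 1)/3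
    = w. *)
Definition flex_reflection : 'M[K]_3 := \matrix_(i, j) ((i == j)%:R + (w - 1) / 3%:R).

Lemma galois_gen_flex_reflection : galois_gen flex_reflection.
Proof.
have pQ := preserves_fourier; have [[a00 a01 a02] [[a10 a11 a12] [a20 a21 a22]]] := fourierE.
move: fourier pQ a00 a01 a02 a10 a11 a12 a20 a21 a22 => Q pQ a00 a01 a02 a10 a11 a12 a20 a21 a22.
have := galois_gen_conj pQ (cube_root_expr3 w0); congr galois_gen.
have w2 := omega_sqr; have n3 := natf_neq0_char0 charK (isT : 3%N != 0%N).
apply: (canLR (mulmxK pQ.1)); apply/matrixP => i j.
rewrite /homology /diag3 mul_mx_diag !mxE sum3 !mxE; apply: (mulfI n3).
transitivity (3%:R * ((i == i0)%:R * Q i0 j + (i == i1)%:R * Q i1 j + (i == i2)%:R * Q i2 j)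
  + (w - 1) * (Q i0 j + Q i1 j + Q i2 j)); last by field.
elim/ord3P: i; elim/ord3P: j; rewrite ?eqxx ?inord3_eq //= ?a00 ?a01 ?a02 ?a10 ?a11 ?a12 ?a20 ?a21 ?a22;
  ring: w2.
Qed.

Definition swap01 : 'M[K]_3 := perm_mx (tperm i0 i1).

Lemma perm_mx_entry (s : 'S_3) i j : (perm_mx s : 'M[K]_3) i j = (s i == j)%:R.
Proof. by rewrite !mxE. Qed.

(* The reflections with centers (0,0,1) and (1,1,1) generate SL(2,3) on the plane x = y,
   whose central involution is, up to a scalar, the transposition of x and y. *)
Lemma galois_gen_swap01 : galois_gen swap01.
Proof.
have w2 := omega_sqr; have w3 := cube_root_expr3 w0; have wn0 := cube_root_neq0 w0.
have n3 := natf_neq0_char0 charK (isT : 3%N != 0%N).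
pose t := (w - 1) / 3%:R; pose D := diag3 (fun i => if i == i2 then w else 1).
have t0 : t != 0 by rewrite mulf_neq0 ?invr_eq0 // subr_eq0.
have gD : galois_gen D by apply: galois_gen_reflection.
have gU := galois_genM (galois_genM gD galois_gen_flex_reflection) gD.
have UE : D *m flex_reflection *m D = t *: \matrix_(i, j)
    (if (i == i2) || (j == i2) then w else if i == j then w ^+ 2 else 1).
  apply/matrixP => i j; rewrite /D /diag3 mul_mx_diag mul_diag_mx !mxE.
  apply: (mulfI n3); rewrite /t.
  elim/ord3P: i; elim/ord3P: j; rewrite ?eqxx ?inord3_eq //=; field: w2; exact: n3.
rewrite UE in gU; have := galois_genM gU gU.
rewrite -scalemxAl -scalemxAr scalerA.
have -> : (\matrix_(i, j) (if (i == i2) || (j == i2) then w else if i == j then w ^+ 2 else 1) : 'M[K]_3) *m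
    (\matrix_(i, j) (if (i == i2) || (j == i2) then w else if i == j then w ^+ 2 else 1)) =
    (3%:R * w ^+ 2) *: swap01.
  apply/matrixP => i j; rewrite !mxE sum3 !mxE /= permE /=.
  by elim/ord3P: i; elim/ord3P: j; rewrite ?eqxx ?inord3_eq //= ?eqxx ?inord3_eq //=; ring: w2.
rewrite scalerA; set c := t * t * _ => gc.
have c0 : c != 0 by apply: mulf_neq0 (mulf_neq0 t0 t0) (mulf_neq0 n3 (expf_neq0 2 wn0)).
by rewrite -[swap01](scalerK c0); apply: galois_genZ; rewrite ?invr_eq0.
Qed.

(** For k other than the last index, [u], the preimage of the k-th unit vector e_k, has last
    coordinate 0, so the partial derivative of F in Z vanishes at [u]. By the chain rule it is, up
    to a nonzero factor, 6 times the entry of the last column in row k. *)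
Lemma last_column_eq0 M : preserves M -> M i2 i0 = 0 -> M i2 i1 = 0 -> M i0 i2 = 0 /\ M i1 i2 = 0.
Proof.
move=> pM m20 m21; have uM := pM.1.
have m22 : M i2 i2 != 0.
  have [j] := unitmx_row_neq0 i2 uM; elim/ord3P: j => //; by rewrite ?m20 ?m21 eqxx.
have [c c0 cE] := preserves_comp pM.
have n6 := natf_neq0_char0 charK (isT : 6%N != 0%N).
suff M2 k : k != i2 -> M k i2 = 0 by split; apply: M2; rewrite inord3_eq.
move=> k2; pose e (i : 'I_3) : K := (i == k)%:R; pose u := mxact (invmx M) e.
have u2 : u i2 = 0.
  have := mxact_Kinv e uM i2; rewrite -/u /mxact sum3 m20 m21 !mul0r !add0r /e eq_sym (negbTE k2).
  by move/eqP; rewrite mulf_eq0 (negbTE m22) => /eqP.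
have ge i : grad e i = 6%:R * (i == k)%:R.
  rewrite grad_formula /e; elim/ord3P: i; elim/ord3P: (k) ; rewrite ?eqxx ?inord3_eq //=; ring.
have := congr1 (fun g => (mderiv i2 g).@[u]) cE.
rewrite /= mderivZ mevalZ -/(grad u i2) grad_formula u2 expr0n /= mulr0 mul0r mulr0.
rewrite mderiv_comp (linear_sum (meval u)) (bigD1 k) //= big1 => [|i ik].
  rewrite addr0 mevalM comp_lin_eval (meval_eq _ (mxact_Kinv e uM)) -/(grad e k) ge eqxx mulr1.
  rewrite mderiv_lin mevalC => /eqP; rewrite mulf_eq0 (negbTE n6) => /eqP //.
by rewrite mevalM comp_lin_eval (meval_eq _ (mxact_Kinv e uM)) -/(grad e i) ge (negbTE ik) mulr0 mul0r.
Qed.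

Lemma preserves_diag_cubes d : preserves (diag3 d) -> exists2 c, c != 0 & forall i, d i ^+ 3 = c.
Proof.
move=> [uD [c c0 cE]].
have E u : sext (d i0 * u i0) (d i1 * u i1) (d i2 * u i2) = c * sext (u i0) (u i1) (u i2).
  by rewrite -sexticE -cE sexticE !mxact_diag3.
pose e a b g (i : 'I_3) : K := if i == i0 then a else if i == i1 then b else g.
have {}E a b g : sext (d i0 * a) (d i1 * b) (d i2 * g) = c * sext a b g.
  by have := E (e a b g); rewrite /e !eqxx !inord3_eq.
have n10 := natf_neq0_char0 charK (isT : 10%N != 0%N).
have E0 : d i0 ^+ 6 = c.
  transitivity (sext (d i0 * 1) (d i1 * 0) (d i2 * 0)); first by rewrite /sext; ring.
  by rewrite E /sext; ring.
have E1 : d i1 ^+ 6 = c.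
  transitivity (sext (d i0 * 0) (d i1 * 1) (d i2 * 0)); first by rewrite /sext; ring.
  by rewrite E /sext; ring.
have E2 : d i2 ^+ 6 = c.
  transitivity (sext (d i0 * 0) (d i1 * 0) (d i2 * 1)); first by rewrite /sext; ring.
  by rewrite E /sext; ring.
have d0 : d i0 != 0 by apply: contraNneq c0 => d0; rewrite -E0 d0 expr0n.
exists (d i0 ^+ 3) => [|i]; first by rewrite expf_neq0.
apply: (mulfI (expf_neq0 3 d0)); rewrite -exprD E0; apply: (mulfI n10).
elim/ord3P: i.
- by rewrite -exprD E0.
- transitivity (d i0 ^+ 6 + d i1 ^+ 6 - sext (d i0 * 1) (d i1 * 1) (d i2 * 0)).
    by rewrite /sext; ring.
  by rewrite E E0 E1 /sext; ring.
transitivity (d i0 ^+ 6 + d i2 ^+ 6 - sext (d i0 * 1) (d i1 * 0) (d i2 * 1)).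
  by rewrite /sext; ring.
by rewrite E E0 E2 /sext; ring.
Qed.

(** The first two rows have last entry 0, so as lines of the Hessian they have a single nonzero
    entry: [M] is diagonal, or becomes so after exchanging x and y. *)
Lemma galois_gen_block M : preserves M -> M i2 i0 = 0 -> M i2 i1 = 0 -> galois_gen M.
Proof.
move=> pM m20 m21; have [m02 m12] := last_column_eq0 pM m20 m21; have uM := pM.1.
have col_neq0 j : exists i, M i j != 0.
  have uT : M^T \in unitmx by rewrite unitmx_tr.
  by have [i] := unitmx_row_neq0 j uT; rewrite mxE; exists i.
have flex i : M i i2 = 0 -> M i i0 = 0 \/ M i i1 = 0.
  move=> mi2; have [[k kE]|[d d0 dE]] := row_flex_line charK i pM; last first.
    by case/eqP: d0; rewrite -(dE i2) mi2 expr0n.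
  by elim/ord3P: k kE => kE; [right|left|left]; apply: kE; rewrite inord3_eq.
have diag N : preserves N -> (forall i j, i != j -> N i j = 0) -> galois_gen N.
  move=> pN N0; have NE : N = diag3 (fun i => N i i).
    apply/matrixP => i j; rewrite !mxE; have [->|ij] := eqVneq i j; first by [].
    by rewrite N0.
  rewrite NE in pN *; have [c c0 cE] := preserves_diag_cubes pN.
  exact: galois_gen_diag c0 cE.
have [k] := col_neq0 i0; have [l] := col_neq0 i1.
have [m00|m01] := flex i0 m02; have [m10|m11] := flex i1 m12.
- by move=> _; elim/ord3P: k; rewrite ?m00 ?m10 ?m20 eqxx.
- move=> _ _; apply: (galois_gen_right galois_gen_swap01); apply: diag.
    exact: preservesM pM galois_gen_swap01.1.
  move=> i j ij; rewrite mxE sum3 !perm_mx_entry tpermL tpermR tpermD ?inord3_eq //.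
  move: ij; elim/ord3P: i; elim/ord3P: j; rewrite ?eqxx ?inord3_eq //= => _;
    by rewrite ?m00 ?m11 ?m02 ?m12 ?m20 ?m21 !(mulr0, mul0r, addr0).
- move=> _ _; apply: diag => // i j.
  by elim/ord3P: i; elim/ord3P: j; rewrite ?eqxx ?inord3_eq.
by elim/ord3P: l; rewrite ?m01 ?m11 ?m21 eqxx.
Qed.

Lemma galois_gen_flex_row M c : preserves M -> c != 0 -> (forall j, M i2 j ^+ 3 = c) ->
  galois_gen M.
Proof.
move=> pM c0 mc; have w2 := omega_sqr; have w3 := cube_root_expr3 w0.
have n3 := natf_neq0_char0 charK (isT : 3%N != 0%N).
have r0 j : M i2 j != 0.
  by apply: contraNneq c0 => r0; rewrite -(mc j) r0 expr0n.
(* This scales the last row to a multiple of (1, 1, w). As (2 + w)(w - 1) = -3, [flex_reflection]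
   then subtracts (1, 1, 1) and leaves (0, 0, w - 1). *)
pose d j := (if j == i2 then w else 1) * (M i2 i2 / M i2 j).
have gD : galois_gen (diag3 d).
  apply: (galois_gen_diag (oner_neq0 K)) => j.
  rewrite /d exprMn expr_div_n !mc divff // mulr1.
  by case: ifP => _; rewrite ?w3 ?expr1n.
have gA := galois_genM gD galois_gen_flex_reflection.
have E j : (M *m (diag3 d *m flex_reflection)) i2 j = M i2 i2 *
    ((i0 == j)%:R + (i1 == j)%:R + w * (i2 == j)%:R + (2%:R + w) * ((w - 1) / 3%:R)).
  rewrite mxE sum3 /diag3 mul_diag_mx !mxE /d ?eqxx ?inord3_eq //=.
  by field; rewrite n3 !r0.
apply: (galois_gen_right gA); apply: galois_gen_block.
- exact: preservesM pM gA.1.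
- by rewrite E ?eqxx ?inord3_eq //=; apply/eqP; rewrite mulf_eq0 (negbTE (r0 _)); apply/eqP; field: w2.
by rewrite E ?eqxx ?inord3_eq //=; apply/eqP; rewrite mulf_eq0 (negbTE (r0 _)); apply/eqP; field: w2.
Qed.

Lemma preserves_galois_gen M : preserves M -> galois_gen M.
Proof.
move=> pM; have w2 := omega_sqr; have w3 := cube_root_expr3 w0.
have n3 := natf_neq0_char0 charK (isT : 3%N != 0%N).
have [[k kE]|[c c0 mc]] := row_flex_line charK i2 pM; last exact: galois_gen_flex_row c0 mc.
have mk : M i2 k != 0.
  have [j] := unitmx_row_neq0 i2 pM.1; have [->//|jk] := eqVneq j k.
  by rewrite kE ?eqxx.
have pMR := preservesM pM galois_gen_flex_reflection.1.
pose t := (w - 1) / 3%:R.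
have t0 : t != 0 by rewrite mulf_neq0 ?invr_eq0 // subr_eq0.
apply: (galois_gen_right galois_gen_flex_reflection).
(* The row has one nonzero entry, so after the reflection its entries are proportional to 1 + t and
   t. Their cubes agree because 1 + t = w^2 t. *)
apply: (@galois_gen_flex_row _ ((M i2 k * t) ^+ 3) pMR) => [|j].
  exact: expf_neq0 (mulf_neq0 mk t0).
rewrite mxE (bigD1 k) //= big1 => [|l lk]; last by rewrite kE ?mul0r.
rewrite addr0 mxE !exprMn; congr (_ * _).
have [_|_] := eqVneq k j; last by rewrite mulr0n add0r exprMn.
by rewrite mulr1n; field: w2.
Qed.
End Omega.
End GaloisGenerated.

Theorem theorem4p13 (K : closedFieldType) (charK : [pchar K] =i pred0) :
  forall t : 3.-tuple {mpoly K[3]},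
    in_Gn (sextic K) 3 t <-> in_Aut (sextic K) t.
Proof.
move=> t; split=> [gt|[s [_ _ inv]]].
  have inB s : (exists P : 'rV[K]_3, [/\ P != 0, quasi_Galois (sextic K) P,
      has_card (sextic K) (in_G (sextic K) P) 3 & in_G (sextic K) P s]) -> in_Bir (sextic K) s.
    by move=> [P [_ _ _ []]].
  have [M pM tM] := generated_linear charK inB gt.
  exact: automorphism_of_linear pM tM.
have [M pM tM] := linear_of_birational charK (ex_intro _ s inv).
have [w [w0 w1]] := cube_root1_exists charK.
have [_ gM] := preserves_galois_gen charK w0 w1 pM.
exact: generated_same gM (rep_same pM (rep_refl charK pM) tM).
Qed.
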